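(* Let $U\subset\mathbb R^2$ be a bounded domain, $Q(u_1,u_2)=\frac12(\lambda_1u_1^2+\lambda_2u_2^2)$ with $\lambda_1\lambda_2>0$, $S_Q=\{(u_1,u_2,Q(u_1,u_2)):u\in U\}$, and $\mu_Q=\chi\,\mathcal H^2\lfloor S_Q$, where $\chi\in L^\infty(S_Q)$ is measurable, nonnegative, and compactly supported in the patch $S_Q$. There exist $R_0\ge1$, depending only on the model ($Q$, $U$, $\chi$) and on the constants of the frequency partition, and a constant $C$ independent of $R$ and $f$, such that for every $R\ge R_0$ and every $f\in L^2(\mathbb R^3)$ with $\operatorname{supp}\widehat f\subset\Sigma_R$ one has $$\|\mathcal G_R f\|_{L^2(\mathrm d\mu_Q)}\le C R^{1/8}\|f\|_{L^2(\mathbb R^3)}.$$ For $1\le R<R_0$ the same estimate holds after modifying $C$. Moreover, if $\chi$ is bounded below by a positive constant in a surface neighbourhood of a tangency point, then there exist a constant $c>0$ independent of $R$ and a family of nonzero functions $f_R\in L^2(\mathbb R^3)$ ($R$ sufficiently large), each microlocalized in a single frequency box $\Theta$ of the parabolic decomposition (i.e. $\operatorname{supp}\widehat{f_R}\subset\Theta$ for one box $\Theta$), such that $$\|\mathcal G_R f_R\|_{L^2(\mathrm d\mu_Q)}\ge c R^{1/8}\|f_R\|_{L^2(\mathbb R^3)}.$$ Consequently, the exponent $1/8$ in the upper bound is optimal for this model, this parabolic scale and this angular square function.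
   Context: Fourier transform: $\widehat f(\xi)=\int_{\mathbb R^3}f(x)e^{-2\pi i x\cdot\xi}\,\mathrm dx$. For $R\ge1$ let $\Sigma_R=\{\xi\in\mathbb R^3:||\xi|-R|\le1\}$. Frequency boxes and partition: for each $R$, the sphere $\{|\xi|=R\}$ is covered by a finite family of caps of angular aperture comparable to $R^{-1/2}$ with finite overlap; to each cap is associated a frequency box $\Theta\subset\Sigma_R$, an anisotropic box adapted to the local geometry of the annulus, of dimensions comparable to $R^{1/2}\times R^{1/2}\times 1$ (the side of length $\sim1$ being radial), containing the radial thickening of the cap. The number of boxes is of order $R$ and they cover $\Sigma_R$. There are fixed smooth functions $\psi_\Theta\in C_c^\infty(C_1\Theta)$ ($C_1\Theta$ a concentric dilation by a fixed constant), with $0\le\psi_\Theta\le1$, $\sum_\Theta\psi_\Theta=1$ on $\Sigma_R$, uniformly finite overlap, uniform derivative bounds after rescaling the box to unit size, and an interior plateau: for each $\Theta$ there is a concentric subbox $\Theta^\circ\Subset\Theta$, separated from $\partial\Theta$ by a fixed fraction of the anisotropic dimensions of $\Theta$, with $\psi_\Theta=1$ on $\Theta^\circ$. All these constants (the ''constants of the frequency partition'') are fixed independently of $R$. For $f$ with $\operatorname{supp}\widehat f\subset\Sigma_R$, define $\widehat{f_\Theta}=\psi_\Theta\widehat f$ and $\mathcal G_Rf(x)=\big(\sum_\Theta|f_\Theta(x)|^2\big)^{1/2}$. A tangency point is a point $x_0\in S_Q$ together with a unit vector $v_0\in T_{x_0}S_Q$ (a tangent direction at $x_0$). ''$\chi$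 compactly supported in the patch'' means there is an open $U_0$ with compact closure in $U$ such that $\operatorname{supp}\chi\subset\{(u,Q(u)):u\in U_0\}$. *)

(* Defs.v *)
From HB Require Import structures.
From mathcomp Require Import all_boot all_order all_algebra.
From mathcomp Require Import complex.
From mathcomp Require Import all_classical all_reals all_analysis measurable_realfun.
Import Order.TTheory GRing.Theory Num.Theory numFieldNormedType.Exports.

Set Implicit Arguments.
Unset Strict Implicit.
Unset Printing Implicit Defensive.

Local Open Scope classical_set_scope.
Local Open Scope ring_scope.
Local Open Scope complex_scope.

Section EuclideanSpace.
Context {R : realType}.

(* A point (u1, u2, z) is a nested pair ((u1, u2), z). The library norm on
   products is the sup norm, hence the separate Euclidean structure below. *)
Definition R3 : Type := (R * R * R)%type.

Definition dot (x y : R3) : R :=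
  x.1.1 * y.1.1 + x.1.2 * y.1.2 + x.2 * y.2.

Definition enorm (x : R3) : R := Num.sqrt (dot x x).

Definition eucl_dist (x y : (R * R * R)%type) : R := enorm (x - y).

Definition basis3 : seq (R * R * R) := [:: (1, 0, 0); (0, 1, 0); (0, 0, 1)].

Definition borelR3 :=
  (measurableTypeR R * measurableTypeR R * measurableTypeR R)%type.

Definition lebesgue2 :
    {measure set (measurableTypeR R * measurableTypeR R) -> \bar R} :=
  (@lebesgue_measure R \x @lebesgue_measure R)%E.

Definition lebesgue3 : {measure set borelR3 -> \bar R} :=
  (lebesgue2 \x @lebesgue_measure R)%E.

(* Support of the class of f modulo a family of null sets: the complement of
   the largest open set on which f vanishes almost everywhere. *)
Definition ess_support (null : set (set R3)) (V : nmodType) (f : R3 -> V) :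
    set R3 :=
  [set x | forall A : set (R * R * R), nbhs (x : R * R * R) A ->
     ~ null (A `&` [set y | f y != 0])].

End EuclideanSpace.
Arguments R3 : clear implicits.
Arguments borelR3 : clear implicits.
Arguments lebesgue2 : clear implicits.
Arguments lebesgue3 : clear implicits.

Section Hausdorff.
Context {R : realType}.
Local Open Scope ereal_scope.

(* The 0 makes the diameter of the empty set 0 instead of -oo. *)
Definition ediam (A : set (R3 R)) : \bar R :=
  ereal_sup (0 |` [set (eucl_dist p.1 p.2)%:E | p in A `*` A]).

(* pi / 4 is the area of a disc of unit diameter: with this normalization the
   measure agrees with the surface area on smooth surfaces. *)
Definition hausdorff2_gauge (A : set (R3 R)) : \bar R :=
  (pi / 4)%:E * (ediam A * ediam A).

Definition delta_cover (delta : R) (A : set (R3 R)) : set (set (R3 R))^nat :=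
  [set F | A `<=` \bigcup_i F i /\ forall i, ediam (F i) <= delta%:E].

Definition hausdorff2_pre (delta : R) (A : set (R3 R)) : \bar R :=
  ereal_inf [set \sum_(i <oo) hausdorff2_gauge (F i) | F in delta_cover delta A].

Definition hausdorff2 (A : set (R * R * R)) : \bar R :=
  ereal_sup [set hausdorff2_pre delta A | delta in [set d : R | (0 < d)%R]].

Lemma ediam_ge0 A : 0 <= ediam A.
Proof. by apply: ereal_sup_ubound; left. Qed.

Lemma ediam0 : ediam set0 = 0.
Proof.
rewrite /ediam set0X image_set0 setU0; exact: ereal_sup1.
Qed.

Lemma hausdorff2_gauge_ge0 A : 0 <= hausdorff2_gauge A.
Proof.
rewrite mule_ge0 ?mule_ge0 ?ediam_ge0 // lee_fin divr_ge0 //; exact: pi_ge0.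
Qed.

#[local] Hint Resolve hausdorff2_gauge_ge0 : core.

Lemma hausdorff2_gauge0 : hausdorff2_gauge set0 = 0.
Proof. by rewrite /hausdorff2_gauge ediam0 mul0e mule0. Qed.

Lemma hausdorff2_pre_ge0 delta A : 0 <= hausdorff2_pre delta A.
Proof.
apply: le_ereal_inf_tmp => _ [F _ <-].
by apply: nneseries_ge0 => n _ _; exact: hausdorff2_gauge_ge0.
Qed.

Lemma hausdorff2_pre0 delta : (0 < delta)%R -> hausdorff2_pre delta set0 = 0.
Proof.
move=> d0; apply/eqP; rewrite eq_le hausdorff2_pre_ge0 andbT.
apply: ereal_inf_lbound; exists (fun=> set0).
  by split => // i; rewrite ediam0 lee_fin ltW.
by apply: eseries0 => i _ _; exact: hausdorff2_gauge0.
Qed.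

Lemma le_hausdorff2_pre delta :
  {homo hausdorff2_pre delta : A B / A `<=` B >-> A <= B}.
Proof.
move=> A B AB; apply: ereal_inf_le_tmp => _ [F [BF dF] <-].
by exists F => //; split => //; exact: subset_trans BF.
Qed.

Lemma hausdorff2_pre_sigma_subadditive delta :
  sigma_subadditive (hausdorff2_pre delta).
Proof.
move=> A; have [[i ioo]|] := pselect (exists i, hausdorff2_pre delta (A i) = +oo).
  rewrite (eseries_pinfty _ _ ioo) ?leey// => n _.
  by rewrite -ltNye (lt_le_trans _ (hausdorff2_pre_ge0 _ _)).
rewrite -forallNE => Aoo.
suff add2e (e : {posnum R}) :
    hausdorff2_pre delta (\bigcup_n A n) <=
    \sum_(i <oo) hausdorff2_pre delta (A i) + e%:num%:E.
  by apply/lee_addgt0Pr => _/posnumP[].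
rewrite (le_trans _ (epsilon_trick _ _ _))//; last first.
  by move=> n; exact: hausdorff2_pre_ge0.
pose P n (B : (set (R3 R))^nat) := delta_cover delta (A n) B /\
  \sum_(k <oo) hausdorff2_gauge (B k) <=
  hausdorff2_pre delta (A n) + (e%:num / (2 ^ n.+1)%:R)%:E.
have [G PG] : {G : ((set (R3 R))^nat)^nat & forall n, P n (G n)}.
  apply: (@choice _ _ P) => n; rewrite /P /hausdorff2_pre.
  set S := (X in ereal_inf X); move infS : (ereal_inf S) => iS.
  case: iS infS => [r Sr|Soo|Soo].
  - have en1 : (0 < e%:num / (2 ^ n.+1)%:R)%R by [].
    have /(lb_ereal_inf_adherent en1) : ereal_inf S \is a fin_num by rewrite Sr.
    move=> [x [B dB muBx] xS].
    by exists B; split => //; rewrite muBx -Sr; exact/ltW.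
  - by have := Aoo n; rewrite /hausdorff2_pre Soo.
  - suff : lbound S 0 by move/le_ereal_inf_tmp; rewrite Soo.
    move=> /= _ [B _ <-]; apply: nneseries_ge0 => *; exact: hausdorff2_gauge_ge0.
have muG_ge0 x : 0 <= (hausdorff2_gauge \o uncurry G) x.
  exact: hausdorff2_gauge_ge0.
apply: (@le_trans _ _ (\esum_(i in setT) (hausdorff2_gauge \o uncurry G) i)).
  apply: ereal_inf_lbound => /=.
  have /card_esym/ppcard_eqP[f] := card_nat2.
  exists (uncurry G \o f).
    split => [|i]; last first.
      by rewrite /= /uncurry; case: (f i) => a b; exact: (PG a).1.2.
    move=> t [i _ /(PG i).1.1 [j _ Bijt]]; exists (f^-1%FUN (i, j)) => //=.
    by rewrite invK ?inE.
  rewrite -(esum_pred_image (hausdorff2_gauge \o uncurry G) _ xpredT) ?[fun=> _]set_true//.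
  by rewrite image_eq.
rewrite (_ : esum _ _ = \sum_(i <oo) \sum_(j <oo ) hausdorff2_gauge (G i j)); last first.
  pose J : nat -> set (nat * nat) := fun i => [set (i, j) | j in setT].
  rewrite (_ : setT = \bigcup_k J k); last first.
    by rewrite predeqE => -[a b]; split => // _; exists a => //; exists b.
  rewrite esum_bigcupT /=; last 2 first.
    - apply/trivIsetP => i j _ _ ij.
      rewrite predeqE => -[n m] /=; split => //= -[] [_] _ [<-{n} _].
      by move=> [m' _] [] /esym/eqP; rewrite (negbTE ij).
    - by move=> /= [n m]; exact: hausdorff2_gauge_ge0.
  rewrite -(image_id [set: nat]) -fun_true esum_pred_image//; last first.
    by move=> n _; exact: esum_ge0.
  apply: eq_eseriesr => /= j _.
  rewrite -(esum_pred_image (hausdorff2_gauge \o uncurry G) (pair j) predT)//=; last first.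
    by move=> ? ? _ _; exact: (@can_inj _ _ _ snd).
  by congr esum; rewrite predeqE => -[a b]; split; move=> [i _ <-]; exists i.
apply: lee_lim.
- apply: is_cvg_nneseries => n *.
  by apply: nneseries_ge0 => m *; exact: (muG_ge0 (n, m)).
- by apply: is_cvg_nneseries => n *; apply: adde_ge0 => //; exact: hausdorff2_pre_ge0.
- by near=> n; apply: lee_sum => i _; exact: (PG i).2.
Unshelve. all: by end_near. Qed.

Lemma hausdorff2_ge0 A : 0 <= hausdorff2 A.
Proof.
apply: le_trans (hausdorff2_pre_ge0 1 A) _.
by apply: ereal_sup_ubound; exists 1%R => //=.
Qed.

Lemma hausdorff20 : hausdorff2 set0 = 0.
Proof.
apply/eqP; rewrite eq_le hausdorff2_ge0 andbT.
by apply: ge_ereal_sup => _ [d /= d0 <-]; rewrite hausdorff2_pre0.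
Qed.

Lemma le_hausdorff2 : {homo hausdorff2 : A B / A `<=` B >-> A <= B}.
Proof.
move=> A B AB; apply: ge_ereal_sup => _ [d /= d0 <-].
apply: le_trans (le_hausdorff2_pre d AB) _.
by apply: ereal_sup_ubound; exists d.
Qed.

Lemma hausdorff2_sigma_subadditive : sigma_subadditive hausdorff2.
Proof.
move=> F; apply: ge_ereal_sup => _ [d /= d0 <-].
apply: le_trans (hausdorff2_pre_sigma_subadditive d F) _.
apply: lee_nneseries => i *; first exact: hausdorff2_pre_ge0.
by apply: ereal_sup_ubound; exists d.
Qed.

HB.instance Definition _ := isOuterMeasure.Build R (R * R * R)%type hausdorff2
  hausdorff20 hausdorff2_ge0 le_hausdorff2 hausdorff2_sigma_subadditive.

End Hausdorff.
Arguments hausdorff2 : clear implicits.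

Definition hausdorff2_outer (R : realType) :
  {outer_measure set (R * R * R) -> \bar R} := hausdorff2 R.

(* R^3 with the sigma-algebra of the Caratheodory measurable sets of H^2. *)
Definition H2space (R : realType) := caratheodory_type (hausdorff2_outer R).

Definition H2 (R : realType) : {measure set (H2space R) -> \bar R} :=
  (hausdorff2_outer R : set (caratheodory_type (hausdorff2_outer R)) -> \bar R).

Section DensityMeasure.
Context d (T : measurableType d) (R : realType) (mu : {measure set T -> \bar R}).
Local Open Scope ereal_scope.

Definition density_measure (w : T -> R) (mw : measurable_fun setT w)
    (w0 : forall x, (0 <= w x)%R) : set T -> \bar R :=
  fun A => \int[mu]_(x in A) (w x)%:E.

Variables (w : T -> R) (mw : measurable_fun setT w) (w0 : forall x, (0 <= w x)%R).
Local Notation nu := (density_measure mw w0).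

Let nu0 : nu set0 = 0. Proof. exact: integral_set0. Qed.

Let nu_ge0 A : 0 <= nu A.
Proof. by apply: integral_ge0 => x _; rewrite lee_fin. Qed.

Let nu_sigma_additive : semi_sigma_additive nu.
Proof.
apply: semi_sigma_additive_nng_induced => [|x]; last by rewrite lee_fin.
exact/measurable_EFinP.
Qed.

HB.instance Definition _ :=
  isMeasure.Build _ _ _ nu nu0 nu_ge0 nu_sigma_additive.

End DensityMeasure.

Section Fourier.
Context {R : realType}.
Local Notation C := (R[i]).

Definition cabs (z : C) : R := Normc.normc z.

Definition expi (t : R) : C := cos (2 * pi * t) +i* sin (2 * pi * t).

Definition cintegral (f : R3 R -> C) : C :=
  Rintegral (lebesgue3 R) setT (fun x => complex.Re (f x)) +i*
  Rintegral (lebesgue3 R) setT (fun x => complex.Im (f x)).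

Definition L2norm (f : R3 R -> C) : \bar R :=
  Lnorm (lebesgue3 R) 2%:E (fun x => (cabs (f x))%:E).

Definition inL2 (f : R3 R -> C) : Prop :=
  [/\ measurable_fun [set: borelR3 R] (fun x => complex.Re (f x)),
      measurable_fun [set: borelR3 R] (fun x => complex.Im (f x)) &
      (L2norm f < +oo)%E].

Definition fourier_integral (f : R3 R -> C) (xi : R3 R) : C :=
  cintegral (fun x => f x * expi (- dot x xi)).

Definition truncate (n : nat) (f : R3 R -> C) (x : R3 R) : C :=
  if enorm x <= n%:R then f x else 0.

(* ghat represents the Fourier transform of the L^2 function f: it is the
   limit in L^2 of the Fourier integrals of the truncations of f, which are
   integrable. *)
Definition is_fourier (f ghat : R3 R -> C) : Prop :=
  inL2 ghat /\
  L2norm (fun xi => ghat xi - fourier_integral (truncate n f) xi)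
    @[n --> \oo] --> 0%E.

Definition fourier_support (ghat : R3 R -> C) : set (R3 R) :=
  ess_support (lebesgue3 R).-negligible ghat.

End Fourier.

Section FrequencyPartition.
Context {R : realType}.

Definition annulus (r : R) : set (R3 R) := [set xi | `|enorm xi - r| <= 1].

Definition tsupport (psi : R * R * R -> R) : set (R * R * R) :=
  closure [set xi | psi xi != 0].

Definition iterated_partial (vs : seq (R * R * R)) (psi : R * R * R -> R) :
    R * R * R -> R :=
  foldr (fun v g => fun x => 'D_v g x) psi vs.

Definition smooth (psi : R * R * R -> R) : Prop :=
  forall vs : seq (R * R * R), {subset vs <= @basis3 R} ->
    continuous (iterated_partial vs psi) /\
    forall x v, v \in @basis3 R -> derivable (iterated_partial vs psi) x v.

(* axis3 is the radial direction of the centre of the box, side1 and side2 are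
   the tangential half-sides, aperture is the angular radius of the cap. *)
Record box := Box {
  axis1 : R * R * R; axis2 : R * R * R; axis3 : R * R * R;
  side1 : R; side2 : R; aperture : R }.

Definition box_center (r : R) (b : box) : R * R * R := r *: axis3 b.

Definition orthonormal_frame (b : box) : Prop :=
  [/\ dot (axis1 b) (axis1 b) = 1, dot (axis2 b) (axis2 b) = 1, dot (axis3 b) (axis3 b) = 1 &
   [/\ dot (axis1 b) (axis2 b) = 0, dot (axis1 b) (axis3 b) = 0 & dot (axis2 b) (axis3 b) = 0]].

Definition cap (r : R) (b : box) : set (R3 R) :=
  [set xi | enorm xi = r /\ acos (dot xi (axis3 b) / r) <= aperture b].

Definition radial_thickening (r : R) (A : set (R3 R)) : set (R3 R) :=
  [set xi | annulus r xi /\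
     exists t : R, exists eta, [/\ 0 <= t, A eta & xi = t *: (eta : R * R * R)]].

(* The part of the annulus of relative size s around the centre of the box,
   curved along the spheres: its faces transverse to the radial direction are
   pieces of the spheres of radii r - s and r + s. A union of finitely many
   flat boxes contained in the annulus cannot cover it. *)
Definition curved_box (r : R) (b : box) (s : R) : set (R3 R) :=
  [set xi | [/\ `|dot xi (axis1 b)| <= s * side1 b,
                `|dot xi (axis2 b)| <= s * side2 b,
                `|enorm xi - r| <= s & 0 <= dot xi (axis3 b)]].

Definition box_set (r : R) (b : box) : set (R3 R) := curved_box r b 1.

Definition dilate (c : R * R * R) (s : R) (A : set (R3 R)) : set (R3 R) :=
  [set c + s *: ((xi : R * R * R) - c) | xi in A].

Definition rescale (r : R) (b : box) (psi : R * R * R -> R) (y : R * R * R) : R :=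
  psi (box_center r b + (side1 b * y.1.1) *: axis1 b + (side2 b * y.1.2) *: axis2 b
       + y.2 *: axis3 b).

(* derivative_bound n bounds the partial derivatives of order n of the rescaled
   cutoffs; comparability is used for all the relations "comparable to" and "of
   the order of". *)
Record partition_constants := PartitionConstants {
  comparability : R; overlap : nat; dilation : R; plateau : R;
  derivative_bound : nat -> R }.

Definition valid_constants (K : partition_constants) : Prop :=
  [/\ 1 <= comparability K, 1 <= dilation K & 0 < plateau K < 1].

Definition comparable_with (K : partition_constants) (x y : R) : Prop :=
  (comparability K)^-1 * y <= x <= comparability K * y.

Record freq_partition := FreqPartition {
  box_number : nat;
  part_box : 'I_box_number -> box;
  cutoff : 'I_box_number -> R * R * R -> R }.
Arguments part_box : clear implicits.
Arguments cutoff : clear implicits.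

Definition overlap_count (n : nat) (A : 'I_n -> set (R3 R)) (xi : R3 R) : nat :=
  #|[set i : 'I_n | `[< A i xi >]]|.

Definition is_box (K : partition_constants) (r : R) (b : box) : Prop :=
  [/\ orthonormal_frame b,
      [/\ comparable_with K (side1 b) (Num.sqrt r), comparable_with K (side2 b) (Num.sqrt r)
        & comparable_with K (aperture b) (Num.sqrt r)^-1],
      box_set r b `<=` annulus r &
      radial_thickening r (cap r b) `<=` box_set r b].

Definition is_cutoff (K : partition_constants) (r : R) (b : box)
    (psi : R * R * R -> R) : Prop :=
  [/\ smooth psi,
      compact (tsupport psi) /\
      tsupport psi `<=` dilate (box_center r b) (dilation K) (box_set r b),
      forall xi, 0 <= psi xi <= 1,
      forall vs : seq (R * R * R), {subset vs <= @basis3 R} -> forall y,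
        `|iterated_partial vs (rescale r b psi) y| <= derivative_bound K (size vs) &
      forall xi, curved_box r b (plateau K) xi -> psi xi = 1].

Definition is_freq_partition (K : partition_constants) (r : R)
    (P : freq_partition) : Prop :=
  [/\ forall i, is_box K r (part_box P i),
      [set xi | enorm xi = r] `<=` \bigcup_i cap r (part_box P i),
      annulus r `<=` \bigcup_i box_set r (part_box P i) &
      [/\ comparable_with K (box_number P)%:R r,
      forall xi, (overlap_count (fun i => cap r (part_box P i)) xi <= overlap K)%N,
      forall xi, (overlap_count (fun i => tsupport (cutoff P i)) xi <= overlap K)%N,
      forall i, is_cutoff K r (part_box P i) (cutoff P i) &
      forall xi, annulus r xi -> \sum_i cutoff P i xi = 1]].

Local Notation C := (R[i]).

(* The inverse Fourier integral of psi * ghat converges pointwise, since psi has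
   compact support: this is the continuous representative of f_Theta, which has
   a meaning on surfaces. *)
Definition localize (psi : R * R * R -> R) (ghat : R3 R -> C) (x : R3 R) : C :=
  cintegral (fun xi => (psi xi)%:C * ghat xi * expi (dot x xi)).

Definition square_function (P : freq_partition) (ghat : R3 R -> C) (x : R3 R) : R :=
  Num.sqrt (\sum_i cabs (localize (cutoff P i) ghat x) ^+ 2).

End FrequencyPartition.
Arguments box : clear implicits.
Arguments partition_constants : clear implicits.
Arguments freq_partition : clear implicits.
Arguments part_box {R}.
Arguments cutoff {R}.

Section Surface.
Context {R : realType}.

Definition quadratic (l1 l2 : R) (u : R * R) : R :=
  (l1 * u.1 ^+ 2 + l2 * u.2 ^+ 2) / 2.

Definition graph_over (Q : R * R -> R) (U : set (R * R)) : set (R3 R) :=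
  [set (u, Q u) | u in U].

Definition unit_tangent (Q : R * R -> R) (x v : R * R * R) : Prop :=
  enorm v = 1 /\ v.2 = 'D_(v.1) Q x.1.

Definition compactly_supported_in_patch (Q : R * R -> R) (U : set (R * R))
    (chi : R3 R -> R) : Prop :=
  exists U0 : set (R * R), [/\ open U0, compact (closure U0), closure U0 `<=` U &
    ess_support (H2 R).-negligible (chi \_ (graph_over Q U)) `<=` graph_over Q U0].

(* The measure chi H^2 |_ S: the values of chi outside S are irrelevant. *)
Definition surface_measure (S : set (R3 R)) (chi : R3 R -> R)
    (mchi : measurable_fun [set: H2space R] (chi \_ S))
    (chi0 : forall x, 0 <= (chi \_ S) x) : {measure set (H2space R) -> \bar R} :=
  density_measure (H2 R) mchi chi0.

End Surface.

(* Main.v *)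
(* Upper bound. f_Theta is the inverse Fourier transform of psi_Theta fhat, which
   lives in a box of dimensions 1 x R^(1/2) x R^(1/2) in coordinates c_i sheared
   so that c_1 is the radial one. Space is cut into cells dual to the box, and a
   large sieve inequality (duality, with the explicit kernel prod sinc^2, the
   transform of the triangle function) bounds the sum over the cells of
   sup |f_Theta|^2 by the volume R of the box times the energy of psi_Theta fhat.
   A cell meets the quadratic graph in a set of H^2 measure O(R^(-3/4)): it is
   a slab of thickness R^(-1/2) in two directions, and since the graph has
   nonzero curvature along it the remaining coordinate is confined to an
   interval of length R^(-1/4), or R^(-1/2) in the transversal case. Hence
   int |f_Theta|^2 dmu <= C R^(1/4) |psi_Theta fhat|^2, and the boxes are summed
   using their finite overlap and |fhat| <= C |f|, which is the large sieve
   inequality for a large cube.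

   Lower bound. Take a box whose radial direction is within O(R^(-1/2)) of a
   tangent direction at x0, and a wave packet with transform a product of
   triangle functions inside the plateau of the box. It is bounded below on a
   tube of dimensions 1 x R^(-1/2) x R^(-1/2), which contains the part of the
   surface above a rectangle of sides R^(-1/4) and R^(-1/2), while its energy is
   O(R^(-1)). *)
Require Import Defs.
From HB Require Import structures.
From mathcomp Require Import all_boot all_order all_algebra.
From mathcomp Require Import complex ring lra zify.
From mathcomp Require Import all_classical all_reals all_analysis measurable_realfun ess_sup_inf.
Import Order.TTheory GRing.Theory Num.Theory numFieldNormedType.Exports.

Set Implicit Arguments.
Unset Strict Implicit.
Unset Printing Implicit Defensive.

Local Open Scope classical_set_scope.
Local Open Scope ring_scope.

(** * One-dimensional Fourier pairs *)

(** The exponent is best read in the parameter [q] = r^(1/4): a box has volume of order q^4, a cell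
    meets the graph in measure of order q^-3, so one box costs a factor q in the squared norm. The
    condition l1 l2 > 0 keeps the second derivative k1 + k2 b^2 of the graph along a direction of
    slope b away from 0, so a tangential slab is bent quadratically, uniformly in the direction of
    the box. Neither Fourier inversion nor the Plancherel identity is invoked. Upper bounds may lose
    constants, and in the lower bound a packet and its transform are both explicit, because the
    triangle function and the Fejer kernel are transforms of each other up to constants. Oscillating
    integrals are reduced to integrals of A + B cos with |B| <= A against nonnegative kernels, to
    which Tonelli's theorem applies at once. Likewise H^2 is only compared with areas of rectangles,
    without an area formula, and its link with Borel functions is the Caratheodory criterion for
    metric outer measures. A cell contributes a supremum and not a value at its centre, so the sieve
    has to accept arbitrary points, one in each cell. *)

Section LebesgueAffine.
Context {R : realType}.
Local Notation leb := (@lebesgue_measure R).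
Local Open Scope ereal_scope.

Lemma measurable_affine (a b : R) :
  measurable_fun [set: measurableTypeR R] (fun x => a * x + b : measurableTypeR R)%R.
Proof. by apply: measurable_funD => //; apply: measurable_funM. Qed.

(** By uniqueness of Lebesgue measure: the pushforward under the affine map, multiplied by [a],
    gives intervals their length. *)
Lemma ge0_integral_affine (a b : R) (f : R -> \bar R) : (0 < a)%R ->
  measurable_fun [set: measurableTypeR R] f -> (forall x, 0 <= f x) ->
  \int[leb]_x f (a * x + b)%R = (a^-1)%:E * \int[leb]_x f x.
Proof.
move=> a0 mf f0; have mphi := measurable_affine a b.
pose push := measure_function_pushforward__canonical__measure_function_Measure leb mphi.
pose nu : {measure set (measurableTypeR R) -> \bar R} := mscale (NngNum (ltW a0)) push.
have nuE A : measurable A -> leb A = nu A.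
  apply: lebesgue_measure_unique => _ [[c d]] _ <-.
  change (leb `]c, d] = a%:E * leb ((fun x => a * x + b)%R @^-1` `]c, d])).
  rewrite (_ : _ @^-1` _ = `](c - b) / a, (d - b) / a]%classic)%R; last first.
    apply/seteqP; split => x /=; rewrite !in_itv/=;
      rewrite ltr_pdivrMr// ler_pdivlMr// ltrBlDr lerBrDr (mulrC x); done.
  rewrite !lebesgue_measure_itv/= !lte_fin ltr_pM2r ?invr_gt0// ltrD2r.
  case: ifPn => _; last by rewrite mule0.
  by rewrite !EFinN -!EFinD -EFinM; congr EFin; field; rewrite gt_eqF.
have -> : \int[leb]_x f x = a%:E * \int[leb]_x f (a * x + b)%R.
  transitivity (a%:E * \int[push]_x f x); last first.
    by rewrite (ge0_integral_pushforward mphi) //= => y _.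
  rewrite (_ : a%:E = (NngNum (ltW a0))%:num%:E)// -ge0_integral_mscale//.
  apply: eq_measure_integral => A mA _; first [exact: nuE | exact/esym/nuE].
by rewrite muleA -EFinM mulVf ?gt_eqF// mul1e.
Qed.

End LebesgueAffine.

Section FourierPair.
Context {R : realType}.
Local Notation leb := (@lebesgue_measure R).
Local Open Scope ereal_scope.

Lemma ge0_integralN (f : R -> \bar R) :
  measurable_fun [set: measurableTypeR R] f -> (forall x, 0 <= f x) ->
  \int[leb]_x f (- x)%R = \int[leb]_x f x.
Proof.
move=> mf f0; have mN : measurable_fun [set: measurableTypeR R] (-%R : _ -> measurableTypeR R) by [].
transitivity (\int[pushforward leb (-%R : _ -> measurableTypeR R)]_x f x).
  by rewrite (ge0_integral_pushforward mN) //= => y _.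
by apply: eq_measure_integral => A mA _; exact: lebesgue_measureN.
Qed.

(** [P] is the cosine transform of the even function [p]. The weight 1 + cos keeps the integrand
    nonnegative, so the integral makes sense before integrability is known; w = 0 gives the mass
    [P 0]. *)
Definition fourier_pair (p P : R -> R) : Prop :=
  [/\ measurable_fun [set: measurableTypeR R] p, (forall t, (0 <= p t)%R),
      (forall t, p (- t)%R = p t) &
      forall w, \int[leb]_t (p t * (1 + cos (w * t)))%:E = (P 0%R + P w)%:E].

Lemma measurable_cos_affine (w ph : R) :
  measurable_fun [set: measurableTypeR R] (fun t => cos (w * t + ph))%R.
Proof.
apply: (@measurableT_comp _ _ _ _ _ _ (@cos R)); last exact: measurable_affine.
by apply: continuous_measurable_fun; exact: continuous_cos.
Qed.

Section Pair.
Variables (p P : R -> R).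
Hypothesis pP : fourier_pair p P.

Let mp : measurable_fun [set: measurableTypeR R] p. Proof. by case: pP. Qed.
Let p0 t : (0 <= p t)%R. Proof. by case: pP. Qed.
Let pN t : p (- t)%R = p t. Proof. by case: pP. Qed.
Let pPE w : \int[leb]_t (p t * (1 + cos (w * t)))%:E = (P 0%R + P w)%:E.
Proof. by case: pP. Qed.

Lemma fourier_pair_integral : \int[leb]_t (p t)%:E = (P 0%R)%:E.
Proof.
have := pPE 0; rewrite (_ : (fun t => _) = fun t => 2%:E * (p t)%:E); last first.
  by apply/funext => t; rewrite mul0r cos0 -EFinM; congr EFin; ring.
rewrite ge0_integralZl//; last 2 first.
- exact/measurable_EFinP.
- by move=> x _; rewrite lee_fin.
move/(congr1 (fun z => 2^-1%:E * z)); rewrite muleA -!EFinM mulVf// mul1e => ->.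
by congr EFin; field.
Qed.

Lemma fourier_pair_integrable : leb.-integrable setT (EFin \o p).
Proof.
apply/integrableP; split; first exact/measurable_EFinP.
under eq_integral do rewrite /= ger0_norm//.
by rewrite fourier_pair_integral ltry.
Qed.

Lemma fourier_pair_integrable_cos w ph :
  leb.-integrable setT (EFin \o (fun t => p t * cos (w * t + ph))%R).
Proof.
apply: le_integrable fourier_pair_integrable => //.
  by apply/measurable_EFinP; apply: measurable_funM => //; exact: measurable_cos_affine.
move=> t _ /=; rewrite lee_fin normrM (ger0_norm (p0 t)) -[leRHS]mulr1.
by apply: ler_wpM2l => //; exact: cos_max.
Qed.

Lemma fourier_pair_cos w :
  \int[leb]_t (p t * cos (w * t))%:E = (P w)%:E.
Proof.
have ic := fourier_pair_integrable_cos w 0.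
have H : \int[leb]_t (p t + p t * cos (w * t + 0))%:E = (P 0%R + P w)%:E.
  by rewrite -pPE; apply: eq_integral => t _; rewrite mulrDr mulr1 addr0.
move: H; rewrite integralD_EFin// ?fourier_pair_integral//; last exact: fourier_pair_integrable.
under eq_integral do rewrite /= addr0.
move: (\int[_]_ _ _) => z; case: z => //= z [].
by move/addrI ->.
Qed.

(** Averaging with the reflection t -> -t turns cos (w t + ph) into cos (w t) cos ph, since the sine
    part is odd against the even [p]. The condition on [B] keeps the integrand nonnegative. *)
Lemma fourier_pairE A B w ph : (`|B| <= A)%R ->
  \int[leb]_t (p t * (A + B * cos (w * t + ph)))%:E =
  (A * P 0 + B * P w * cos ph)%:E.
Proof.
move=> BA; set F := fun t : R => (p t * (A + B * cos (w * t + ph)))%R.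
have F0 t : (0 <= F t)%R.
  have : (`|B * cos (w * t + ph)| <= A)%R.
    by rewrite normrM -[leRHS]mulr1 ler_pM// cos_max.
  by rewrite ler_norml /F => /andP[? _]; apply: mulr_ge0 => //; lra.
have mF : measurable_fun [set: measurableTypeR R] F.
  apply: measurable_funM => //; apply: measurable_funD => //.
  by apply: measurable_funM => //; exact: measurable_cos_affine.
have H : \int[leb]_t (F t)%:E + \int[leb]_t (F t)%:E = (2 * (A * P 0 + B * P w * cos ph))%:E.
  rewrite -{2}(@ge0_integralN (EFin \o F)) //; last exact/measurable_EFinP.
  rewrite -ge0_integralD//; last 4 first.
  - by move=> t _; rewrite lee_fin.
  - exact/measurable_EFinP.
  - by move=> t _; rewrite lee_fin.
  - by apply/measurable_EFinP; apply: measurableT_comp.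
  transitivity (\int[leb]_t ((2 * A)%:E * (EFin \o p) t + (2 * B * cos ph)%:E * (EFin \o (fun t => p t * cos (w * t + 0))%R) t)).
    apply: eq_integral => t _; rewrite /= /F pN -!EFinM -!EFinD; congr EFin.
    by rewrite mulrN [(- (w * t) + ph)%R]addrC cosB cosD addr0; ring.
  rewrite integralD//; last 2 first.
  - by apply: integrableZl => //; exact: fourier_pair_integrable.
  - by apply: integrableZl => //; exact: fourier_pair_integrable_cos.
  rewrite !integralZl//; [|exact: fourier_pair_integrable_cos|exact: fourier_pair_integrable].
  rewrite fourier_pair_integral.
  under eq_integral do rewrite /= addr0.
  by rewrite fourier_pair_cos -!EFinM -EFinD; congr EFin; ring.
move: H; move: (\int[_]_ _ _) => z; case: z => //= z [] H; congr EFin.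
by apply: (@mulfI _ 2); rewrite // -H; ring.
Qed.

(** Positivity of the integrals of p (1 + cos) and p (1 - cos). *)
Lemma fourier_pair_norm w : (`|P w| <= P 0)%R.
Proof.
have H B : (`|B| <= 1)%R -> (0 <= P 0 + B * P w)%R.
  move=> B1; rewrite -lee_fin.
  have := @fourier_pairE 1%R B w 0%R B1; rewrite cos0 mulr1 mul1r => <-.
  apply: integral_ge0 => t _; rewrite lee_fin mulr_ge0//.
  have : (`|B * cos (w * t + 0)| <= 1)%R by rewrite normrM -[leRHS]mulr1 ler_pM// cos_max.
  by rewrite ler_norml => /andP[? _]; lra.
have := H 1%R; have := H (-1)%R; rewrite normrN normr1 => /(_ (lexx _)) + /(_ (lexx _)).
by rewrite ler_norml => ? ?; apply/andP; split; lra.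
Qed.

Lemma fourier_pair_scale (h : R) : (0 < h)%R ->
  fourier_pair (fun t => p (t / h)) (fun w => h * P (h * w))%R.
Proof.
move=> h0; split => //.
- by apply: measurableT_comp => //; apply: measurable_funM.
- by move=> t; rewrite mulNr pN.
- move=> w; have mf : measurable_fun [set: measurableTypeR R] (fun t => (p t * (1 + cos (h * w * t)))%:E).
    apply/measurable_EFinP; apply: measurable_funM => //; apply: measurable_funD => //.
    by under eq_fun do rewrite -[X in cos X]addr0; exact: measurable_cos_affine.
  have h'0 : (0 < h^-1)%R by rewrite invr_gt0.
  have := @ge0_integral_affine R h^-1%R 0%R _ h'0 mf.
  rewrite invrK pPE => E; rewrite mulr0 -mulrDr EFinM -E.
    apply: eq_integral => t _; rewrite addr0 (mulrC h^-1%R) -!mulrA.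
    by rewrite (_ : h * (w * (t / h)) = w * t)%R//; field; rewrite gt_eqF.
  move=> t; rewrite lee_fin mulr_ge0//.
Qed.

End Pair.
End FourierPair.

(** * The triangle function and the Fejer kernel *)

Section TriangleSinc.
Context {R : realType}.
Local Notation leb := (@lebesgue_measure R).

Lemma integral_is_derive (F f : R -> R) (a b : R) : a < b -> continuous f ->
  (forall t : R, is_derive t (1 : R) F (f t)) ->
  (\int[leb]_(x in `[a, b]) (f x)%:E = (F b - F a)%:E)%E.
Proof.
move=> ab cf dF.
have cF : continuous F.
  by move=> x; apply/differentiable_continuous/derivable1_diffP/ex_derive.
rewrite (@continuous_FTC2 _ f F)//; first exact: continuous_subspaceT.
- split; first by move=> x _; apply: ex_derive.
  + by apply: cvg_at_right_filter; exact: cF.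
  + by apply: cvg_at_left_filter; exact: cF.
- by move=> x _; rewrite derive1E; exact: derive_val.
Qed.

Definition tri (t : R) : R := Num.max 0 (1 - `|t|).

(** The Fejer kernel (sin (w/2) / (w/2))^2, in a form without half angles. *)
Definition sinc2 (w : R) : R := if w == 0 then 1 else 2 * (1 - cos w) / w ^+ 2.

Lemma tri_ge0 t : 0 <= tri t. Proof. by rewrite le_max lexx. Qed.

Lemma triN t : tri (- t) = tri t. Proof. by rewrite /tri normrN. Qed.

Lemma tri_eq0 t : 1 <= `|t| -> tri t = 0.
Proof. by move=> t1; apply/max_idPl; rewrite subr_le0. Qed.

Lemma tri_in01 t : 0 <= t <= 1 -> tri t = 1 - t.
Proof. by case/andP=> t0 t1; rewrite /tri ger0_norm//; apply/max_idPr; rewrite subr_ge0. Qed.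

Lemma tri_ge_half t : `|t| <= 2^-1 -> 2^-1 <= tri t.
Proof. by move=> t1; rewrite le_max; apply/orP; right; lra. Qed.

Lemma triE t : tri t = 2^-1 * `|t + 1| + 2^-1 * `|t - 1| - `|t|.
Proof.
rewrite /tri; have [t0|t0] := ger0P t; have [t1|t1] := ger0P (t - 1);
 have [t2|t2] := ger0P (t + 1); case: ltP; lra.
Qed.

Lemma continuous_tri : continuous tri.
Proof.
rewrite (_ : tri = fun t => 2^-1 * `|t + 1| + 2^-1 * `|t - 1| - `|t|); last first.
  by apply/funext => t; exact: triE.
move=> t; apply: cvgB; last by apply: cvg_norm; exact: cvg_id.
apply: cvgD; apply: cvgM; try exact: cvg_cst; apply: cvg_norm.
  by apply: cvgD; [exact: cvg_id|exact: cvg_cst].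
by apply: cvgB; [exact: cvg_id|exact: cvg_cst].
Qed.

Lemma tri_pair : fourier_pair tri sinc2.
Proof.
split; [exact: continuous_measurable_fun continuous_tri|exact: tri_ge0|exact: triN|].
move=> w.
have ccos : continuous (fun t => 1 + cos (w * t)).
  move=> t; apply: continuousD; first exact: cst_continuous.
  apply: (@continuous_comp _ _ _ (fun t => w * t) cos); last exact: continuous_cos.
  exact: mulrl_continuous.
rewrite ge0_symfun_integralT; last 3 first.
- by move=> t; rewrite mulr_ge0// tri_ge0.
- by move=> t; apply: continuousM; [exact: continuous_tri|exact: ccos].
- by move=> t; rewrite /= triN mulrN cosN.
have -> : (\int[leb]_(x in [set x | (0 <= x)%R]) (tri x * (1 + cos (w * x)))%:E =
    \int[leb]_(x in `[0%R, 1%R]) ((1 - x) * (1 + cos (w * x)))%:E)%E.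
  rewrite integral_mkcond [RHS]integral_mkcond; apply: eq_integral => t _.
  rewrite /patch; have [t0|t0] := leP 0 t; last first.
    by rewrite !ifF//; apply/negbTE/negP; rewrite inE/= ?in_itv/= leNgt t0.
  rewrite ifT ?inE//; have [t1|t1] := leP t 1.
    by rewrite ifT ?tri_in01 ?t0// inE/= in_itv/= t0.
  rewrite ifF; first by rewrite tri_eq0 ?mul0r// ger0_norm// ltW.
  by apply/negbTE/negP; rewrite inE/= in_itv/= t0/= leNgt t1.
have cg : continuous (fun t : R => (1 - t) * (1 + cos (w * t))).
  by move=> t; apply: cvgM; [apply: cvgB; [exact: cvg_cst|exact: cvg_id]|exact: ccos].
have [w0|w0] := eqVneq w 0.
  have dF (t : R) : is_derive t (1 : R) (fun t : R => 2 * t - t ^+ 2) ((1 - t) * (1 + cos (w * t))).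
    by apply: is_derive_eq; rewrite w0 mul0r cos0 /GRing.scale/=; ring.
  rewrite (integral_is_derive ltr01 cg dF).
  by rewrite w0 /sinc2 eqxx -EFinM; congr EFin; ring.
(* Antiderivative found by integrating (1 - t) cos (w t) by parts. *)
have dF (t : R) : is_derive t (1 : R)
    (fun t : R => t - t ^+ 2 / 2 + (1 - t) * sin (w * t) / w - cos (w * t) / w ^+ 2)
    ((1 - t) * (1 + cos (w * t))).
  by apply: is_derive_eq; rewrite /GRing.scale/=; field.
rewrite (integral_is_derive ltr01 cg dF).
by rewrite /sinc2 eqxx (negbTE w0) -EFinM; congr EFin; rewrite mulr0 sin0 cos0 mulr1; field.
Qed.

Lemma sinc20 : sinc2 0 = 1. Proof. by rewrite /sinc2 eqxx. Qed.

Lemma sinc2N w : sinc2 (- w) = sinc2 w.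
Proof. by rewrite /sinc2 oppr_eq0 cosN sqrrN. Qed.

Lemma sinc2_ge0 w : 0 <= sinc2 w.
Proof.
rewrite /sinc2; case: ifPn => // w0; rewrite divr_ge0 ?sqr_ge0// mulr_ge0//.
Qed.

Lemma sinc2_le1 w : sinc2 w <= 1.
Proof.
by have := fourier_pair_norm tri_pair w; rewrite sinc20; apply: le_trans (ler_norm _).
Qed.

Lemma sinc2_sqr w : sinc2 w * w ^+ 2 = 2 * (1 - cos w).
Proof.
rewrite /sinc2; case: ifPn => [/eqP ->|w0]; first by rewrite cos0; ring.
by field.
Qed.

Lemma cos_ge (w : R) : 1 - w ^+ 2 / 2 <= cos w.
Proof.
have := sinc2_sqr w; have := sinc2_le1 w; have := sqr_ge0 w; nra.
Qed.

Lemma sinc2_decay w : sinc2 w <= 5 / (1 + w ^+ 2).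
Proof.
rewrite ler_pdivlMr ?mulrDr ?mulr1 ?sinc2_sqr; last by have := sqr_ge0 w; lra.
by have := sinc2_le1 w; have := cos_geN1 w; lra.
Qed.

Lemma measurable_sinc2 : measurable_fun [set: measurableTypeR R] sinc2.
Proof.
have mw : measurable_fun [set: measurableTypeR R] (fun w : R => w == 0).
  by apply: measurable_fun_eqr => //; exact: measurable_id.
apply: measurable_fun_if => //; rewrite setTI.
rewrite (_ : _ @^-1` _ = [set w : R | w != 0]); last first.
  by apply/seteqP; split => w /=; [move/negbT|move/negbTE].
apply: open_continuous_measurable_fun; first exact: open_neq.
move=> w; rewrite inE /= => w0; apply: cvgM.
  by apply: cvgM; [exact: cvg_cst|apply: cvgB; [exact: cvg_cst|exact: continuous_cos]].
apply: cvgV; first by rewrite sqrf_eq0.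
exact: exprn_continuous.
Qed.

(** The quadratic lower bound for the cosine is averaged against [tri], a probability density
    supported in [-1, 1]. *)
Lemma sinc2_ge w : 1 - w ^+ 2 / 2 <= sinc2 w.
Proof.
have i1 := fourier_pair_integrable tri_pair.
rewrite -lee_fin -(fourier_pair_cos tri_pair w).
have -> : ((1 - w ^+ 2 / 2)%:E = \int[leb]_t ((1 - w ^+ 2 / 2)%:E * (EFin \o tri) t))%E.
  by rewrite integralZl// (fourier_pair_integral tri_pair) sinc20 -EFinM mulr1.
apply: le_integral => //.
- exact: integrableZl.
- by have := fourier_pair_integrable_cos tri_pair w 0; under eq_fun do rewrite addr0.
move=> t _; rewrite -EFinM lee_fin mulrC.
have [t1|/ltW t1] := leP `|t| 1; last by rewrite tri_eq0// !mul0r.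
apply: ler_wpM2l; first exact: tri_ge0.
apply: le_trans (cos_ge _); rewrite lerD2l lerN2 ler_pM2r ?invr_gt0// exprMn.
rewrite -[leRHS]mulr1 ler_wpM2l ?sqr_ge0//.
by rewrite -[t ^+ 2]ger0_norm ?sqr_ge0// normrX -[leRHS](expr1n _ 2) lerXn2r ?nnegrE.
Qed.

Local Open Scope ereal_scope.

Lemma integral_sinc2_lty : \int[leb]_t (sinc2 t)%:E < +oo.
Proof.
have c5 : continuous (fun t : R => 5 / (1 + t ^+ 2))%R.
  move=> t; apply: cvgM; first exact: cvg_cst.
  exact: continuous_oneDsqrV.
apply: (@le_lt_trans _ _ (\int[leb]_t (5 / (1 + t ^+ 2))%:E)).
  apply: ge0_le_integral => //.
  - by move=> t _; rewrite lee_fin sinc2_ge0.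
  - by apply/measurable_EFinP; exact: measurable_sinc2.
  - by apply/measurable_EFinP; exact: continuous_measurable_fun.
  - by move=> t _; rewrite lee_fin sinc2_decay.
rewrite ge0_symfun_integralT//; last 2 first.
  by move=> t; rewrite divr_ge0// addr_ge0// sqr_ge0.
  by move=> t; rewrite /= sqrrN.
rewrite -set_itvcy.
rewrite [X in _ * X](_ : _ = \int[leb]_(x in `[0%R, +oo[) (5%:E * (oneDsqr x)^-1%:E)); last first.
  by apply: eq_integral => t _; rewrite -EFinM.
have mo : measurable_fun (`[0%R, +oo[%classic : set (measurableTypeR R)) (fun x : R => ((oneDsqr x)^-1)%:E).
  apply/measurable_EFinP; apply: measurable_funTS; apply: continuous_measurable_fun.
  exact: continuous_oneDsqrV.
rewrite ge0_integralZl//.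
by rewrite integral0y_oneDsqr -!EFinM ltry.
Qed.

(** Its value is 2 pi; finiteness and positivity are all that the argument asks of it. *)
Definition sinc2_mass : R := fine (\int[leb]_t (sinc2 t)%:E).

Lemma sinc2_massE : \int[leb]_t (sinc2 t)%:E = sinc2_mass%:E.
Proof.
rewrite /sinc2_mass fineK// ge0_fin_numE; first exact: integral_sinc2_lty.
by apply: integral_ge0 => t _; rewrite lee_fin sinc2_ge0.
Qed.

Lemma sinc2_mass_gt0 : (0 < sinc2_mass)%R.
Proof.
rewrite -lte_fin -sinc2_massE; apply: (@lt_le_trans _ _ (\int[leb]_(t in `[0%R, 1%R]) (2^-1)%:E)).
  by rewrite integral_cst//= lebesgue_measure_itv/= lte_fin ltr01 oppr0 adde0 mule1 lte_fin.
apply: (@le_trans _ _ (\int[leb]_(t in `[0%R, 1%R]) (sinc2 t)%:E)).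
  apply: ge0_le_integral => //.
  - by apply/measurable_EFinP; apply: measurable_funTS; exact: measurable_sinc2.
  - move=> t; rewrite /= in_itv/= => /andP[t0 t1]; rewrite lee_fin.
    by apply: le_trans (sinc2_ge _); nra.
apply: ge0_subset_integral => //.
- by apply/measurable_EFinP; exact: measurable_sinc2.
- by move=> t _; rewrite lee_fin sinc2_ge0.
Qed.

Lemma integral_sinc2_scale (a : R) :
  \int[leb]_t (a ^+ 2 * sinc2 (a * t))%:E = (`|a| * sinc2_mass)%:E.
Proof.
wlog a0 : a / (0 <= a)%R.
  move=> H; have [/H//|/ltW] := leP 0%R a; rewrite -oppr_ge0 => /H; rewrite sqrrN normrN => <-.
  by apply: eq_integral => t _; rewrite mulNr sinc2N.
rewrite ger0_norm//; move: a0; rewrite le_eqVlt => /predU1P[<-|a0].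
  by under eq_integral do rewrite expr0n mul0r; rewrite integral0 mul0r.
under eq_integral do rewrite EFinM -[(a * _)%R]addr0.
have ms : measurable_fun [set: measurableTypeR R] (fun t => (sinc2 t)%:E).
  by apply/measurable_EFinP; exact: measurable_sinc2.
rewrite ge0_integralZl//; last 3 first.
- by apply: (measurableT_comp ms); exact: measurable_affine.
- by move=> t _; rewrite lee_fin sinc2_ge0.
- by rewrite lee_fin sqr_ge0.
rewrite (@ge0_integral_affine _ a 0%R (fun t => (sinc2 t)%:E))//; last first.
  by move=> t; rewrite lee_fin sinc2_ge0.
by rewrite sinc2_massE -!EFinM; congr EFin; field; rewrite gt_eqF.
Qed.

(** This replaces Fourier inversion: all terms but the product with 1 + cos are dilates a^2 sinc2 (a
    t), each of integral |a| times the mass, and |w + 1| / 2 + |w - 1| / 2 - |w| is the triangle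
    function in the form [triE]. The w^2 term stands on the left so that all terms are nonnegative
    and their integrals add. *)
Lemma sinc2_product (w t : R) :
  (sinc2 t * (1 + cos (w * t)) + w ^+ 2 * sinc2 (w * t) =
   sinc2 t + 2^-1 * ((w + 1) ^+ 2 * sinc2 ((w + 1) * t))
           + 2^-1 * ((w - 1) ^+ 2 * sinc2 ((w - 1) * t)))%R.
Proof.
have [->|t0] := eqVneq t 0%R; first by rewrite !mulr0 cos0 sinc20; field.
have E a : (a ^+ 2 * sinc2 (a * t) = 2 * (1 - cos (a * t)) / t ^+ 2)%R.
  by rewrite -sinc2_sqr; field.
have E1 : (sinc2 t = 2 * (1 - cos t) / t ^+ 2)%R by have := E 1%R; rewrite expr1n !mul1r.
rewrite !E E1.
by rewrite (mulrDl w 1%R t) (mulrBl t w 1%R) mul1r cosB cosD; field.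
Qed.

Lemma sinc2_pair : fourier_pair sinc2 (fun w => sinc2_mass * tri w)%R.
Proof.
split; [exact: measurable_sinc2|exact: sinc2_ge0|exact: sinc2N|].
move=> w.
have ms a : measurable_fun [set: measurableTypeR R] (fun t => (a ^+ 2 * sinc2 (a * t))%:E).
  apply/measurable_EFinP; apply: measurable_funM => //.
  under eq_fun do rewrite -[(a * _)%R]addr0.
  by apply: (measurableT_comp measurable_sinc2); exact: measurable_affine.
have s0 a t : (0 <= a ^+ 2 * sinc2 (a * t))%R by rewrite mulr_ge0 ?sqr_ge0 ?sinc2_ge0.
have c0 t : (0 <= sinc2 t * (1 + cos (w * t)))%R.
  by rewrite mulr_ge0 ?sinc2_ge0//; have := cos_geN1 (w * t); lra.
have mc : measurable_fun [set: measurableTypeR R] (fun t => (sinc2 t * (1 + cos (w * t)))%:E).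
  apply/measurable_EFinP; apply: measurable_funM; first exact: measurable_sinc2.
  apply: measurable_funD => //; under eq_fun do rewrite -[(w * _)%R]addr0.
  exact: measurable_cos_affine.
have H : \int[leb]_t (sinc2 t * (1 + cos (w * t)))%:E + (`|w| * sinc2_mass)%:E =
   (sinc2_mass + 2^-1 * (`|w + 1| * sinc2_mass) + 2^-1 * (`|w - 1| * sinc2_mass))%:E.
  rewrite -integral_sinc2_scale -ge0_integralD//; last 2 first.
  - by move=> t _; rewrite lee_fin.
  - by move=> t _; rewrite lee_fin.
  transitivity (\int[leb]_t ((sinc2 t)%:E + 2^-1%:E * ((w + 1) ^+ 2 * sinc2 ((w + 1) * t))%:E
     + 2^-1%:E * ((w - 1) ^+ 2 * sinc2 ((w - 1) * t))%:E)).
    by apply: eq_integral => t _; rewrite -EFinD sinc2_product.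
  rewrite ge0_integralD//; last 4 first.
  - by move=> t _; rewrite adde_ge0 ?mule_ge0 ?lee_fin// sinc2_ge0.
  - apply: emeasurable_funD; first by apply/measurable_EFinP; exact: measurable_sinc2.
    exact: emeasurable_funM.
  - by move=> t _; rewrite mule_ge0 ?lee_fin.
  - exact: emeasurable_funM.
  rewrite ge0_integralD//; last 4 first.
  - by move=> t _; rewrite lee_fin sinc2_ge0.
  - by apply/measurable_EFinP; exact: measurable_sinc2.
  - by move=> t _; rewrite mule_ge0 ?lee_fin.
  - exact: emeasurable_funM.
  rewrite sinc2_massE ge0_integralZl//; last by move=> t _; rewrite lee_fin.
  rewrite [X in _ + _ + X]ge0_integralZl//; last by move=> t _; rewrite lee_fin.
  by rewrite !integral_sinc2_scale.
have t0 : tri 0%R = 1%R by rewrite /tri normr0 subr0; apply/max_idPr.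
move: H; move: (\int[_]_ _ _) => z; case: z => //= z [] H; congr EFin.
rewrite t0 triE; move: H; lra.
Qed.

End TriangleSinc.

(** * Sheared coordinates and the large sieve *)

Section Iterated.
Context {R : realType}.
Local Notation leb := (@lebesgue_measure R).
Local Notation leb3 := (lebesgue3 R).
Local Open Scope ereal_scope.

Lemma fourier_pair_shift (p P : R -> R) A B w ph m : fourier_pair p P -> (`|B| <= A)%R ->
  \int[leb]_t (p (t + m) * (A + B * cos (w * (t + m) + ph)))%:E =
  (A * P 0 + B * P w * cos ph)%:E.
Proof.
move=> pP BA; rewrite -(fourier_pairE pP _ _ BA).
have [mp p0 _ _] := pP.
set f := fun t : R => (p t * (A + B * cos (w * t + ph)))%:E.
have mf : measurable_fun [set: measurableTypeR R] f.
  apply/measurable_EFinP; apply: measurable_funM => //; apply: measurable_funD => //.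
  by apply: measurable_funM => //; exact: measurable_cos_affine.
have f0 t : 0 <= f t.
  rewrite lee_fin mulr_ge0//.
  have : (`|B * cos (w * t + ph)| <= A)%R by rewrite normrM -[leRHS]mulr1 ler_pM// cos_max.
  by rewrite ler_norml => /andP[? _]; lra.
have := ge0_integral_affine m ltr01 mf f0.
rewrite invr1 mul1e => <-.
by apply: eq_integral => t _; rewrite mul1r.
Qed.


Lemma fourier_pair_shiftZ (p P : R -> R) A B w ph m D (g : R -> R) : fourier_pair p P ->
  (`|B| <= A)%R -> (0 <= D)%R ->
  (forall t, g t = D * (p (t + m) * (A + B * cos (w * (t + m) + ph))))%R ->
  \int[leb]_t (g t)%:E = (D * (A * P 0 + B * P w * cos ph))%:E.
Proof.
move=> pP BA D0 gE; rewrite EFinM -(fourier_pair_shift _ _ m pP BA).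
have [mp p0 _ _] := pP.
rewrite -ge0_integralZl//.
- by apply: eq_integral => t _; rewrite gE EFinM.
- have ma : measurable_fun [set: measurableTypeR R] (fun t => t + m)%R.
    by apply: measurable_funD.
  apply/measurable_EFinP; apply: measurable_funM.
    exact: (measurableT_comp mp ma).
  apply: measurable_funD => //; apply: measurable_funM => //.
  exact: (measurableT_comp (measurable_cos_affine w ph) ma).
- move=> t _; rewrite lee_fin mulr_ge0//.
  have : (`|B * cos (w * (t + m) + ph)| <= A)%R by rewrite normrM -[leRHS]mulr1 ler_pM// cos_max.
  by rewrite ler_norml => /andP[? _]; lra.
Qed.

Section Triple.
Variables (p1 p2 p3 P1 P2 P3 : R -> R).
Hypothesis (pP1 : fourier_pair p1 P1) (pP2 : fourier_pair p2 P2) (pP3 : fourier_pair p3 P3).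

Let n1 := fourier_pair_norm pP1.
Let n2 := fourier_pair_norm pP2.
Let n3 := fourier_pair_norm pP3.
Let p10 t : (0 <= p1 t)%R. Proof. by case: pP1. Qed.
Let p20 t : (0 <= p2 t)%R. Proof. by case: pP2. Qed.
Let p30 t : (0 <= p3 t)%R. Proof. by case: pP3. Qed.
Let mp1 : measurable_fun [set: measurableTypeR R] p1. Proof. by case: pP1. Qed.
Let mp2 : measurable_fun [set: measurableTypeR R] p2. Proof. by case: pP2. Qed.
Let mp3 : measurable_fun [set: measurableTypeR R] p3. Proof. by case: pP3. Qed.

(* Each inner integral of a sheared product leaves an integrand of the same
   form A + B cos, with |B| <= A, in the remaining variables. *)
Lemma iterated_integral (m1 : R -> R -> R) (m2 : R -> R) (m3 A B w1 w2 w3 ph : R) :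
  (`|B| <= A)%R ->
  \int[leb]_z \int[leb]_y \int[leb]_x
    (p1 (x + m1 y z) * p2 (y + m2 z) * p3 (z + m3) *
     (A + B * cos (w1 * (x + m1 y z) + w2 * (y + m2 z) + w3 * (z + m3) + ph)))%:E =
  (A * (P1 0 * P2 0 * P3 0) + B * (P1 w1 * P2 w2 * P3 w3) * cos ph)%:E.
Proof.
move=> BA.
have N1 : (`|B * P1 w1| <= A * P1 0)%R by rewrite normrM ler_pM.
have N2 : (`|B * P1 w1 * P2 w2| <= A * P1 0 * P2 0)%R by rewrite normrM ler_pM.
transitivity (\int[leb]_z \int[leb]_y (p2 (y + m2 z) * p3 (z + m3) *
    (A * P1 0 + B * P1 w1 * cos (w2 * (y + m2 z) + (w3 * (z + m3) + ph))))%:E).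
  apply: eq_integral => z _; apply: eq_integral => y _.
  apply: (fourier_pair_shiftZ (m := m1 y z) (w := w1) pP1 BA); first by rewrite mulr_ge0.
  by move=> t; rewrite -!addrA; ring.
transitivity (\int[leb]_z (p3 (z + m3) *
    (A * P1 0 * P2 0 + B * P1 w1 * P2 w2 * cos (w3 * (z + m3) + ph)))%:E).
  apply: eq_integral => z _.
  apply: (fourier_pair_shiftZ (m := m2 z) (w := w2) pP2 N1) => //.
  by move=> t; ring.
rewrite (fourier_pair_shiftZ (m := m3) (w := w3) (ph := ph) (D := 1%R) pP3 N2)//.
  by congr EFin; ring.
by move=> t; rewrite mul1r.
Qed.

End Triple.

End Iterated.

Section ShearedCoordinates.
Context {R : realType}.
Local Notation leb := (@lebesgue_measure R).
Local Notation leb3 := (lebesgue3 R).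
Local Open Scope ereal_scope.

Lemma lebesgue2E (A B : set (measurableTypeR R)) : measurable A -> measurable B ->
  lebesgue2 R (A `*` B) = leb A * leb B.
Proof. exact: product_measure1E. Qed.

Lemma sigma_finite_lebesgue2 : sigma_finite setT (lebesgue2 R).
Proof.
have /sigma_finiteP[F [TF ndF Foo]] := sigma_finiteT (leb : {sigma_finite_measure set _ -> \bar R}).
exists (fun n => F n `*` F n).
  rewrite -setXTT {1 2}TF predeqE => -[x y]; split.
    move=> [/= [n _ Fnx] [k _ Gky]]; exists (maxn n k) => //; split.
    - by move: x Fnx; exact/subsetPset/ndF/leq_maxl.
    - by move: y Gky; exact/subsetPset/ndF/leq_maxr.
  by move=> [n _ []/= ? ?]; split; exists n.
move=> k; have [? ?] := Foo k.
split; first exact: measurableX.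
by rewrite lebesgue2E// lte_mul_pinfty// ge0_fin_numE.
Qed.
Definition sigma_finite_lebesgue2_mixin :=
  Measure_isSigmaFinite.Build _ _ _ (lebesgue2 R) sigma_finite_lebesgue2.

Definition sigma_lebesgue2 : {sigma_finite_measure set (measurableTypeR R * measurableTypeR R)%type -> \bar R} :=
 HB.pack (Measure.sort (lebesgue2 R)) sigma_finite_lebesgue2_mixin.
Lemma tonelli_zyx (f : R3 R -> \bar R) : measurable_fun [set: borelR3 R] f ->
  (forall u, 0 <= f u) ->
  \int[leb3]_u f u = \int[leb]_z \int[leb]_y \int[leb]_x f (x, y, z).
Proof.
move=> mf f0; rewrite /lebesgue3.
rewrite (@fubini_tonelli2 _ _ _ _ _ sigma_lebesgue2 leb f mf f0).
apply: eq_integral => z _; rewrite /fubini_G.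
rewrite /= /lebesgue2 (@fubini_tonelli2 _ _ _ _ _ leb leb (fun u => f (u, z)))//.
by apply: measurableT_comp mf _; exact: measurable_pair2.
Qed.

Lemma tonelli_zxy (f : R3 R -> \bar R) : measurable_fun [set: borelR3 R] f ->
  (forall u, 0 <= f u) ->
  \int[leb3]_u f u = \int[leb]_z \int[leb]_x \int[leb]_y f (x, y, z).
Proof.
move=> mf f0; rewrite /lebesgue3.
rewrite (@fubini_tonelli2 _ _ _ _ _ sigma_lebesgue2 leb f mf f0).
apply: eq_integral => z _; rewrite /fubini_G.
rewrite /= /lebesgue2 (@fubini_tonelli1 _ _ _ _ _ leb leb (fun u => f (u, z)))//.
by apply: measurableT_comp mf _; exact: measurable_pair2.
Qed.

Lemma tonelli_xyz (f : R3 R -> \bar R) : measurable_fun [set: borelR3 R] f ->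
  (forall u, 0 <= f u) ->
  \int[leb3]_u f u = \int[leb]_x \int[leb]_y \int[leb]_z f (x, y, z).
Proof.
move=> mf f0; rewrite /lebesgue3.
rewrite (@fubini_tonelli1 _ _ _ _ _ sigma_lebesgue2 leb f mf f0).
have mF : measurable_fun setT (fubini_F leb f) :=
  @measurable_fun_fubini_tonelli_F _ _ _ _ _ leb f mf f0.
rewrite /= /lebesgue2 (@fubini_tonelli1 _ _ _ _ _ leb leb (fubini_F leb f) mF)//.
by move=> u; apply: integral_ge0 => z _.
Qed.

Definition shear_density (p1 p2 p3 : R -> R) (c1 c2 c3 : R3 R -> R)
    (A B w1 w2 w3 ph : R) (u : R3 R) : R :=
  (p1 (c1 u) * p2 (c2 u) * p3 (c3 u) *
  (A + B * cos (w1 * c1 u + w2 * c2 u + w3 * c3 u + ph)))%R.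

(** Unimodular coordinates, encoded by the consequence of the change of variables that is used:
    integrals of products of even kernels against A + B cos factor as in the standard
    coordinates. *)
Definition sheared (c1 c2 c3 : R3 R -> R) : Prop :=
  [/\ measurable_fun [set: borelR3 R] c1, measurable_fun [set: borelR3 R] c2,
      measurable_fun [set: borelR3 R] c3 &
      forall p1 p2 p3 P1 P2 P3 A B w1 w2 w3 ph,
      fourier_pair p1 P1 -> fourier_pair p2 P2 -> fourier_pair p3 P3 ->
      (`|B| <= A)%R ->
      \int[leb3]_u (shear_density p1 p2 p3 c1 c2 c3 A B w1 w2 w3 ph u)%:E =
      (A * (P1 0 * P2 0 * P3 0) + B * (P1 w1 * P2 w2 * P3 w3) * cos ph)%:E].

Section Density.
Variables (p1 p2 p3 P1 P2 P3 : R -> R).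
Hypothesis (pP1 : fourier_pair p1 P1) (pP2 : fourier_pair p2 P2) (pP3 : fourier_pair p3 P3).
Variables (c1 c2 c3 : R3 R -> R).
Hypothesis mc1 : measurable_fun [set: borelR3 R] c1.
Hypothesis mc2 : measurable_fun [set: borelR3 R] c2.
Hypothesis mc3 : measurable_fun [set: borelR3 R] c3.

Lemma shear_density_ge0 A B w1 w2 w3 ph u : (`|B| <= A)%R ->
  (0 <= shear_density p1 p2 p3 c1 c2 c3 A B w1 w2 w3 ph u)%R.
Proof.
have [[[_ p10 _ _] [_ p20 _ _]] [_ p30 _ _]] := (pP1, pP2, pP3).
move=> BA; rewrite /shear_density !mulr_ge0//; set t := (_ + ph)%R.
have : (`|B * cos t| <= A)%R by rewrite normrM -[leRHS]mulr1 ler_pM// cos_max.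
by rewrite ler_norml => /andP[? _]; lra.
Qed.

Lemma measurable_shear_density A B w1 w2 w3 ph :
  measurable_fun [set: borelR3 R] (shear_density p1 p2 p3 c1 c2 c3 A B w1 w2 w3 ph).
Proof.
have [[[mp1 _ _ _] [mp2 _ _ _]] [mp3 _ _ _]] := (pP1, pP2, pP3).
have mcos : measurable_fun [set: measurableTypeR R] (@cos R).
  by apply: continuous_measurable_fun; exact: continuous_cos.
apply: measurable_funM.
  by apply: measurable_funM; [apply: measurable_funM|]; exact: measurableT_comp.
apply: measurable_funD => //; apply: measurable_funM => //.
apply: measurableT_comp => //.
by do ! (apply: measurable_funD => //); apply: measurable_funM.
Qed.

End Density.

(** With [x] integrated first, then [y], then [z], each integration is a translation in a single
    variable. The two variants below let another coordinate lead [c1]. *)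
Lemma sheared_zyx (m1 : R -> R -> R) (m2 : R -> R) (m3 : R) (c1 c2 c3 : R3 R -> R) :
  (forall u, c1 u = u.1.1 + m1 u.1.2 u.2)%R -> (forall u, c2 u = u.1.2 + m2 u.2)%R ->
  (forall u, c3 u = u.2 + m3)%R ->
  measurable_fun [set: borelR3 R] c1 -> measurable_fun [set: borelR3 R] c2 ->
  measurable_fun [set: borelR3 R] c3 -> sheared c1 c2 c3.
Proof.
move=> h1 h2 h3 mc1 mc2 mc3; split => // p1 p2 p3 P1 P2 P3 A B w1 w2 w3 ph pP1 pP2 pP3 BA.
rewrite tonelli_zyx; last first.
- by move=> u; rewrite lee_fin; exact: (shear_density_ge0 pP1 pP2 pP3).
- by apply/measurable_EFinP; exact: (measurable_shear_density pP1 pP2 pP3).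
rewrite -(iterated_integral pP1 pP2 pP3 m1 m2 m3 w1 w2 w3 ph BA).
do 3 (apply: eq_integral => ? _); by rewrite /shear_density !h1 !h2 !h3.
Qed.

Lemma sheared_zxy (m1 : R -> R -> R) (m2 : R -> R) (m3 : R) (c1 c2 c3 : R3 R -> R) :
  (forall u, c1 u = u.1.2 + m1 u.1.1 u.2)%R -> (forall u, c2 u = u.1.1 + m2 u.2)%R ->
  (forall u, c3 u = u.2 + m3)%R ->
  measurable_fun [set: borelR3 R] c1 -> measurable_fun [set: borelR3 R] c2 ->
  measurable_fun [set: borelR3 R] c3 -> sheared c1 c2 c3.
Proof.
move=> h1 h2 h3 mc1 mc2 mc3; split => // p1 p2 p3 P1 P2 P3 A B w1 w2 w3 ph pP1 pP2 pP3 BA.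
rewrite tonelli_zxy; last first.
- by move=> u; rewrite lee_fin; exact: (shear_density_ge0 pP1 pP2 pP3).
- by apply/measurable_EFinP; exact: (measurable_shear_density pP1 pP2 pP3).
rewrite -(iterated_integral pP1 pP2 pP3 m1 m2 m3 w1 w2 w3 ph BA).
do 3 (apply: eq_integral => ? _); by rewrite /shear_density !h1 !h2 !h3.
Qed.

Lemma sheared_xyz (m1 : R -> R -> R) (m2 : R -> R) (m3 : R) (c1 c2 c3 : R3 R -> R) :
  (forall u, c1 u = u.2 + m1 u.1.2 u.1.1)%R -> (forall u, c2 u = u.1.2 + m2 u.1.1)%R ->
  (forall u, c3 u = u.1.1 + m3)%R ->
  measurable_fun [set: borelR3 R] c1 -> measurable_fun [set: borelR3 R] c2 ->
  measurable_fun [set: borelR3 R] c3 -> sheared c1 c2 c3.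
Proof.
move=> h1 h2 h3 mc1 mc2 mc3; split => // p1 p2 p3 P1 P2 P3 A B w1 w2 w3 ph pP1 pP2 pP3 BA.
rewrite tonelli_xyz; last first.
- by move=> u; rewrite lee_fin; exact: (shear_density_ge0 pP1 pP2 pP3).
- by apply/measurable_EFinP; exact: (measurable_shear_density pP1 pP2 pP3).
rewrite -(iterated_integral pP1 pP2 pP3 m1 m2 m3 w1 w2 w3 ph BA).
do 3 (apply: eq_integral => ? _); by rewrite /shear_density !h1 !h2 !h3.
Qed.

Lemma measurable_coord1 : measurable_fun [set: borelR3 R] (fun u : R3 R => u.1.1).
Proof. exact: (measurableT_comp measurable_fst measurable_fst). Qed.

Lemma measurable_coord2 : measurable_fun [set: borelR3 R] (fun u : R3 R => u.1.2).
Proof. exact: (measurableT_comp measurable_snd measurable_fst). Qed.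

Lemma measurable_coord3 : measurable_fun [set: borelR3 R] (fun u : R3 R => u.2).
Proof. exact: measurable_snd. Qed.

End ShearedCoordinates.

(** * Sums of the Fejer kernel over unit cells *)

Section LatticeSums.
Context {R : realType}.

(** An increasing function bounded by 1 whose increments over unit steps dominate 1 / (4 (1 + x^2));
    sums of 1 / (1 + x^2) along a lattice then telescope to at most 4 times 2. *)
Let F (x : R) : R := x / (1 + `|x|).

Let F_norm (x : R) : `|F x| <= 1.
Proof.
have p : 0 < 1 + `|x| by have := normr_ge0 x; lra.
by rewrite normrM normfV (gtr0_norm p) ler_pdivrMr// mul1r; lra.
Qed.

Let key (x a b : R) : 0 < b -> b <= 4 * a * (1 + x ^+ 2) ->
  (1 + x ^+ 2)^-1 <= 4 * (a / b).
Proof.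
move=> b0 ab; have q0 : 0 < 1 + x ^+ 2 by rewrite ltr_pwDl// sqr_ge0.
by rewrite mulrA ler_pdivlMr// mulrC ler_pdivrMr.
Qed.

Let F_step (x : R) : (1 + x ^+ 2)^-1 <= 4 * (F (x + 1) - F x).
Proof.
have [x0|x0] := ger0P x.
  have -> : F (x + 1) - F x = 1 / ((1 + x) * (2 + x)).
    rewrite /F !ger0_norm//; [field|by lra].
    by repeat (apply/andP; split); apply/eqP => ?; lra.
  by apply: key; [rewrite mulr_gt0//; lra|nra].
have [x1|x1] := leP x (-1).
  have -> : F (x + 1) - F x = 1 / ((- x) * (1 - x)).
    rewrite /F !ler0_norm//; [field|by lra|by lra].
    by repeat (apply/andP; split); apply/eqP => ?; lra.
  by apply: key; [rewrite mulr_gt0//; lra|nra].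
have -> : F (x + 1) - F x = ((x + 1) * (1 - x) - x * (2 + x)) / ((2 + x) * (1 - x)).
  rewrite /F (ler0_norm (ltW x0)) ger0_norm; last by lra.
  by field; repeat (apply/andP; split); apply/eqP => ?; lra.
by apply: key; [rewrite mulr_gt0//; lra|nra].
Qed.

Lemma sum_inv_sqr (a : R) n : \sum_(j < n) (1 + (a + j%:R) ^+ 2)^-1 <= 8.
Proof.
apply: (@le_trans _ _ (\sum_(j < n) 4 * (F (a + j.+1%:R) - F (a + j%:R)))).
  by apply: ler_sum => j _; have := F_step (a + j%:R); rewrite -addrA natr1.
rewrite -mulr_sumr -(big_mkord xpredT (fun j => F (a + j.+1%:R) - F (a + j%:R))).
rewrite telescope_sumr// addr0.
have := F_norm (a + n%:R); have := F_norm a; rewrite !ler_norml.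
by move=> /andP[? ?] /andP[? ?]; lra.
Qed.

(** Moving the argument by at most 1 changes 1 + x^2 by a factor at most 4, so the decay constant 5
    becomes 20. *)
Lemma sinc2_cell (a t m : R) : m <= t <= m + 1 ->
  sinc2 (a + t) <= 20 * (1 + (a + m) ^+ 2)^-1.
Proof.
move=> /andP[t1 t2]; apply: le_trans (sinc2_decay _) _.
rewrite ler_pdivlMr; last by have := sqr_ge0 (a + m); lra.
rewrite mulrAC ler_pdivrMr; last by have := sqr_ge0 (a + t); lra.
have [d -> {t1 t2}] : exists2 d, m = t - d & 0 <= d <= 1 by exists (t - m); [ring|lra].
move=> /andP[d0 d1]; rewrite addrA; move: (a + t) => e.
have d2 : d ^+ 2 <= 1 by rewrite expr_le1.
by have := sqr_ge0 (e + d); have := sqr_ge0 e; rewrite sqrrD sqrrB; lra.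
Qed.

Lemma sum_triple (I J L : finType) (f : I -> R) (g : J -> R) (h : L -> R) :
  \sum_(p : I * J * L) f p.1.1 * g p.1.2 * h p.2 =
  (\sum_i f i) * (\sum_j g j) * (\sum_k h k).
Proof.
rewrite -(pair_bigA _ (fun p k => f p.1 * g p.2 * h k))/=.
under eq_bigr do rewrite -mulr_sumr.
rewrite -mulr_suml; congr (_ * _).
rewrite -(pair_bigA _ (fun i j => f i * g j))/=.
by under eq_bigr do rewrite -mulr_sumr; rewrite -mulr_suml.
Qed.

(** In each coordinate the cells are unit intervals, so the decay is summed over a lattice: 160 is
    20 times 8. *)
Lemma sum_sinc2_cells (a1 a2 a3 m : R) n (t1 t2 t3 : 'I_n * 'I_n * 'I_n -> R) :
  (forall j : 'I_n * 'I_n * 'I_n, m + j.1.1%:R <= t1 j <= m + j.1.1%:R + 1) ->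
  (forall j : 'I_n * 'I_n * 'I_n, m + j.1.2%:R <= t2 j <= m + j.1.2%:R + 1) ->
  (forall j : 'I_n * 'I_n * 'I_n, m + j.2%:R <= t3 j <= m + j.2%:R + 1) ->
  \sum_j sinc2 (a1 + t1 j) * sinc2 (a2 + t2 j) * sinc2 (a3 + t3 j) <= 160 ^+ 3.
Proof.
move=> h1 h2 h3.
pose f (a : R) (k : 'I_n) := 20 * (1 + (a + m + k%:R) ^+ 2)^-1.
have f_le a : \sum_k f a k <= 160.
  by rewrite -mulr_sumr; have := sum_inv_sqr (a + m) n; lra.
have f_ge0 a k : 0 <= f a k.
  by rewrite mulr_ge0// invr_ge0; have := sqr_ge0 (a + m + k%:R); lra.
apply: (@le_trans _ _ (\sum_j f a1 j.1.1 * f a2 j.1.2 * f a3 j.2)).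
  apply: ler_sum => j _; have bnd a t (k : 'I_n) : m + k%:R <= t <= m + k%:R + 1 -> sinc2 (a + t) <= f a k.
    by rewrite /f -(addrA a); exact: sinc2_cell.
  by rewrite ?ler_pM ?mulr_ge0 ?sinc2_ge0 ?bnd.
rewrite sum_triple !exprS expr0 mulr1 mulrA.
have F0 a : 0 <= \sum_k f a k by apply: sumr_ge0.
by rewrite ?ler_pM ?mulr_ge0.
Qed.

End LatticeSums.

(** * The large sieve inequality *)

Section LargeSieve.
Context {R : realType}.
Local Notation leb3 := (lebesgue3 R).

Section RintegralSum.
Context d (T : measurableType d) (mu : {measure set T -> \bar R}).

Lemma integrable_scale (a : R) (f : T -> R) : mu.-integrable setT (EFin \o f) ->
  mu.-integrable setT (EFin \o (fun u => a * f u)).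
Proof. by move=> fi; exact: (integrableZl measurableT a fi). Qed.

Lemma integrable_Rsum (I : Type) (s : seq I) (f : I -> T -> R) :
  (forall i, mu.-integrable setT (EFin \o f i)) ->
  mu.-integrable setT (EFin \o (fun x => \sum_(i <- s) f i x)).
Proof.
move=> fi; rewrite (_ : _ \o _ = fun x => (\sum_(i <- s) (EFin \o f i) x)%E).
  by apply: integrable_sum.
by apply/funext => x; rewrite /= sumEFin.
Qed.

Lemma Rintegral_sum (I : Type) (s : seq I) (f : I -> T -> R) :
  (forall i, mu.-integrable setT (EFin \o f i)) ->
  \int[mu]_x (\sum_(i <- s) f i x) = \sum_(i <- s) \int[mu]_x f i x.
Proof.
move=> fi; elim: s => [|i s IH].
  by rewrite big_nil; under eq_Rintegral do rewrite big_nil; rewrite Rintegral_cst// mul0r.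
rewrite big_cons -IH -RintegralD//; last exact: integrable_Rsum.
by apply: eq_Rintegral => x _; rewrite big_cons.
Qed.

End RintegralSum.

Lemma sheared_integrable_cos (c1 c2 c3 : R3 R -> R) (p1 p2 p3 P1 P2 P3 : R -> R) (w1 w2 w3 ph : R) :
  sheared c1 c2 c3 -> fourier_pair p1 P1 -> fourier_pair p2 P2 -> fourier_pair p3 P3 ->
  let f u := p1 (c1 u) * p2 (c2 u) * p3 (c3 u) * cos (w1 * c1 u + w2 * c2 u + w3 * c3 u + ph) in
  leb3.-integrable setT (EFin \o f) /\ \int[leb3]_u f u = P1 w1 * P2 w2 * P3 w3 * cos ph.
Proof.
move=> [mc1 mc2 mc3 sh] pP1 pP2 pP3 f.
(* The integrals known from [sheared] are those of nonnegative densities; the oscillating one is the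
   difference of the cases B = 1 and B = 0. *)
pose D (B : R) := shear_density p1 p2 p3 c1 c2 c3 1 B w1 w2 w3 ph.
have DE B : `|B| <= 1 -> leb3.-integrable setT (EFin \o D B) /\
    \int[leb3]_u D B u = P1 0 * P2 0 * P3 0 + B * (P1 w1 * P2 w2 * P3 w3) * cos ph.
  move=> B1; have E := sh _ _ _ _ _ _ _ _ w1 w2 w3 ph pP1 pP2 pP3 B1.
  split; last by rewrite /Rintegral E /= mul1r.
  apply/integrableP; split.
    by apply/measurable_EFinP; exact: (measurable_shear_density pP1 pP2 pP3).
  under eq_integral do rewrite /= ger0_norm ?(shear_density_ge0 pP1 pP2 pP3)//.
  by rewrite E ltry.
have [|i1 E1] := DE 1; first by rewrite normr1.
have [|i0 E0] := DE 0; first by rewrite normr0.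
have fE : f = fun u => D 1 u - D 0 u.
  by apply/funext => u; rewrite /f /D /shear_density; ring.
split.
  by rewrite fE; exact: (integrableB measurableT i1 i0).
by rewrite fE RintegralB// E1 E0; ring.
Qed.

Section Sieve.
Variables (c1 c2 c3 : R3 R -> R) (h1 h2 h3 : R).
Hypothesis sh : sheared c1 c2 c3.
Hypotheses (h10 : 0 < h1) (h20 : 0 < h2) (h30 : 0 < h3).

(** [8 * W] majorizes the indicator of the support of [g], each factor being at least 1/2 there, and
    the transform of [W] is a product of Fejer kernels. This is the 8 of the sieve constant. *)
Let W u := tri (c1 u / h1) * tri (c2 u / h2) * tri (c3 u / h3).

Let W_ge0 u : 0 <= W u. Proof. by rewrite !mulr_ge0 ?tri_ge0. Qed.

Let WE w1 w2 w3 ph := sheared_integrable_cos w1 w2 w3 ph sh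
  (fourier_pair_scale tri_pair h10) (fourier_pair_scale tri_pair h20)
  (fourier_pair_scale tri_pair h30).

Let W_integrable : leb3.-integrable setT (EFin \o W).
Proof.
have [+ _] := WE 0 0 0 0; rewrite (_ : (fun u => _) = W)//.
by apply/funext => u; rewrite !mul0r !addr0 cos0 mulr1.
Qed.

Variables (N : nat) (m : R) (a1 a2 a3 ph : 'I_N * 'I_N * 'I_N -> R).
Hypothesis cell1 : forall j : 'I_N * 'I_N * 'I_N, m + j.1.1%:R <= h1 * a1 j <= m + j.1.1%:R + 1.
Hypothesis cell2 : forall j : 'I_N * 'I_N * 'I_N, m + j.1.2%:R <= h2 * a2 j <= m + j.1.2%:R + 1.
Hypothesis cell3 : forall j : 'I_N * 'I_N * 'I_N, m + j.2%:R <= h3 * a3 j <= m + j.2%:R + 1.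

Let th j u := a1 j * c1 u + a2 j * c2 u + a3 j * c3 u + ph j.
Let V := h1 * h2 * h3.
Let V0 : 0 < V. Proof. by rewrite !mulr_gt0. Qed.

(** The sign [e] is -1 or 1: a product of two cosines contains the difference and the sum of the
    frequencies, and both kernels must have bounded row sums. *)
Let K (e : R) i j := sinc2 (h1 * (a1 i + e * a1 j)) * sinc2 (h2 * (a2 i + e * a2 j)) *
  sinc2 (h3 * (a3 i + e * a3 j)).

Let K_ge0 e i j : 0 <= K e i j. Proof. by rewrite !mulr_ge0 ?sinc2_ge0. Qed.

Let KC e i j : e ^+ 2 = 1 -> K e i j = K e j i.
Proof.
move=> e2; have E h x y : sinc2 (h * (x + e * y)) = sinc2 (h * (y + e * x)).
  have /eqP : (e - 1) * (e + 1) = 0 by rewrite -subr_sqr expr1n e2 subrr.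
  rewrite mulf_eq0 subr_eq0 addr_eq0 => /orP[]/eqP ->; first by rewrite !mul1r addrC.
  by rewrite -sinc2N; congr sinc2; ring.
by rewrite /K (E h1 (a1 i)) (E h2 (a2 i)) (E h3 (a3 i)).
Qed.

Let K_row e i : e ^+ 2 = 1 -> \sum_j K e i j <= 160 ^+ 3.
Proof.
move=> e2; have E h x y : sinc2 (h * (x + e * y)) = sinc2 (e * h * x + h * y).
  have /eqP : (e - 1) * (e + 1) = 0 by rewrite -subr_sqr expr1n e2 subrr.
  rewrite mulf_eq0 subr_eq0 addr_eq0 => /orP[]/eqP ->; first by rewrite !mul1r mulrDr.
  by rewrite -sinc2N; congr sinc2; ring.
rewrite /K; under eq_bigr do rewrite !E.
exact: (@sum_sinc2_cells _ _ _ _ m).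
Qed.

Let cross i j : let f u := W u * (cos (th i u) * cos (th j u)) in
  leb3.-integrable setT (EFin \o f) /\ `|\int[leb3]_u f u| <= V / 2 * (K (-1) i j + K 1 i j).
Proof.
move=> f; pose g e u := W u * cos ((a1 i + e * a1 j) * c1 u + (a2 i + e * a2 j) * c2 u +
  (a3 i + e * a3 j) * c3 u + (ph i + e * ph j)).
have gE e : leb3.-integrable setT (EFin \o g e) /\ `|\int[leb3]_u g e u| <= V * K e i j.
  have [ig Eg] := WE (a1 i + e * a1 j) (a2 i + e * a2 j) (a3 i + e * a3 j) (ph i + e * ph j).
  split => //; rewrite Eg normrM -[leRHS]mulr1 ler_pM ?cos_max// ger0_norm.
    by rewrite le_eqVlt; apply/orP; left; apply/eqP; rewrite /V /K; ring.
  by rewrite !mulr_ge0 ?sinc2_ge0// ltW.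
have [i1 E1] := gE 1; have [i2 E2] := gE (-1).
have fE : f = fun u => 2^-1 * g (-1) u + 2^-1 * g 1 u.
  apply/funext => u; rewrite /f /g.
  rewrite (_ : _ + (ph i + -1 * ph j) = th i u - th j u); last by rewrite /th; ring.
  rewrite (_ : _ + (ph i + 1 * ph j) = th i u + th j u); last by rewrite /th; ring.
  by rewrite (cosB (th i u)) (cosD (th i u)); field.
have j1 : leb3.-integrable setT (EFin \o (fun u => 2^-1 * g 1 u)).
  exact: integrable_scale.
have j2 : leb3.-integrable setT (EFin \o (fun u => 2^-1 * g (-1) u)).
  exact: integrable_scale.
split; first by rewrite fE; exact: integrableD j2 j1.
rewrite fE RintegralD// !RintegralZl//.
by apply: le_trans (ler_normD _ _) _; rewrite !normrM ger0_norm//; lra.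
Qed.

Variable g : R3 R -> R.
Hypothesis mg : measurable_fun [set: borelR3 R] g.
Hypothesis ig2 : leb3.-integrable setT (EFin \o (fun u => g u ^+ 2)).
Hypothesis supp_g : forall u, g u != 0 ->
  [/\ `|c1 u| <= h1 / 2, `|c2 u| <= h2 / 2 & `|c3 u| <= h3 / 2].

Let g_W u : g u != 0 -> 1 <= 8 * W u.
Proof.
move=> /supp_g[s1 s2 s3].
have T (c h : R) : 0 < h -> `|c| <= h / 2 -> 2^-1 <= tri (c / h).
  move=> h0 ch; apply: tri_ge_half; rewrite normrM normfV (gtr0_norm h0).
  by rewrite ler_pdivrMr// mulrC.
have := T _ _ h10 s1; have := T _ _ h20 s2; have := T _ _ h30 s3.
rewrite /W => t3 t2 t1.
have : 2^-1 * 2^-1 * 2^-1 <= tri (c1 u / h1) * tri (c2 u / h2) * tri (c3 u / h3).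
  by rewrite !ler_pM.
by lra.
Qed.

Lemma integrable_window (q : R3 R -> R) : measurable_fun [set: borelR3 R] q ->
  (forall u, `|q u| <= 1) -> leb3.-integrable setT (EFin \o (fun u => g u * q u)).
Proof.
move=> mq q1.
have : leb3.-integrable setT (EFin \o (fun u => g u ^+ 2 + 8 * W u)).
  exact: (integrableD measurableT ig2 (integrable_scale 8 W_integrable)).
apply: le_integrable => //; first by apply/measurable_EFinP; exact: measurable_funM.
move=> u _ /=; rewrite lee_fin [leRHS]ger0_norm ?addr_ge0 ?sqr_ge0 ?mulr_ge0 ?tri_ge0//.
rewrite normrM; have [->|g0] := eqVneq (g u) 0.
  by rewrite normr0 mul0r addr_ge0 ?sqr_ge0// mulr_ge0 ?W_ge0.
apply: (@le_trans _ _ `|g u|); first by rewrite -[leRHS]mulr1 ler_wpM2l.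
have := g_W g0; rewrite -[g u ^+ 2]real_normK ?num_real//.
by move: (W u) `|g u| => w x; have := sqr_ge0 (x - 1); nra.
Qed.

Let measurable_cos_th j : measurable_fun [set: borelR3 R] (fun u => cos (th j u)).
Proof.
have [mc1 mc2 mc3 _] := sh.
have mcos : measurable_fun [set: measurableTypeR R] (@cos R).
  by apply: continuous_measurable_fun; exact: continuous_cos.
apply: measurableT_comp => //.
by do ! (apply: measurable_funD => //); apply: measurable_funM.
Qed.

(* Duality: with v_j the coefficients to be bounded and H = sum_j v_j cos (th j),
   integrate 0 <= g^2 - 2 t g H + 8 t^2 W H^2; the quadratic form in v is
   controlled by the row sums of the kernel. *)
Theorem large_sieve :
  \sum_j (\int[leb3]_u (g u * cos (th j u))) ^+ 2 <= 8 * 160 ^+ 3 * V * \int[leb3]_u (g u ^+ 2).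
Proof.
have M0 : 0 < 160 ^+ 3 :> R by exact: exprn_gt0.
move: (160 ^+ 3 : R) M0 K_row => M M0 row.
set v := fun j => \int[leb3]_u (g u * cos (th j u)).
set G := \int[leb3]_u (g u ^+ 2); set S := \sum_j v j ^+ 2.
pose H u := \sum_j v j * cos (th j u).
have ig j : leb3.-integrable setT (EFin \o (fun u => g u * cos (th j u))).
  by apply: integrable_window; [exact: measurable_cos_th|move=> u; exact: cos_max].
have gHE : (fun u => g u * H u) = fun u => \sum_j v j * (g u * cos (th j u)).
  by apply/funext => u; rewrite /H mulr_sumr; apply: eq_bigr => j _; rewrite mulrCA.
have igH : leb3.-integrable setT (EFin \o (fun u => g u * H u)).
  by rewrite gHE; apply: integrable_Rsum => j; exact: integrable_scale.
have SE : \int[leb3]_u (g u * H u) = S.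
  rewrite gHE Rintegral_sum; last by move=> j; exact: integrable_scale.
  by apply: eq_bigr => j _; rewrite RintegralZl// expr2.
have WHE : (fun u => W u * H u ^+ 2) =
    fun u => \sum_i \sum_j v i * v j * (W u * (cos (th i u) * cos (th j u))).
  apply/funext => u; rewrite expr2 /H big_distrlr mulr_sumr/=; apply: eq_bigr => i _.
  by rewrite mulr_sumr; apply: eq_bigr => j _; ring.
have iWi i : leb3.-integrable setT
    (EFin \o (fun u => \sum_j v i * v j * (W u * (cos (th i u) * cos (th j u))))).
  by apply: integrable_Rsum => j; apply: integrable_scale; exact: (cross i j).1.
have iWH : leb3.-integrable setT (EFin \o (fun u => W u * H u ^+ 2)).
  by rewrite WHE; exact: integrable_Rsum.
pose L i j := V / 2 * (K (-1) i j + K 1 i j).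
have L0 i j : 0 <= L i j by rewrite !mulr_ge0 ?addr_ge0// ltW.
have LC i j : L i j = L j i by rewrite /L (KC i j) ?sqrrN ?expr1n// (KC (e := 1) i j) ?expr1n.
have Lrow i : \sum_j L i j <= V * M.
  rewrite -mulr_sumr big_split/=.
  have := row 1 i; have := row (-1) i; rewrite sqrrN expr1n => /(_ erefl) k1 /(_ erefl) k2.
  have -> : V * M = V / 2 * (M + M) by field.
  by rewrite ler_pM2l ?lerD// divr_gt0.
(* Schur test: |v_i v_j| is at most (v_i^2 + v_j^2) / 2, and the kernel is symmetric with bounded
   rows. *)
have QE : \int[leb3]_u (W u * H u ^+ 2) <= V * M * S.
  rewrite WHE Rintegral_sum//.
  apply: (@le_trans _ _ (\sum_i \sum_j (v i ^+ 2 / 2 * L i j + v j ^+ 2 / 2 * L j i))).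
    apply: ler_sum => i _; rewrite Rintegral_sum; last first.
      by move=> j; apply: integrable_scale; exact: (cross i j).1.
    apply: ler_sum => j _; rewrite RintegralZl//; last exact: (cross i j).1.
    apply: le_trans (ler_norm _) _; rewrite normrM.
    apply: (@le_trans _ _ (`|v i * v j| * L i j)).
      by rewrite ler_wpM2l//; exact: (cross i j).2.
    rewrite -LC -mulrDl ler_wpM2r// normrM.
    have := sqr_ge0 (`|v i| - `|v j|); rewrite sqrrB -!normrX.
    rewrite (ger0_norm (sqr_ge0 (v i))) (ger0_norm (sqr_ge0 (v j))); lra.
  under eq_bigr do rewrite big_split/=.
  rewrite big_split/= [X in _ + X]exchange_big/= -big_split/= mulr_sumr.
  apply: ler_sum => i _; rewrite -[X in X + _]mulr_sumr -[X in _ + X]mulr_sumr.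
  by rewrite -mulrDl -splitr mulrC; apply: ler_wpM2r; [exact: sqr_ge0|exact: Lrow].
have G0 t : 0 <= G - 2 * t * S + 8 * t ^+ 2 * \int[leb3]_u (W u * H u ^+ 2).
  have -> : G - 2 * t * S + 8 * t ^+ 2 * \int[leb3]_u (W u * H u ^+ 2) =
      \int[leb3]_u (g u ^+ 2 - 2 * t * (g u * H u) + 8 * t ^+ 2 * (W u * H u ^+ 2)).
    rewrite RintegralD//; last exact: integrable_scale.
      rewrite RintegralB//; last exact: integrable_scale.
      by rewrite !RintegralZl// SE.
    exact: (integrableB measurableT ig2 (integrable_scale (2 * t) igH)).
  apply: Rintegral_ge0 => u _.
  have [g0|/g_W W8] := eqVneq (g u) 0.
    by rewrite g0 mul0r mulr0 expr0n subr0 add0r (mulr_ge0 (mulr_ge0 _ (sqr_ge0 t)) (mulr_ge0 (W_ge0 u) (sqr_ge0 _))).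
  have : 0 <= (g u - t * H u) ^+ 2 + (8 * W u - 1) * (t * H u) ^+ 2.
    by rewrite addr_ge0 ?sqr_ge0// mulr_ge0 ?sqr_ge0// subr_ge0.
  by congr (0 <= _); ring.
have {}M0 : 0 < V * M by rewrite mulr_gt0.
(* The value of [t] that minimizes G - 2 t S + 8 t^2 V M S. *)
have := G0 (8 * (V * M))^-1; rewrite -[8 * M * V]mulrA (mulrC M V).
move: (\int[leb3]_u (W u * H u ^+ 2)) QE => Q; move: {row Lrow} (V * M) M0 => {}M M0 QE H1.
have t0 : 0 < (8 * M)^-1 by rewrite invr_gt0 mulr_gt0.
have E : (8 * M) * (8 * M)^-1 = 1 by rewrite mulfV// gt_eqF// mulr_gt0.
have : 0 <= (8 * M) * (G - 2 * (8 * M)^-1 * S + 8 * (8 * M)^-1 ^+ 2 * Q).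
  by rewrite mulr_ge0// mulr_ge0// ltW.
have -> : (8 * M) * (G - 2 * (8 * M)^-1 * S + 8 * (8 * M)^-1 ^+ 2 * Q) =
  8 * M * G - 2 * S + (8 * (8 * M)^-1) * Q by field; rewrite gt_eqF.
have : 8 * (8 * M)^-1 * Q <= S.
  by rewrite mulrAC ler_pdivrMr ?mulr_gt0//; lra.
by lra.
Qed.

End Sieve.

End LargeSieve.

(** * Suprema of the transform over dual cells *)

Section Sampling.
Context {R : realType}.
Local Notation leb3 := (lebesgue3 R).
Local Notation C := (R[i]).

(** The sign [s] = -1 gives the Fourier integral and [s] = 1 the inverse one. *)
Definition ctrans (s : R) (g : R3 R -> C) (x : R3 R) : C :=
  cintegral (fun u => g u * expi (s * dot x u)).

(** Sines are written as cosines shifted by pi / 2, because the large sieve is stated for cosines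
    with arbitrary phases. *)
Definition trig_energy (g1 g2 th : R3 R -> R) : R :=
  (\int[leb3]_u (g1 u * cos (th u))) ^+ 2 + (\int[leb3]_u (g1 u * cos (th u - pi / 2))) ^+ 2 +
  ((\int[leb3]_u (g2 u * cos (th u))) ^+ 2 + (\int[leb3]_u (g2 u * cos (th u - pi / 2))) ^+ 2).

Lemma cabs_sqr (z : C) : cabs z ^+ 2 = complex.Re z ^+ 2 + complex.Im z ^+ 2.
Proof. by case: z => a b; rewrite /cabs /= sqr_sqrtr// addr_ge0 ?sqr_ge0. Qed.

Lemma Re_mul (z w : C) :
  complex.Re (z * w) = complex.Re z * complex.Re w - complex.Im z * complex.Im w.
Proof. by case: z; case: w. Qed.

Lemma Im_mul (z w : C) :
  complex.Im (z * w) = complex.Re z * complex.Im w + complex.Im z * complex.Re w.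
Proof. by case: z; case: w. Qed.

Lemma trig_energy_ge0 g1 g2 th : 0 <= trig_energy g1 g2 th.
Proof. by rewrite !addr_ge0 ?sqr_ge0. Qed.

Lemma ctransE s g x (th := fun u => 2 * pi * (s * dot x u))
    (g1 := fun u => complex.Re (g u)) (g2 := fun u => complex.Im (g u)) :
  (forall (f : R3 R -> R) b, f = g1 \/ f = g2 ->
     leb3.-integrable setT (EFin \o (fun u => f u * cos (th u - b)))) ->
  ctrans s g x =
  ((\int[leb3]_u (g1 u * cos (th u)) - \int[leb3]_u (g2 u * cos (th u - pi / 2))) +i*
   (\int[leb3]_u (g1 u * cos (th u - pi / 2)) + \int[leb3]_u (g2 u * cos (th u))))%C.
Proof.
move=> H.
have i1 (f : R3 R -> R) : f = g1 \/ f = g2 ->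
    leb3.-integrable setT (EFin \o (fun u => f u * cos (th u))).
  by move=> /(H f 0); under eq_fun do rewrite subr0.
have [l1 l2] : (g1 = g1 \/ g1 = g2) /\ (g2 = g1 \/ g2 = g2) by split; [left|right].
rewrite /ctrans /cintegral; congr (_ +i* _)%C.
  rewrite -RintegralB//; [|exact: i1|exact: H].
  by apply: eq_Rintegral => u _; rewrite Re_mul /expi/= cosBpihalf.
rewrite -RintegralD//; [|exact: H|exact: i1].
by apply: eq_Rintegral => u _; rewrite Im_mul /expi/= cosBpihalf.
Qed.

Lemma cabs_ctrans_le s g x (th := fun u => 2 * pi * (s * dot x u))
    (g1 := fun u => complex.Re (g u)) (g2 := fun u => complex.Im (g u)) :
  (forall (f : R3 R -> R) b, f = g1 \/ f = g2 ->
     leb3.-integrable setT (EFin \o (fun u => f u * cos (th u - b)))) ->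
  cabs (ctrans s g x) ^+ 2 <= 2 * trig_energy g1 g2 th.
Proof.
move=> H; rewrite (ctransE H) cabs_sqr /= /trig_energy -/th -/g1 -/g2.
move: (\int[leb3]_u (g1 u * cos (th u))) (\int[leb3]_u (g2 u * cos (th u - pi / 2)))
  (\int[leb3]_u (g1 u * cos (th u - pi / 2))) (\int[leb3]_u (g2 u * cos (th u))) => a b c d.
by have := sqr_ge0 (a + b); have := sqr_ge0 (c - d); nra.
Qed.

Variables (c1 c2 c3 : R3 R -> R) (h1 h2 h3 : R).
Hypothesis sh : sheared c1 c2 c3.
Hypotheses (h10 : 0 < h1) (h20 : 0 < h2) (h30 : 0 < h3).
Variables (g : R3 R -> C) (s : R).
Let g1 u := complex.Re (g u).
Let g2 u := complex.Im (g u).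
Hypothesis mg1 : measurable_fun [set: borelR3 R] g1.
Hypothesis mg2 : measurable_fun [set: borelR3 R] g2.
Hypothesis ig1 : leb3.-integrable setT (EFin \o (fun u => g1 u ^+ 2)).
Hypothesis ig2 : leb3.-integrable setT (EFin \o (fun u => g2 u ^+ 2)).
Hypothesis supp_g : forall u, g u != 0 ->
  [/\ `|c1 u| <= h1 / 2, `|c2 u| <= h2 / 2 & `|c3 u| <= h3 / 2].

Let supp1 u : g1 u != 0 -> [/\ `|c1 u| <= h1 / 2, `|c2 u| <= h2 / 2 & `|c3 u| <= h3 / 2].
Proof. by move=> gu; apply: supp_g; apply: contraNneq gu => gu; rewrite /g1 gu. Qed.
Let supp2 u : g2 u != 0 -> [/\ `|c1 u| <= h1 / 2, `|c2 u| <= h2 / 2 & `|c3 u| <= h3 / 2].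
Proof. by move=> gu; apply: supp_g; apply: contraNneq gu => gu; rewrite /g2 gu. Qed.

Let mcos : measurable_fun [set: measurableTypeR R] (@cos R).
Proof. by apply: continuous_measurable_fun; exact: continuous_cos. Qed.

Lemma integrable_supp_mul (f q : R3 R -> R) : f = g1 \/ f = g2 ->
  measurable_fun [set: borelR3 R] q -> (forall u, `|q u| <= 1) ->
  leb3.-integrable setT (EFin \o (fun u => f u * q u)).
Proof.
by move=> [] -> mq q1; [exact: (integrable_window sh h10 h20 h30 mg1 ig1 supp1)
  |exact: (integrable_window sh h10 h20 h30 mg2 ig2 supp2)].
Qed.

Lemma integrable_supp_cos (f th : R3 R -> R) b : f = g1 \/ f = g2 ->
  measurable_fun [set: borelR3 R] th ->
  leb3.-integrable setT (EFin \o (fun u => f u * cos (th u - b))).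
Proof.
move=> fE mth; apply: integrable_supp_mul => //; last by move=> u; exact: cos_max.
by apply: measurableT_comp => //; exact: measurable_funB.
Qed.

Let bound : R := 2 * (\int[leb3]_u `|g1 u|) ^+ 2 + 2 * (\int[leb3]_u `|g2 u|) ^+ 2.

Lemma trig_energy_le_L1 th : measurable_fun [set: borelR3 R] th -> trig_energy g1 g2 th <= bound.
Proof.
move=> mth.
have key f b : f = g1 \/ f = g2 ->
    (\int[leb3]_u (f u * cos (th u - b))) ^+ 2 <= (\int[leb3]_u `|f u|) ^+ 2.
  move=> fE; rewrite -[leLHS]real_normK ?num_real//.
  have ifc := integrable_supp_cos b fE mth.
  have if1 : leb3.-integrable setT (EFin \o f).
    have := @integrable_supp_mul f (cst 1) fE; rewrite /= normr1.
    by under [X in _ -> _ -> integrable _ _ X]eq_fun do rewrite mulr1; apply.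
  rewrite lerXn2r ?nnegrE ?Rintegral_ge0//.
  apply: le_trans (le_normr_Rintegral measurableT ifc) _.
  apply: le_Rintegral => //; [exact: integrable_norm|exact: integrable_norm|].
  by move=> u _; rewrite normrM -[leRHS]mulr1 ler_wpM2l// cos_max.
have k1 b := key g1 b (or_introl erefl); have k2 b := key g2 b (or_intror erefl).
have {key} e f : \int[leb3]_u (f u * cos (th u - 0)) = \int[leb3]_u (f u * cos (th u)).
  by apply: eq_Rintegral => u _; rewrite subr0.
have := k1 0; have := k1 (pi / 2); have := k2 0; have := k2 (pi / 2); rewrite !e.
by rewrite /trig_energy /bound; lra.
Qed.

Variables (A1 A2 A3 k : R3 R -> R).
Hypothesis phaseE : forall x u,
  2 * pi * (s * dot x u) = A1 x * c1 u + A2 x * c2 u + A3 x * c3 u + k x.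
Variables (N : nat) (m : R).

Definition sampling_cell (j : 'I_N * 'I_N * 'I_N) : set (R3 R) :=
  [set x | [/\ m + j.1.1%:R <= h1 * A1 x <= m + j.1.1%:R + 1,
               m + j.1.2%:R <= h2 * A2 x <= m + j.1.2%:R + 1 &
               m + j.2%:R <= h3 * A3 x <= m + j.2%:R + 1]].

Let th (a : R * R * R * R) (u : R3 R) := a.1.1.1 * c1 u + a.1.1.2 * c2 u + a.1.2 * c3 u + a.2.

Let mth a : measurable_fun [set: borelR3 R] (th a).
Proof.
have [? ? ? _] := sh.
by do ! (apply: measurable_funD => //); apply: measurable_funM.
Qed.

Let F_le x : cabs (ctrans s g x) ^+ 2 <= 2 * trig_energy g1 g2 (th (A1 x, A2 x, A3 x, k x)).
Proof.
have thE : (fun u => 2 * pi * (s * dot x u)) = th (A1 x, A2 x, A3 x, k x).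
  by apply/funext => u; rewrite phaseE.
have := @cabs_ctrans_le s g x; rewrite thE; apply => f b fE.
exact: integrable_supp_cos.
Qed.

(** In each nonempty cell a point is chosen where the squared modulus reaches its supremum up to a
    factor 2, and the sieve is applied to these points. The constant 64 is 8 from the sieve, 4 from
    the passage from the supremum to [trig_energy], and 2 from the two phases. *)
Lemma sampling : exists S : 'I_N * 'I_N * 'I_N -> R,
  [/\ forall j, 0 <= S j,
      forall j x, sampling_cell j x -> cabs (ctrans s g x) ^+ 2 <= S j &
      \sum_j S j <= 64 * 160 ^+ 3 * (h1 * h2 * h3) *
        (\int[leb3]_u (g1 u ^+ 2) + \int[leb3]_u (g2 u ^+ 2))].
Proof.
pose P (j : 'I_N * 'I_N * 'I_N) (q : R * (R * R * R * R)) := [/\ 0 <= q.1,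
  forall x, sampling_cell j x -> cabs (ctrans s g x) ^+ 2 <= q.1,
  q.1 <= 4 * trig_energy g1 g2 (th q.2) &
  [/\ m + j.1.1%:R <= h1 * q.2.1.1.1 <= m + j.1.1%:R + 1,
               m + j.1.2%:R <= h2 * q.2.1.1.2 <= m + j.1.2%:R + 1 &
               m + j.2%:R <= h3 * q.2.1.2 <= m + j.2%:R + 1]].
have [q qP] : {q & forall j, P j (q j)}.
  apply: choice => j; have [[x0 cx0]|nc] := pselect (exists x, sampling_cell j x); last first.
    (* An empty cell gets the value 0 and a fictitious frequency on its boundary, since the sieve
       expects one frequency for every index. *)
    exists (0, ((m + j.1.1%:R) / h1, (m + j.1.2%:R) / h2, (m + j.2%:R) / h3, 0)); split => //=.
    - by move=> x cx; exfalso; apply: nc; exists x.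
    - by rewrite mulr_ge0// trig_energy_ge0.
    - by rewrite ![h1 * _]mulrC ![h2 * _]mulrC ![h3 * _]mulrC !divfK ?gt_eqF// !lexx !lerDl ler01.
  pose B := [set cabs (ctrans s g x) ^+ 2 | x in sampling_cell j].
  have B0 : B (cabs (ctrans s g x0) ^+ 2) by exists x0.
  have hB : has_sup B.
    split; first by exists (cabs (ctrans s g x0) ^+ 2).
    exists (2 * bound) => _ [x cx <-]; apply: le_trans (F_le x) _.
    by rewrite ler_pM2l// trig_energy_le_L1.
  have Bub x : sampling_cell j x -> cabs (ctrans s g x) ^+ 2 <= sup B.
    by move=> cx; apply: ub_le_sup; [case: hB|exists x].
  (* The supremum need not be attained: if it is positive some value exceeds half of it, and
     otherwise any point of the cell will do. *)
  have [x cx Bx] : exists2 x, sampling_cell j x & sup B <= 2 * cabs (ctrans s g x) ^+ 2.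
    have [B_gt0|B_le0] := ltP 0 (sup B).
      have B2 : 0 < sup B / 2 by rewrite divr_gt0.
      by have [_ [x cx <-] Bx] := sup_adherent B2 hB; exists x => //; lra.
    by exists x0 => //; apply: le_trans B_le0 _; rewrite mulr_ge0// sqr_ge0.
  exists (sup B, (A1 x, A2 x, A3 x, k x)); split => //=.
  - by apply: le_trans (Bub _ cx0); exact: sqr_ge0.
  - by apply: le_trans Bx _; have := F_le x; lra.
exists (fun j => (q j).1); split.
- by move=> j; case: (qP j).
- by move=> j x; case: (qP j) => _ + _ _; apply.
have c1P (j : 'I_N * 'I_N * 'I_N) : m + j.1.1%:R <= h1 * (q j).2.1.1.1 <= m + j.1.1%:R + 1 by case: (qP j) => _ _ _ [].
have c2P (j : 'I_N * 'I_N * 'I_N) : m + j.1.2%:R <= h2 * (q j).2.1.1.2 <= m + j.1.2%:R + 1 by case: (qP j) => _ _ _ [].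
have c3P (j : 'I_N * 'I_N * 'I_N) : m + j.2%:R <= h3 * (q j).2.1.2 <= m + j.2%:R + 1 by case: (qP j) => _ _ _ [].
have sieve f : f = g1 \/ f = g2 ->
    \sum_j ((\int[leb3]_u (f u * cos (th (q j).2 u))) ^+ 2 +
            (\int[leb3]_u (f u * cos (th (q j).2 u - pi / 2))) ^+ 2) <=
    2 * (8 * 160 ^+ 3 * (h1 * h2 * h3) * \int[leb3]_u (f u ^+ 2)).
  move=> fE; rewrite big_split/= mulr_natl mulr2n.
  have [mf [if2 sf]] : measurable_fun [set: borelR3 R] f /\
     leb3.-integrable setT (EFin \o (fun u => f u ^+ 2)) /\
     forall u, f u != 0 -> [/\ `|c1 u| <= h1 / 2, `|c2 u| <= h2 / 2 & `|c3 u| <= h3 / 2].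
    by case: fE => ->.
  have S1 p := large_sieve sh h10 h20 h30 p c1P c2P c3P mf if2 sf.
  apply: lerD; first exact: S1.
  have := S1 (fun j => (q j).2.2 - pi / 2); congr (_ <= _).
  by apply: eq_bigr => j _; congr (_ ^+ 2); apply: eq_Rintegral => u _; rewrite addrA.
apply: (@le_trans _ _ (\sum_j 4 * trig_energy g1 g2 (th (q j).2))).
  by apply: ler_sum => j _; case: (qP j).
rewrite -mulr_sumr /trig_energy big_split/=.
have := sieve g1 (or_introl erefl); have := sieve g2 (or_intror erefl).
move: (160 ^+ 3 : R) => M; lra.
Qed.

End Sampling.

(** * Energy and the Fourier transform *)

Section L2Energy.
Local Open Scope ereal_scope.

Lemma Lnorm2E d (T : measurableType d) (R : realType) (mu : {measure set T -> \bar R}) (F : T -> R) :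
  Lnorm mu 2%:E (fun x => (F x)%:E) = (\int[mu]_x (F x ^+ 2)%:E) `^ 2^-1.
Proof.
rewrite Lnorm.unlock; congr (_ `^ _); apply: eq_integral => x _.
by rewrite abse_EFin poweR_EFin -[2%R]/(2%:R) powR_mulrn// -normrX ger0_norm// sqr_ge0.
Qed.

Lemma poweR_half_le (R : realType) (X Y : \bar R) (a : R) : (0 <= a)%R -> 0 <= X -> 0 <= Y ->
  X <= (a ^+ 2)%:E * Y -> X `^ 2^-1 <= a%:E * Y `^ 2^-1.
Proof.
move=> a0 X0 Y0 XY.
have -> : a%:E = (a ^+ 2)%:E `^ 2^-1.
  by rewrite poweR_EFin powR12_sqrt ?sqr_ge0// sqrtr_sqr ger0_norm.
rewrite -poweRM ?lee_fin ?sqr_ge0//; apply: gt0_ler_poweR; rewrite ?invr_ge0//.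
- by rewrite in_itv/= X0 leey.
- by rewrite in_itv/= mule_ge0 ?lee_fin ?sqr_ge0//= leey.
Qed.

Lemma poweR_half_ge (R : realType) (X Y : \bar R) (a : R) : (0 <= a)%R -> 0 <= X -> 0 <= Y ->
  (a ^+ 2)%:E * Y <= X -> a%:E * Y `^ 2^-1 <= X `^ 2^-1.
Proof.
move=> a0 X0 Y0 XY.
have -> : a%:E = (a ^+ 2)%:E `^ 2^-1.
  by rewrite poweR_EFin powR12_sqrt ?sqr_ge0// sqrtr_sqr ger0_norm.
rewrite -poweRM ?lee_fin ?sqr_ge0//; apply: gt0_ler_poweR; rewrite ?invr_ge0//.
- by rewrite in_itv/= mule_ge0 ?lee_fin ?sqr_ge0//= leey.
- by rewrite in_itv/= X0 leey.
Qed.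

Lemma fatou_le d (T : measurableType d) (R : realType) (mu : {measure set T -> \bar R})
    (f_ : nat -> T -> \bar R) (f : T -> \bar R) (B : \bar R) :
  (forall n, measurable_fun setT (f_ n)) -> (forall n x, 0 <= f_ n x) ->
  (forall x, f_ n x @[n --> \oo] --> f x) -> (forall n, \int[mu]_x f_ n x <= B) ->
  \int[mu]_x f x <= B.
Proof.
move=> mf f0 ff fB.
rewrite (eq_integral (fun x => limn_einf (f_^~ x))); last first.
  by move=> x _; rewrite (cvg_limn_einf_sup (ff x)).1.
apply: le_trans (fatou mu measurableT mf (fun n x _ => f0 n x)) _.
rewrite limn_einf_lim; apply: lime_le; first exact: is_cvg_einfs.
near=> n; apply: le_trans (fB n); apply: ereal_inf_lbound; exists n => //=.
Unshelve. all: by end_near. Qed.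

Context {R : realType}.
Local Notation leb3 := (lebesgue3 R).
Local Notation C := (R[i]).

Definition energy (f : R3 R -> C) : \bar R := \int[leb3]_x (cabs (f x) ^+ 2)%:E.

Lemma energy_ge0 f : 0 <= energy f.
Proof. by apply: integral_ge0 => x _; rewrite lee_fin sqr_ge0. Qed.

Lemma L2normE f : L2norm f = energy f `^ 2^-1.
Proof. exact: Lnorm2E. Qed.

Lemma L2norm_lty f : (L2norm f < +oo) = (energy f < +oo).
Proof.
rewrite L2normE; apply/idP/idP; last exact: poweR_lty.
by apply: lty_poweRy; rewrite invr_eq0.
Qed.

Definition cmeasurable (f : R3 R -> C) :=
  measurable_fun [set: borelR3 R] (fun x => complex.Re (f x)) /\
  measurable_fun [set: borelR3 R] (fun x => complex.Im (f x)).

Lemma inL2P f : inL2 f <-> cmeasurable f /\ energy f < +oo.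
Proof. by rewrite -L2norm_lty; split=> [[? ? ?]|[[? ?] ?]]. Qed.

Lemma measurable_cabs_sqr f : cmeasurable f ->
  measurable_fun [set: borelR3 R] (fun x => (cabs (f x) ^+ 2)%:E).
Proof.
move=> [mr mi]; apply/measurable_EFinP; under eq_fun do rewrite cabs_sqr.
by apply: measurable_funD; exact: measurable_funX.
Qed.

Lemma energy_Re_Im f : cmeasurable f -> energy f < +oo ->
  [/\ leb3.-integrable setT (EFin \o (fun u => complex.Re (f u) ^+ 2)%R),
      leb3.-integrable setT (EFin \o (fun u => complex.Im (f u) ^+ 2)%R) &
      energy f = ((\int[leb3]_u (complex.Re (f u) ^+ 2) + \int[leb3]_u (complex.Im (f u) ^+ 2))%R)%:E].
Proof.
move=> cmf ef; have [mr mi] := cmf.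
have iE : leb3.-integrable setT (fun x => (cabs (f x) ^+ 2)%:E).
  apply/integrableP; split; first exact: measurable_cabs_sqr.
  by under eq_integral do rewrite /= ger0_norm ?sqr_ge0//.
have ir : leb3.-integrable setT (EFin \o (fun u => complex.Re (f u) ^+ 2)%R).
  apply: le_integrable iE => //; first by apply/measurable_EFinP; exact: measurable_funX.
  by move=> u _; rewrite /= lee_fin !ger0_norm ?sqr_ge0// cabs_sqr lerDl sqr_ge0.
have ii : leb3.-integrable setT (EFin \o (fun u => complex.Im (f u) ^+ 2)%R).
  apply: le_integrable iE => //; first by apply/measurable_EFinP; exact: measurable_funX.
  by move=> u _; rewrite /= lee_fin !ger0_norm ?sqr_ge0// cabs_sqr lerDr sqr_ge0.
split => //; rewrite EFinD /Rintegral !fineK; last 2 first.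
- exact: (integrable_fin_num measurableT ii).
- exact: (integrable_fin_num measurableT ir).
rewrite -(integralD_EFin measurableT ir ii).
by apply: eq_integral => u _; rewrite cabs_sqr.
Qed.

Lemma cmeasurableB f g : cmeasurable f -> cmeasurable g -> cmeasurable (fun x => f x - g x)%R.
Proof.
move=> [fr fi] [gr gi]; split.
  rewrite (_ : (fun _ => _) = fun x => complex.Re (f x) - complex.Re (g x))%R; last first.
    by apply/funext => x; case: (f x); case: (g x).
  exact: measurable_funB.
rewrite (_ : (fun _ => _) = fun x => complex.Im (f x) - complex.Im (g x))%R; last first.
  by apply/funext => x; case: (f x); case: (g x).
exact: measurable_funB.
Qed.

Lemma cabs_sqrB_le (z w : C) : (cabs (z - w) ^+ 2 <= 2 * cabs z ^+ 2 + 2 * cabs w ^+ 2)%R.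
Proof.
rewrite !cabs_sqr; case: z => a b; case: w => c d /=.
by have := sqr_ge0 (a + c); have := sqr_ge0 (b + d); nra.
Qed.

Lemma cabsN (z : C) : cabs (- z)%R = cabs z.
Proof. by case: z => a b; rewrite /cabs/= !sqrrN. Qed.

Lemma energyB_le f g : cmeasurable f -> cmeasurable g ->
  energy (fun x => f x - g x)%R <= 2%:E * energy f + 2%:E * energy g.
Proof.
move=> mf mg; rewrite /energy -!ge0_integralZl//; last 4 first.
- exact: measurable_cabs_sqr.
- by move=> x _; rewrite lee_fin sqr_ge0.
- exact: measurable_cabs_sqr.
- by move=> x _; rewrite lee_fin sqr_ge0.
rewrite -ge0_integralD//; last 4 first.
- by move=> x _; rewrite -EFinM lee_fin mulr_ge0// sqr_ge0.
- by apply: emeasurable_funM => //; exact: measurable_cabs_sqr.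
- by move=> x _; rewrite -EFinM lee_fin mulr_ge0// sqr_ge0.
- by apply: emeasurable_funM => //; exact: measurable_cabs_sqr.
apply: ge0_le_integral => //.
- by move=> x _; rewrite lee_fin sqr_ge0.
- by apply: measurable_cabs_sqr; exact: cmeasurableB.
- by apply: emeasurable_funD; apply: emeasurable_funM => //; exact: measurable_cabs_sqr.
- by move=> x _; rewrite -!EFinM -EFinD lee_fin cabs_sqrB_le.
Qed.

Definition cintegrable (f : R3 R -> C) :=
  leb3.-integrable setT (EFin \o (fun x => complex.Re (f x))) /\
  leb3.-integrable setT (EFin \o (fun x => complex.Im (f x))).

Lemma cintegrable_cmeasurable f : cintegrable f -> cmeasurable f.
Proof. by move=> [/measurable_int/measurable_EFinP ? /measurable_int/measurable_EFinP]. Qed.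

Lemma measurable_dot (x : R3 R) : measurable_fun [set: borelR3 R] (fun u => dot x u).
Proof.
have [[k1 k2] k3] := (@measurable_coord1 R, @measurable_coord2 R, @measurable_coord3 R).
by apply: measurable_funD; [apply: measurable_funD|]; apply: measurable_funM.
Qed.

Lemma measurable_cos_comp d (T : measurableType d) (th : T -> R) :
  measurable_fun setT th -> measurable_fun setT (fun u => cos (th u)).
Proof.
move=> mth; apply: (@measurableT_comp _ _ _ _ _ _ (@cos R)) => //.
by apply: continuous_measurable_fun; exact: continuous_cos.
Qed.

Lemma integrable_mul_cos (f th : R3 R -> R) : leb3.-integrable setT (EFin \o f) ->
  measurable_fun [set: borelR3 R] th ->
  leb3.-integrable setT (EFin \o (fun u => f u * cos (th u))%R).
Proof.
move=> fi mth; apply: (le_integrable _ _ _ fi) => //.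
  apply/measurable_EFinP; apply: measurable_funM; last exact: measurable_cos_comp.
  by apply/measurable_EFinP; exact: measurable_int fi.
by move=> u _ /=; rewrite lee_fin normrM -[leRHS]mulr1 ler_wpM2l// cos_max.
Qed.

Let measurable_phase s (x : R3 R) :
  measurable_fun [set: borelR3 R] (fun u => 2 * pi * (s * dot x u))%R.
Proof. by do 2 apply: measurable_funM => //; exact: measurable_dot. Qed.

Lemma cintegrable_ctransE s f x (th := fun u => (2 * pi * (s * dot x u))%R)
    (g1 := fun u => complex.Re (f u)) (g2 := fun u => complex.Im (f u)) : cintegrable f ->
  ctrans s f x =
  ((\int[leb3]_u (g1 u * cos (th u)) - \int[leb3]_u (g2 u * cos (th u - pi / 2))) +i*
   (\int[leb3]_u (g1 u * cos (th u - pi / 2)) + \int[leb3]_u (g2 u * cos (th u))))%C%R.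
Proof.
move=> [fr fi]; apply: ctransE => g b [] ->; apply: integrable_mul_cos => //;
  by apply: measurable_funB => //; exact: measurable_phase.
Qed.

Lemma sigma_finite_lebesgue3 : sigma_finite setT leb3.
Proof.
have /sigma_finiteP[F [TF ndF Foo]] := @sigma_finite_lebesgue2 R.
have /sigma_finiteP[G [TG ndG Goo]] :=
  sigma_finiteT (@lebesgue_measure R : {sigma_finite_measure set _ -> \bar R}).
exists (fun n => F n `*` G n).
  rewrite -setXTT TF TG predeqE => -[x y]; split.
    move=> [/= [n _ Fnx] [k _ Gky]]; exists (maxn n k) => //; split.
    - by move: x Fnx; exact/subsetPset/ndF/leq_maxl.
    - by move: y Gky; exact/subsetPset/ndG/leq_maxr.
  by move=> [n _ []/= ? ?]; split; exists n.
move=> k; have [? ?] := Foo k; have [? ?] := Goo k.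
split; first exact: measurableX.
rewrite (_ : leb3 _ = lebesgue2 R (F k) * @lebesgue_measure R (G k)); last exact: product_measure1E.
by rewrite lte_mul_pinfty// ge0_fin_numE.
Qed.

Definition sigma_finite_lebesgue3_mixin :=
  Measure_isSigmaFinite.Build _ _ _ leb3 sigma_finite_lebesgue3.

Definition sigma_lebesgue3 : {sigma_finite_measure set (borelR3 R) -> \bar R} :=
  HB.pack (Measure.sort leb3) sigma_finite_lebesgue3_mixin.

(* f cos = (|f| + f cos) - |f|, and Tonelli applies to the first summand. *)
Lemma measurable_cos_transform (f : R3 R -> R) (s b : R) : leb3.-integrable setT (EFin \o f) ->
  measurable_fun [set: borelR3 R]
    (fun x => \int[leb3]_u (f u * cos (2 * pi * (s * dot x u) - b)))%R.
Proof.
move=> fi; have mf : measurable_fun [set: borelR3 R] f.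
  by apply/measurable_EFinP; exact: measurable_int fi.
pose K (p : R3 R * R3 R) := (`|f p.2| + f p.2 * cos (2 * pi * (s * dot p.1 p.2) - b))%R.
have K0 p : (0 <= K p)%R.
  have : (`|f p.2 * cos (2 * pi * (s * dot p.1 p.2) - b)| <= `|f p.2|)%R.
    by rewrite normrM -[leRHS]mulr1 ler_wpM2l// cos_max.
  by rewrite ler_norml /K => /andP[? _]; lra.
have mf2 : measurable_fun [set: (borelR3 R * borelR3 R)%type] (fun p => f p.2).
  exact: (measurableT_comp mf measurable_snd).
have mK : measurable_fun [set: (borelR3 R * borelR3 R)%type] K.
  apply: measurable_funD; first exact: measurableT_comp.
  apply: measurable_funM => //; apply: measurable_cos_comp; apply: measurable_funB => //.
  do 2 apply: measurable_funM => //.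
  have m1 (g : R3 R -> R) : measurable_fun [set: borelR3 R] g ->
     measurable_fun [set: (borelR3 R * borelR3 R)%type] (fun p => g p.1).
    by move=> mg; exact: (measurableT_comp mg measurable_fst).
  have m2 (g : R3 R -> R) : measurable_fun [set: borelR3 R] g ->
     measurable_fun [set: (borelR3 R * borelR3 R)%type] (fun p => g p.2).
    by move=> mg; exact: (measurableT_comp mg measurable_snd).
  have [[k1 k2] k3] := (@measurable_coord1 R, @measurable_coord2 R, @measurable_coord3 R).
  apply: measurable_funD; [apply: measurable_funD|]; apply: measurable_funM.
  - exact: (m1 _ k1).
  - exact: (m2 _ k1).
  - exact: (m1 _ k2).
  - exact: (m2 _ k2).
  - exact: (m1 _ k3).
  - exact: (m2 _ k3).
have := @measurable_fun_fubini_tonelli_F _ _ _ _ _ sigma_lebesgue3 (EFin \o K)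
  ((measurable_EFinP _ _).2 mK) (fun p => K0 p).
rewrite /fubini_F => mF.
have iA : leb3.-integrable setT (EFin \o (fun u => `|f u|)%R) by exact: integrable_norm.
have iB x : leb3.-integrable setT (EFin \o (fun u => f u * cos (2 * pi * (s * dot x u) - b))%R).
  by apply: integrable_mul_cos => //; apply: measurable_funB => //; exact: measurable_phase.
rewrite (_ : (fun x => _) = fun x => fine (\int[leb3]_u (K (x, u))%:E) - \int[leb3]_u `|f u|)%R; last first.
  apply/funext => x; rewrite -/(Rintegral leb3 setT (fun u => K (x, u))) /K/= RintegralD//.
  by rewrite addrAC subrr add0r.
apply: measurable_funB; last exact: measurable_cst.
by apply: (measurableT_comp _ mF).
Qed.

Lemma cmeasurable_ctrans s f : cintegrable f -> cmeasurable (ctrans s f).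
Proof.
move=> fi; have [fr fim] := fi.
have m0 (g : R3 R -> R) : leb3.-integrable setT (EFin \o g) -> measurable_fun [set: borelR3 R]
    (fun x => \int[leb3]_u (g u * cos (2 * pi * (s * dot x u))))%R.
  move=> gi; have := @measurable_cos_transform g s 0 gi.
  by under [X in measurable_fun _ X -> _]eq_fun do under eq_Rintegral do rewrite subr0.
split; under eq_fun do rewrite (cintegrable_ctransE _ _ fi)/=.
  by apply: measurable_funB; [exact: m0|exact: measurable_cos_transform].
by apply: measurable_funD; [exact: measurable_cos_transform|exact: m0].
Qed.

End L2Energy.

Section StepMajorant.
Context d (T : measurableType d) (R : realType) (mu : {measure set T -> \bar R}).
Local Open Scope ereal_scope.

(* No measurability is needed: the integral is a supremum over the simple
   functions below the integrand. *)
Lemma ge0_integral_mono (f g : T -> \bar R) : (forall x, 0 <= f x) -> (forall x, f x <= g x) ->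
  \int[mu]_x f x <= \int[mu]_x g x.
Proof.
move=> f0 fg; have g0 x : 0 <= g x by apply: le_trans (fg x).
rewrite !ge0_integralTE//; apply: ge_ereal_sup => _ [h hf <-].
by apply: ereal_sup_ubound; exists h => // x; apply: le_trans (fg x).
Qed.

Lemma integral_step_le (J : finType) (F : T -> \bar R) (E : J -> set T) (S : J -> R) :
  (forall j, measurable (E j)) -> (forall j, (0 <= S j)%R) -> (forall x, 0 <= F x) ->
  (forall x, F x <= \sum_j (S j * \1_(E j) x)%:E) ->
  \int[mu]_x F x <= \sum_j (S j)%:E * mu (E j).
Proof.
move=> mE S0 F0 FS; apply: le_trans (ge0_integral_mono F0 FS) _.
rewrite ge0_integral_sum//; last 2 first.
- by move=> j; apply/measurable_EFinP; apply: measurable_funM => //; exact: measurable_indic.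
- by move=> j x _; rewrite lee_fin mulr_ge0.
apply: lee_sum => j _; under eq_integral do rewrite EFinM.
have mI : measurable_fun setT (fun x => (\1_(E j) x)%:E : \bar R).
  by apply/measurable_EFinP; exact: measurable_indic.
by rewrite ge0_integralZl ?lee_fin//; rewrite integral_indic// setIT.
Qed.

End StepMajorant.

(** * Plancherel up to a constant *)

Section Plancherel.
Context {R : realType}.
Local Notation leb := (@lebesgue_measure R).
Local Notation leb3 := (lebesgue3 R).
Local Notation C := (R[i]).

Lemma slab_itv (a m : R) : a != 0 -> [set y : R | m <= a * y <= m + 1] =
  if 0 < a then `[m / a, (m + 1) / a]%classic else `[(m + 1) / a, m / a]%classic.
Proof.
move=> a0; case: ifPn => [a_gt0|].
  apply/seteqP; split => y /=; rewrite in_itv/= ler_pdivrMr// ler_pdivlMr// mulrC; done.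
rewrite -leNgt le_eqVlt (negbTE a0)/= => a_lt0.
by apply/seteqP; split => y /=; rewrite in_itv/= ler_ndivrMr// ler_ndivlMr// mulrC andbC.
Qed.

Lemma measurable_slab (a m : R) : a != 0 ->
  measurable ([set y | m <= a * y <= m + 1] : set (measurableTypeR R)).
Proof. by move=> /(slab_itv m) ->; case: ifPn. Qed.

Lemma lebesgue_slab (a m : R) : a != 0 -> leb [set y | m <= a * y <= m + 1] = (`|a|^-1)%:E.
Proof.
move=> a0; rewrite slab_itv//; case: ifPn => [a_gt0|].
  rewrite lebesgue_measure_itv/= lte_fin ltr_pM2r ?invr_gt0// ltrDl ltr01 -EFinD.
  by rewrite gtr0_norm//; congr EFin; field; rewrite gt_eqF.
rewrite -leNgt le_eqVlt (negbTE a0)/= => a_lt0.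
rewrite lebesgue_measure_itv/= lte_fin ltr_nM2r ?invr_lt0// ltrDl ltr01 -EFinD.
by rewrite ltr0_norm//; congr EFin; field; rewrite lt_eqF.
Qed.

Lemma lebesgue3_box (A1 A2 A3 : set (measurableTypeR R)) :
  measurable A1 -> measurable A2 -> measurable A3 ->
  leb3 (A1 `*` A2 `*` A3) = (leb A1 * leb A2 * leb A3)%E.
Proof.
move=> m1 m2 m3; rewrite -lebesgue2E//.
by apply: product_measure1E => //; exact: measurableX.
Qed.

Lemma truncn_slab (t : R) (M : nat) : `|t| <= M%:R ->
  exists i : 'I_(2 * M).+1, - M%:R + i%:R <= t <= - M%:R + i%:R + 1.
Proof.
rewrite ler_norml => /andP[t1 t2].
have t0 : 0 <= t + M%:R by lra.
have /andP[l1 l2] := truncn_itv t0.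
(* At t = M the integer part is 2 M, hence the (2 M).+1 intervals. *)
have lt : (Num.truncn (t + M%:R) < (2 * M).+1)%N.
  rewrite ltnS -(ler_nat R); apply: le_trans l1 _; rewrite natrM; lra.
by exists (Ordinal lt) => /=; move: l2; rewrite -natr1; lra.
Qed.

Definition plancherel_const : R := 160 ^+ 3.

Lemma plancherel_const_gt0 : 0 < plancherel_const. Proof. exact: exprn_gt0. Qed.

Lemma sheared_id : sheared (fun u : R3 R => u.1.1) (fun u => u.1.2) (fun u => u.2).
Proof.
have [[k1 k2] k3] := (@measurable_coord1 R, @measurable_coord2 R, @measurable_coord3 R).
by apply: (@sheared_zyx _ (fun _ _ => 0) (fun _ => 0) 0) => // u; rewrite addr0.
Qed.

Lemma cintegrable_compact (f : R3 R -> C) (n : nat) : cmeasurable f -> (energy f < +oo)%E ->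
  (forall u, f u != 0 -> [/\ `|u.1.1| <= n.+1%:R, `|u.1.2| <= n.+1%:R & `|u.2| <= n.+1%:R]) ->
  cintegrable f.
Proof.
move=> mf ef supp; have [mr mi] := mf; have [ir ii eE] := energy_Re_Im mf ef.
pose h : R := 2 * n.+1%:R; have h0 : 0 < h by rewrite mulr_gt0.
have sup u : f u != 0 -> [/\ `|u.1.1| <= h / 2, `|u.1.2| <= h / 2 & `|u.2| <= h / 2].
  by rewrite (_ : h / 2 = n.+1%:R); [exact: supp|rewrite /h; field].
have H (g : R3 R -> R) : g = (fun u => complex.Re (f u)) \/ g = (fun u => complex.Im (f u)) ->
   leb3.-integrable setT (EFin \o g).
  move=> gE; have := @integrable_supp_mul _ _ _ _ _ _ _ sheared_id h0 h0 h0 f mr mi ir ii sup g (cst 1) gE.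
  by under [X in _ -> _ -> integrable _ _ X]eq_fun do rewrite mulr1; apply => // u; rewrite normr1.
by split; apply: H; [left|right].
Qed.

(** If h is the side of a cube containing the support, the sieve costs h^3 while the dual cells have
    volume (2 pi h)^-3: the two cancel, and the constant does not depend on [n]. *)
Lemma plancherel_compact (f : R3 R -> C) (n : nat) (s : R) : s ^+ 2 = 1 ->
  cmeasurable f -> (energy f < +oo)%E ->
  (forall u, f u != 0 -> [/\ `|u.1.1| <= n.+1%:R, `|u.1.2| <= n.+1%:R & `|u.2| <= n.+1%:R]) ->
  (energy (ctrans s f) <= plancherel_const%:E * energy f)%E.
Proof.
move=> s2 mf ef supp.
have [mr mi] := mf; have [ir ii eE] := energy_Re_Im mf ef.
pose h : R := 2 * n.+1%:R; have h0 : 0 < h by rewrite mulr_gt0.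
have sup u : f u != 0 -> [/\ `|u.1.1| <= h / 2, `|u.1.2| <= h / 2 & `|u.2| <= h / 2].
  by rewrite (_ : h / 2 = n.+1%:R); [exact: supp|rewrite /h; field].
have cf := cintegrable_compact mf ef supp.
pose a : R := h * (2 * pi * s).
have s0 : s != 0 by apply: contra_eq_neq s2 => ->; rewrite expr0n eq_sym oner_eq0.
have a0 : a != 0 by rewrite !mulf_neq0// ?gt_eqF ?pi_gt0.
have sN : `|s| = 1 by apply/eqP; rewrite -sqrp_eq1// real_normK ?num_real// s2.
pose F x : R := cabs (ctrans s f x) ^+ 2.
have F0 x : 0 <= F x by exact: sqr_ge0.
pose Q M : set (borelR3 R) := [set x | [/\ `|a * x.1.1| <= M%:R, `|a * x.1.2| <= M%:R & `|a * x.2| <= M%:R]].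
have mQ M : measurable (Q M).
  have I3 : Q M = [set y : R | `|a * y| <= M%:R] `*` [set y : R | `|a * y| <= M%:R] `*` [set y : R | `|a * y| <= M%:R].
    by apply/seteqP; split => [[[x y] z] [? ? ?]//|[[x y] z] [[? ?] ?]].
  have mI : measurable ([set y : R | `|a * y| <= M%:R] : set (measurableTypeR R)).
    have mg : measurable_fun [set: measurableTypeR R] (fun y : R => `|a * y|).
      by apply: measurableT_comp => //; exact: measurable_funM.
    rewrite (_ : [set y | _] = (fun y : R => `|a * y|) @^-1` `]-oo, M%:R]); last first.
      by apply/seteqP; split => y /=; rewrite in_itv.
    by rewrite -[X in measurable X]setTI; exact: mg.
  by rewrite I3; apply: measurableX => //; exact: measurableX.
(* Sampling deals with finitely many cells, hence the exhaustion of space by the boxes [Q M]. *)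
apply: (@fatou_le _ (borelR3 R) R leb3 (fun M (x : R3 R) => (F x * \1_(Q M) x)%:E)).
- move=> M; apply/measurable_EFinP; apply: measurable_funM; last exact: measurable_indic.
  by apply/measurable_EFinP; apply: measurable_cabs_sqr; exact: cmeasurable_ctrans.
- by move=> M x; rewrite lee_fin mulr_ge0.
- move=> x; apply: cvg_near_cst.
  pose B := `|a * x.1.1| + `|a * x.1.2| + `|a * x.2|.
  near=> M.
  have BM : B <= M%:R by near: M; exact: nbhs_infty_ger.
  rewrite indicE mem_set ?mulr1//= /Q/=.
  split; apply: (le_trans _ BM); rewrite /B.
  - by rewrite -addrA lerDl addr_ge0.
  - by rewrite addrAC lerDr addr_ge0.
  - by rewrite lerDr addr_ge0.
- move=> M.
  pose A (k : R3 R -> R) (x : R3 R) := 2 * pi * s * k x.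
  have phE x u : 2 * pi * (s * dot x u) =
     A (fun x => x.1.1) x * u.1.1 + A (fun x => x.1.2) x * u.1.2 + A (fun x => x.2) x * u.2 + 0.
    by rewrite /A /dot; ring.
  have [S [S0 SF Ssum]] := sampling sheared_id h0 h0 h0 mr mi ir ii sup phE (2 * M).+1 (- M%:R).
  pose E (j : 'I_(2 * M).+1 * 'I_(2 * M).+1 * 'I_(2 * M).+1) : set (borelR3 R) :=
    [set y : R | - M%:R + j.1.1%:R <= a * y <= - M%:R + j.1.1%:R + 1] `*`
    [set y : R | - M%:R + j.1.2%:R <= a * y <= - M%:R + j.1.2%:R + 1] `*`
    [set y : R | - M%:R + j.2%:R <= a * y <= - M%:R + j.2%:R + 1].
  have mE j : measurable (E j).
    by apply: measurableX; [apply: measurableX|]; exact: measurable_slab.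
  have EE j : leb3 (E j) = ((`|a|^-1) ^+ 3)%:E.
    rewrite lebesgue3_box ?lebesgue_slab//; try exact: measurable_slab.
    by rewrite -!EFinM !exprS expr0 mulr1 mulrA.
  apply: (@le_trans _ _ (\sum_j (S j)%:E * leb3 (E j))%E).
    apply: integral_step_le => //.
    - by move=> x; rewrite lee_fin mulr_ge0.
    - move=> x; rewrite sumEFin lee_fin.
      have [xQ|xQ] := pselect (Q M x); last first.
        by rewrite indicE memNset// mulr0 sumr_ge0// => j _; rewrite mulr_ge0.
      have [/truncn_slab[j1 h1] /truncn_slab[j2 h2] /truncn_slab[j3 h3]] := xQ.
      rewrite indicE mem_set// mulr1 (bigD1 (j1, j2, j3))//= indicE mem_set; last by [].
      rewrite mulr1 -[leLHS]addr0 lerD//; last by rewrite sumr_ge0// => j _; rewrite mulr_ge0.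
      have aA y : h * (2 * pi * s * y) = a * y by rewrite /a; ring.
      by apply: SF; rewrite /sampling_cell/= /A !aA.
  under eq_bigr do rewrite EE -EFinM.
  rewrite sumEFin -mulr_suml eE -EFinM lee_fin.
  rewrite (_ : `|a| = 4 * pi * n.+1%:R); last first.
    by rewrite /a /h !normrM sN (gtr0_norm (pi_gt0 R)) !ger0_norm//; ring.
  rewrite exprVn ler_pdivrMr ?exprn_gt0 ?mulr_gt0 ?pi_gt0//.
  apply: le_trans Ssum _.
  (* The factor 64 of the sampling is absorbed by (2 pi)^3. *)
  have p8 : 8 <= pi ^+ 3 :> R.
    rewrite (_ : 8 = 2 ^+ 3); last by ring.
    by rewrite lerXn2r ?nnegrE ?pi_ge0// pi_ge2.
  set I := (X in _ * X <= _); have I0 : 0 <= I by rewrite addr_ge0// Rintegral_ge0// => ? _; exact: sqr_ge0.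
  rewrite /plancherel_const; have M0 : 0 < 160 ^+ 3 :> R by exact: exprn_gt0.
  move: (160 ^+ 3) M0 => D D0.
  rewrite -/I (_ : 64 * D * (h * h * h) * I = (D * I) * (64 * n.+1%:R ^+ 3 * 8)); last by rewrite /h; ring.
  apply: ler_wpM2l; first by rewrite mulr_ge0// ltW.
  rewrite (_ : (4 * pi * n.+1%:R) ^+ 3 = 64 * n.+1%:R ^+ 3 * pi ^+ 3); last by ring.
  by apply: ler_wpM2l => //; rewrite mulr_ge0// exprn_ge0.
Unshelve. all: by end_near. Qed.

Lemma enorm_coord (x : R3 R) :
  [/\ `|x.1.1| <= enorm x, `|x.1.2| <= enorm x & `|x.2| <= enorm x].
Proof.
have H (a b : R) : 0 <= b -> `|a| <= Num.sqrt (a * a + b).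
  move=> b0; rewrite -sqrtr_sqr ler_wsqrtr// expr2 lerDl//.
have s0 (y : R) : 0 <= y * y by rewrite -expr2 sqr_ge0.
split; rewrite /enorm /dot.
- by rewrite -addrA; apply: H; rewrite addr_ge0.
- by rewrite [X in X + _]addrC -addrA; apply: H; rewrite addr_ge0.
- by rewrite [X in Num.sqrt X]addrC; apply: H; rewrite addr_ge0.
Qed.

Lemma measurable_enorm : measurable_fun [set: borelR3 R] (@enorm R).
Proof.
apply: (@measurableT_comp _ _ _ _ _ _ (@Num.sqrt R)).
  by apply: continuous_measurable_fun; exact: sqrt_continuous.
have [[k1 k2] k3] := (@measurable_coord1 R, @measurable_coord2 R, @measurable_coord3 R).
by apply: measurable_funD; [apply: measurable_funD|]; apply: measurable_funM.
Qed.

Let ball_ind (n : nat) (x : R3 R) : R := if enorm x <= n%:R then 1 else 0.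

Let ball_ind01 n x : 0 <= ball_ind n x <= 1.
Proof. by rewrite /ball_ind; case: ifPn; rewrite lexx ler01. Qed.

Let truncateE n (f : R3 R -> C) :
  [/\ (fun x => complex.Re (truncate n f x)) = (fun x => complex.Re (f x) * ball_ind n x),
      (fun x => complex.Im (truncate n f x)) = (fun x => complex.Im (f x) * ball_ind n x) &
      (fun x => cabs (truncate n f x) ^+ 2) = (fun x => cabs (f x) ^+ 2 * ball_ind n x)].
Proof.
split; apply/funext => x; rewrite /truncate /ball_ind; case: ifPn => _; rewrite ?mulr1 ?mulr0//.
by rewrite cabs_sqr/= expr0n addr0.
Qed.

Let ball_ind_cvg x : \forall n \near \oo, ball_ind n x = 1.
Proof. by near=> n; rewrite /ball_ind ifT//; near: n; exact: nbhs_infty_ger.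
Unshelve. all: by end_near. Qed.

Let measurable_ball_ind n : measurable_fun [set: borelR3 R] (ball_ind n).
Proof.
apply: measurable_fun_ifT => //.
by apply: measurable_fun_ler => //; exact: measurable_enorm.
Qed.

Lemma cmeasurable_truncate n (f : R3 R -> C) : cmeasurable f -> cmeasurable (truncate n f).
Proof.
move=> [mr mi]; have [rE iE _] := truncateE n f.
by split; [rewrite rE|rewrite iE]; apply: measurable_funM => //; exact: measurable_ball_ind.
Qed.

Lemma energy_truncate_le n (f : R3 R -> C) : (energy (truncate n f) <= energy f)%E.
Proof.
apply: ge0_integral_mono => x; rewrite lee_fin ?sqr_ge0//.
have [_ _ /(congr1 (fun F => F x)) ->] := truncateE n f.
by rewrite -[leRHS]mulr1 ler_wpM2l ?sqr_ge0//; case/andP: (ball_ind01 n x).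
Qed.

Lemma supp_truncate n (f : R3 R -> C) u : truncate n f u != 0 ->
  [/\ `|u.1.1| <= n.+1%:R, `|u.1.2| <= n.+1%:R & `|u.2| <= n.+1%:R].
Proof.
rewrite /truncate; case: ifPn => [un _|_]; last by rewrite eqxx.
have n1 : n%:R <= n.+1%:R :> R by rewrite ler_nat.
by have [? ? ?] := enorm_coord u; split; apply: le_trans n1; apply: le_trans un.
Qed.

Lemma cintegrable_truncate n (f : R3 R -> C) : cmeasurable f -> (energy f < +oo)%E -> cintegrable (truncate n f).
Proof.
move=> mf ef; apply: (@cintegrable_compact _ n); first exact: cmeasurable_truncate.
  by apply: le_lt_trans ef; exact: energy_truncate_le.
exact: supp_truncate.
Qed.

Let cvg_ball_integral (g q : R3 R -> R) : leb3.-integrable setT (EFin \o g) ->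
  measurable_fun [set: borelR3 R] q -> (forall u, `|q u| <= 1) ->
  \int[leb3]_u (g u * ball_ind n u * q u) @[n --> \oo] --> \int[leb3]_u (g u * q u).
Proof.
move=> gi mq q1.
have mg : measurable_fun [set: borelR3 R] g by apply/measurable_EFinP; exact: measurable_int gi.
have [|||||i0 _ H] := @dominated_convergence _ (borelR3 R) R leb3 setT measurableT
  (fun n u => (g u * ball_ind n u * q u)%:E) (fun u => (g u * q u)%:E) (fun u => `|g u|%:E).
- by move=> n; apply/measurable_EFinP; do 2 apply: measurable_funM => //.
- by apply/measurable_EFinP; exact: measurable_funM.
- apply: aeW => u _; apply: cvg_near_cst; near=> n.
  by rewrite (_ : ball_ind n u = 1) ?mulr1//; near: n; exact: ball_ind_cvg.
- exact: integrable_norm.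
- apply: aeW => u n _; rewrite /= lee_fin !normrM -[leRHS]mulr1 -mulrA ler_wpM2l// mulr_ile1//.
  by rewrite ger0_norm; case/andP: (ball_ind01 n u).
apply: fine_cvg; rewrite /Rintegral fineK; first exact: H.
exact: (integrable_fin_num measurableT i0).
Unshelve. all: by end_near. Qed.

(** The transforms of the truncations converge pointwise by dominated convergence, and Fatou's lemma
    carries the uniform bound to the limit. *)
Lemma plancherel_L1L2 (f : R3 R -> C) (s : R) : s ^+ 2 = 1 -> cintegrable f -> (energy f < +oo)%E ->
  (energy (ctrans s f) <= plancherel_const%:E * energy f)%E.
Proof.
move=> s2 fi ef; have mf := cintegrable_cmeasurable fi.
have ti n := cintegrable_truncate n mf ef.
apply: (@fatou_le _ (borelR3 R) R leb3 (fun n x => (cabs (ctrans s (truncate n f) x) ^+ 2)%:E)).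
- by move=> n; apply: measurable_cabs_sqr; exact: cmeasurable_ctrans.
- by move=> n x; rewrite lee_fin sqr_ge0.
- move=> x; apply: cvg_EFin; first by near=> n.
  rewrite (_ : fine \o _ = fun n => cabs (ctrans s (truncate n f) x) ^+ 2)//.
  under eq_fun do rewrite (cintegrable_ctransE s x (ti _)) cabs_sqr/=.
  rewrite (cintegrable_ctransE s x fi) cabs_sqr/=.
  have H (g : R3 R -> R) (g_ : nat -> R3 R -> R) b : leb3.-integrable setT (EFin \o g) ->
      (forall n, g_ n = fun u => g u * ball_ind n u) ->
      \int[leb3]_u (g_ n u * cos (2 * pi * (s * dot x u) - b)) @[n --> \oo] -->
      \int[leb3]_u (g u * cos (2 * pi * (s * dot x u) - b)).
    move=> gi gE; under eq_fun do rewrite gE.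
    apply: cvg_ball_integral => //; last by move=> u; exact: cos_max.
    apply: measurable_cos_comp; apply: measurable_funB => //.
    by do 2 apply: measurable_funM => //; exact: measurable_dot.
  have rE n : (fun u => complex.Re (truncate n f u)) = fun u => complex.Re (f u) * ball_ind n u.
    by have [] := truncateE n f.
  have iE n : (fun u => complex.Im (truncate n f u)) = fun u => complex.Im (f u) * ball_ind n u.
    by have [] := truncateE n f.
  have := H _ _ 0 fi.1 rE; have := H _ _ 0 fi.2 iE.
  have := H _ _ (pi / 2) fi.1 rE; have := H _ _ (pi / 2) fi.2 iE.
  have e0 (g : R3 R -> R) : \int[leb3]_u (g u * cos (2 * pi * (s * dot x u) - 0)) =
     \int[leb3]_u (g u * cos (2 * pi * (s * dot x u))) by apply: eq_Rintegral => u _; rewrite subr0.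
  rewrite !e0; under [X in _ -> _ -> X @ _ --> _ -> _]eq_fun do rewrite e0.
  under [X in _ -> _ -> _ -> X @ _ --> _ -> _]eq_fun do rewrite e0.
  move=> h1 h2 h3 h4.
  apply: cvgD; rewrite expr2; under eq_fun do rewrite expr2.
    by apply: cvgM; apply: cvgB.
  by apply: cvgM; apply: cvgD.
- move=> n; apply: le_trans (plancherel_compact s2 (cmeasurable_truncate n mf) _ (@supp_truncate n f)) _.
    by apply: le_lt_trans ef; exact: energy_truncate_le.
  apply: lee_wpmul2l; last exact: energy_truncate_le.
  by rewrite lee_fin ltW// plancherel_const_gt0.
Unshelve. all: by end_near. Qed.

Lemma dotC (x y : R3 R) : dot x y = dot y x.
Proof. by rewrite /dot; ring. Qed.

Lemma fourier_integralE (f : R3 R -> C) : fourier_integral f = ctrans (-1) f.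
Proof.
apply/funext => x; rewrite /fourier_integral /ctrans; congr cintegral.
by apply/funext => u; rewrite dotC mulN1r.
Qed.

Lemma cintegrableB (f g : R3 R -> C) : cintegrable f -> cintegrable g ->
  cintegrable (fun x => f x - g x).
Proof.
move=> [fr fi] [gr gi]; split.
  rewrite (_ : (fun _ => _) = fun x => complex.Re (f x) - complex.Re (g x)); last first.
    by apply/funext => x; case: (f x); case: (g x).
  exact: (integrableB measurableT fr gr).
rewrite (_ : (fun _ => _) = fun x => complex.Im (f x) - complex.Im (g x)); last first.
  by apply/funext => x; case: (f x); case: (g x).
exact: (integrableB measurableT fi gi).
Qed.

Lemma ctransB s (f g : R3 R -> C) x : cintegrable f -> cintegrable g ->
  ctrans s (fun u => f u - g u) x = ctrans s f x - ctrans s g x.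
Proof.
move=> fi gi; rewrite !cintegrable_ctransE//; last exact: cintegrableB.
have mth b : measurable_fun [set: borelR3 R] (fun u => 2 * pi * (s * dot x u) - b).
  by apply: measurable_funB => //; do 2 apply: measurable_funM => //; exact: measurable_dot.
have mth0 : measurable_fun [set: borelR3 R] (fun u => 2 * pi * (s * dot x u)).
  by do 2 apply: measurable_funM => //; exact: measurable_dot.
have H (c a b t : R3 R -> R) : (forall u, c u = a u - b u) ->
    leb3.-integrable setT (EFin \o a) -> leb3.-integrable setT (EFin \o b) ->
    measurable_fun [set: borelR3 R] t ->
    \int[leb3]_u (c u * cos (t u)) =
    \int[leb3]_u (a u * cos (t u)) - \int[leb3]_u (b u * cos (t u)).
  move=> cE ai bi mt; rewrite -RintegralB//; try exact: integrable_mul_cos.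
  by apply: eq_Rintegral => u _; rewrite cE mulrBl.
have rB u : complex.Re (f u - g u) = complex.Re (f u) - complex.Re (g u) by case: (f u); case: (g u).
have iB u : complex.Im (f u - g u) = complex.Im (f u) - complex.Im (g u) by case: (f u); case: (g u).
have [[fr fm] [gr gm]] := (fi, gi).
by rewrite !(H _ _ _ _ rB) ?(H _ _ _ _ iB)//; apply/eqP; rewrite eq_complex/=; apply/andP; split; apply/eqP; ring.
Qed.

Lemma cvg_poweR_half (u : nat -> \bar R) : (forall n, 0 <= u n)%E ->
  u @ \oo --> 0%E -> (u n `^ 2^-1)%E @[n --> \oo] --> 0%E.
Proof.
move=> u0 uc; have ufin := fcvg_is_fine uc.
apply: cvg_EFin; first by near do rewrite fin_num_poweR//.
have fc : fine (u n) @[n --> \oo] --> (0 : R) by exact: (fine_cvg uc).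
rewrite (_ : _ \o _ = fun n => Num.sqrt (fine (u n))); last first.
  by apply/funext => n; rewrite /= fine_poweR powR12_sqrt// fine_ge0.
have := cvg_comp _ _ fc (@sqrt_continuous R 0); rewrite sqrtr0; exact.
Unshelve. all: by end_near. Qed.

Lemma cvg_energy_truncate (f : R3 R -> C) : cmeasurable f -> (energy f < +oo)%E ->
  energy (fun x => f x - truncate n f x) @[n --> \oo] --> 0%E.
Proof.
move=> mf ef.
have iE : leb3.-integrable setT (fun x => (cabs (f x) ^+ 2)%:E).
  apply/integrableP; split; first exact: measurable_cabs_sqr.
  by under eq_integral do rewrite /= ger0_norm ?sqr_ge0//.
have E n x : cabs (f x - truncate n f x) ^+ 2 = cabs (f x) ^+ 2 * (1 - ball_ind n x).
  rewrite /truncate /ball_ind; case: ifPn => _; rewrite ?subrr ?subr0 ?mulr1 ?mulr0//.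
  by rewrite cabs_sqr/= expr0n addr0.
have [|||||_ _ H] := @dominated_convergence _ (borelR3 R) R leb3 setT measurableT
  (fun n x => (cabs (f x - truncate n f x) ^+ 2)%:E) (cst 0%E) (fun x => (cabs (f x) ^+ 2)%:E).
- move=> n; apply: measurable_cabs_sqr; apply: cmeasurableB => //; exact: cmeasurable_truncate.
- by [].
- apply: aeW => x _; apply: cvg_near_cst; near=> n.
  rewrite E (_ : ball_ind n x = 1) ?subrr ?mulr0//; near: n; exact: ball_ind_cvg.
- by [].
- apply: aeW => x n _; rewrite /= lee_fin ger0_norm ?sqr_ge0// E -[leRHS]mulr1 ler_wpM2l ?sqr_ge0//.
  by rewrite lerBlDr lerDl; case/andP: (ball_ind01 n x).
by move: H; rewrite integral0.
Unshelve. all: by end_near. Qed.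

(** The error made by truncating at [n] is the transform of the tail of [f], whose energy is
    controlled by the preceding inequality and tends to 0. *)
Lemma is_fourier_ctrans (f : R3 R -> C) : cintegrable f -> (energy f < +oo)%E ->
  is_fourier f (ctrans (-1) f).
Proof.
move=> fi ef; have mf := cintegrable_cmeasurable fi.
have sN1 : (-1) ^+ 2 = 1 :> R by rewrite sqrrN expr1n.
split.
  apply/inL2P; split; first exact: cmeasurable_ctrans.
  apply: le_lt_trans (plancherel_L1L2 sN1 fi ef) _.
  by rewrite lte_mul_pinfty// ?lee_fin ?ltW ?plancherel_const_gt0.
under eq_fun do rewrite L2normE fourier_integralE.
apply: cvg_poweR_half; first by move=> n; exact: energy_ge0.
have ti n := cintegrable_truncate n mf ef.
apply: (@squeeze_cvge _ _ _ _ (cst 0%E) _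
  (fun n => plancherel_const%:E * energy (fun x => (f x - truncate n f x)%R))%E).
- apply: nearW => n; rewrite energy_ge0/=.
  rewrite (_ : (fun xi => _) = ctrans (-1) (fun x => f x - truncate n f x)); last first.
    by apply/funext => x; rewrite ctransB.
  apply: plancherel_L1L2 => //; first exact: cintegrableB.
  have mt := cmeasurable_truncate n mf.
  apply: le_lt_trans (energyB_le mf mt) _.
  rewrite lte_add_pinfty// lte_mul_pinfty//.
  by apply: le_lt_trans ef; exact: energy_truncate_le.
- exact: cvg_cst.
- rewrite -(mule0 plancherel_const%:E); apply: cvgeZl => //; exact: cvg_energy_truncate.
Qed.

(** The factor 2 is the price of |a + b|^2 <= 2 |a|^2 + 2 |b|^2 when [fhat] is compared with the
    transform of a truncation. *)
Lemma energy_fourier_le (f fhat : R3 R -> C) : inL2 f -> is_fourier f fhat ->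
  (energy fhat <= (2 * plancherel_const)%:E * energy f)%E.
Proof.
move=> /inL2P[mf ef] [/inL2P[mh eh] hc].
have sN1 : (-1) ^+ 2 = 1 :> R by rewrite sqrrN expr1n.
apply/lee_addgt0Pr => e e0.
(* With d^2 = e / 2, twice the energy of the error is at most [e]. *)
pose d := Num.sqrt (e / 2); have d0 : 0 < d by rewrite sqrtr_gt0 divr_gt0.
have [n nd] : exists n, (L2norm (fun xi => (fhat xi - fourier_integral (truncate n f) xi)%R) < d%:E)%E.
  have dn : nbhs (0%E : \bar R) [set x | (x < d%:E)%E].
    by apply: open_nbhs_nbhs; split; [exact: open_ereal_lt_ereal|rewrite /= lte_fin].
  by have [n _ /(_ n (leqnn n))] := hc _ dn; exists n.
have ti := cintegrable_truncate n mf ef.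
set D := fun xi => fhat xi - fourier_integral (truncate n f) xi.
have mD : cmeasurable D.
  by apply: (cmeasurableB mh); rewrite fourier_integralE; exact: cmeasurable_ctrans.
have eD : (energy D <= (e / 2)%:E)%E.
  rewrite leNgt; apply/negP => De; move: nd; rewrite -/D L2normE ltNge => /negP; apply.
  have := @poweR_half_ge R (energy D) 1%E d (ltW d0) (energy_ge0 _) lee01.
  rewrite poweR1r !mule1; apply.
  by rewrite sqr_sqrtr ?ltW// divr_gt0.
have eT : (energy (fourier_integral (truncate n f)) <= plancherel_const%:E * energy f)%E.
  rewrite fourier_integralE; apply: le_trans (plancherel_L1L2 sN1 ti _) _.
    by apply: le_lt_trans ef; exact: energy_truncate_le.
  by apply: lee_wpmul2l; [rewrite lee_fin ltW// plancherel_const_gt0|exact: energy_truncate_le].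
have -> : fhat = fun x => D x - (- fourier_integral (truncate n f) x).
  by apply/funext => x; rewrite /D opprK subrK.
have mN : cmeasurable (fun x => - fourier_integral (truncate n f) x).
  rewrite fourier_integralE; have [mFr mFi] := cmeasurable_ctrans (-1) ti; split.
    rewrite (_ : (fun _ => _) = fun x => - complex.Re (ctrans (-1) (truncate n f) x)).
      exact: measurableT_comp.
    by apply/funext => x; case: (ctrans _ _ x).
  rewrite (_ : (fun _ => _) = fun x => - complex.Im (ctrans (-1) (truncate n f) x)).
    exact: measurableT_comp.
  by apply/funext => x; case: (ctrans _ _ x).
apply: le_trans (energyB_le mD mN) _.
rewrite addeC; apply: leeD.
  rewrite EFinM -muleA; apply: lee_wpmul2l => //.
  by apply: le_trans eT; rewrite /energy; under eq_integral do rewrite cabsN.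
apply: (@le_trans _ _ (2%:E * (e / 2)%:E)%E); first exact: lee_wpmul2l.
by rewrite -EFinM lee_fin mulrCA mulfV// mulr1.
Qed.

End Plancherel.

(** * The two-dimensional Hausdorff measure on quadratic graphs *)

Section HausdorffMetric.
Context {R : realType}.
Local Notation H := (hausdorff2 R).
Local Open Scope ereal_scope.

Lemma le_ediam (A B : set (R3 R)) : A `<=` B -> ediam A <= ediam B.
Proof.
move=> AB; apply: ge_ereal_sup => _ [->|[[x y] [/= Ax Ay] <-]]; first exact: ediam_ge0.
by apply: ereal_sup_ubound; right; exists (x, y) => //; split => /=; exact: AB.
Qed.

Lemma le_hausdorff2_gauge (A B : set (R3 R)) : A `<=` B -> hausdorff2_gauge A <= hausdorff2_gauge B.
Proof.
move=> /le_ediam AB; rewrite /hausdorff2_gauge lee_wpmul2l//.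
  by rewrite lee_fin divr_ge0// pi_ge0.
by rewrite lee_pmul ?ediam_ge0.
Qed.

Lemma ediam_dist (A : set (R3 R)) x y : A x -> A y -> (eucl_dist x y)%:E <= ediam A.
Proof. by move=> Ax Ay; apply: ereal_sup_ubound; right; exists (x, y). Qed.

Lemma hausdorff2_pre_le (d e : R) A : (d <= e)%R -> hausdorff2_pre e A <= hausdorff2_pre d A.
Proof.
move=> de; apply: ereal_inf_le_tmp => _ [F [AF dF] <-]; exists F => //; split => // i.
by apply: le_trans (dF i) _; rewrite lee_fin.
Qed.

Lemma hausdorff2_pre_ub (d : R) A : (0 < d)%R -> hausdorff2_pre d A <= H A.
Proof. by move=> d0; apply: ereal_sup_ubound; exists d. Qed.

(** A covering set of diameter at most [e] < [d] cannot meet both [A] and [B], so the traces of a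
    cover on [A] and on [B] together cost no more than the cover. *)
Lemma hausdorff2_pre_separated (A B : set (R3 R)) (d e : R) : (e < d)%R ->
  (forall x y, A x -> B y -> (d <= eucl_dist x y)%R) ->
  hausdorff2_pre e A + hausdorff2_pre e B <= hausdorff2_pre e (A `|` B).
Proof.
move=> ed AB; apply: le_ereal_inf_tmp => _ [F [ABF dF] <-].
apply: (@le_trans _ _ (\sum_(i <oo) hausdorff2_gauge (F i `&` A) +
                       \sum_(i <oo) hausdorff2_gauge (F i `&` B))).
  by apply: leeD; apply: ereal_inf_lbound; [exists (fun i => F i `&` A)|exists (fun i => F i `&` B)];
    rewrite //; split => [x|i]; (try by apply: le_trans (dF i); apply: le_ediam => ? []);
    move=> Ax; have [i _ Fx] := ABF x ltac:(by [left|right]); exists i.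
rewrite -nneseriesD; [|by move=> i _ _; exact: hausdorff2_gauge_ge0..].
apply: lee_nneseries => [i _|i _].
  by rewrite adde_ge0// hausdorff2_gauge_ge0.
have [[x [Fx Ax]]|nA] := pselect (exists x, F i x /\ A x); last first.
  rewrite (_ : F i `&` A = set0) ?hausdorff2_gauge0 ?add0e.
    by apply: le_hausdorff2_gauge => ? [].
  by apply/seteqP; split => // x [Fx Ax]; apply: nA; exists x.
rewrite (_ : F i `&` B = set0) ?hausdorff2_gauge0 ?adde0.
  by apply: le_hausdorff2_gauge => ? [].
apply/seteqP; split => // y [Fy By]; have := AB _ _ Ax By.
apply/negP; rewrite -ltNge; apply: le_lt_trans ed.
by rewrite -lee_fin; apply: le_trans (dF i); exact: ediam_dist.
Qed.

Lemma hausdorff2_separated (A B : set (R3 R)) (d : R) : (0 < d)%R ->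
  (forall x y, A x -> B y -> (d <= eucl_dist x y)%R) -> H A + H B <= H (A `|` B).
Proof.
move=> d0 AB; set X := H (A `|` B).
have [->|Xy] := eqVneq X +oo; first exact: leey.
have key (d1 d2 : R) : (0 < d1)%R -> (0 < d2)%R -> hausdorff2_pre d1 A + hausdorff2_pre d2 B <= X.
  move=> d10 d20; pose e : R := Num.min (Num.min d1 d2) (d / 2)%R.
  have e0 : (0 < e)%R by rewrite !lt_min d10 d20/= divr_gt0.
  have ed : (e < d)%R by rewrite !gt_min; apply/orP; right; lra.
  apply: le_trans (hausdorff2_pre_ub (A `|` B) e0).
  apply: le_trans (hausdorff2_pre_separated ed AB).
  by apply: leeD; apply: hausdorff2_pre_le; rewrite !ge_min lexx ?orbT.
have fX : X \is a fin_num by rewrite ge0_fin_numE ?ltey// hausdorff2_ge0.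
have B2 (d2 : R) : (0 < d2)%R -> H A <= X - hausdorff2_pre d2 B.
  move=> d20; apply: ge_ereal_sup => _ [d1 /= d10 <-].
  have := key _ _ d10 d20; rewrite leeBrDr// ge0_fin_numE ?hausdorff2_pre_ge0//.
  apply: le_lt_trans (_ : _ <= X) _; last by rewrite ltey.
  by apply: le_trans (key _ _ d20 d20); rewrite leeDr// hausdorff2_pre_ge0.
have fA : H A \is a fin_num.
  rewrite ge0_fin_numE ?hausdorff2_ge0//; apply: le_lt_trans (_ : _ <= X) _; last by rewrite ltey.
  exact: le_outer_measure (hausdorff2_outer R) _ _ (@subsetUl _ A B).
rewrite addeC -leeBrDr//; apply: ge_ereal_sup => _ [d2 /= d20 <-].
rewrite leeBrDr// addeC -leeBrDr//; first exact: B2.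
rewrite ge0_fin_numE ?hausdorff2_pre_ge0//; apply: le_lt_trans (_ : _ <= X) _; last by rewrite ltey.
by apply: le_trans (key _ _ d20 d20); rewrite leeDr// hausdorff2_pre_ge0.
Qed.

Section HalfSpace.
Variable g : R3 R -> R.
Hypothesis g_lip : forall x y, (`|g x - g y| <= eucl_dist x y)%R.
Variable E : set (R3 R).

Let t (k : nat) : R := k.+1%:R^-1.

Let t_gt0 k : (0 < t k)%R. Proof. by rewrite invr_gt0. Qed.

Let t_lt k l : (k < l)%N -> (t l < t k)%R.
Proof. by move=> kl; rewrite ltf_pV2 ?posrE// ltr_nat. Qed.

Let t_le k l : (k <= l)%N -> (t l <= t k)%R.
Proof. by move=> kl; rewrite lef_pV2 ?posrE// ler_nat. Qed.

(** Layers accumulating at the set g <= 0. Distinct layers of the same parity are a positive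
    distance apart, because [g] is Lipschitz; this makes [H] superadditive on them, and the sum over
    all layers is at most twice [H E]. *)
Let P (k : nat) : set (R3 R) := E `&` [set x | (t k.+1 < g x <= t k)%R].

Let sep (A B : set (R3 R)) a b : (b < a)%R -> (forall x, A x -> (a <= g x)%R) ->
  (forall y, B y -> (g y <= b)%R) -> H A + H B <= H (A `|` B).
Proof.
move=> ba Aa Bb; apply: (@hausdorff2_separated _ _ (a - b)); first by rewrite subr_gt0.
move=> x y /Aa ax /Bb yb; apply: le_trans (g_lip x y); apply: le_trans (ler_norm _); lra.
Qed.

Let sum_layers e n : (e <= 1)%N -> \sum_(j < n) H (P (2 * j + e)) <= H E.
Proof.
move=> e1; apply: (@le_trans _ _ (H (\bigcup_(j in [set j | (j < n)%N]) P (2 * j + e)))); last first.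
  by apply: (le_outer_measure (hausdorff2_outer R)) => x [j _ []].
elim: n => [|n IH]; first by rewrite big_ord0 hausdorff2_ge0.
rewrite big_ord_recr/=; apply: le_trans (leeD IH (lexx _)) _.
have -> : \bigcup_(j in [set j | (j < n.+1)%N]) P (2 * j + e) =
    \bigcup_(j in [set j | (j < n)%N]) P (2 * j + e) `|` P (2 * n + e).
  apply/seteqP; split => [x [j /= jn Px]|x [[j /= jn Px]|Px]].
  - by move: jn; rewrite ltnS leq_eqVlt => /predU1P[jE|jn]; [right; rewrite -jE|left; exists j].
  - by exists j => //=; exact: ltnW.
  - by exists n => /=.
case: n {IH} => [|n].
  rewrite (_ : \bigcup_(j in _) _ = set0) ?hausdorff20 ?add0e ?set0U//.
  by apply/seteqP; split => // x [].
apply: (@sep _ _ (t (2 * n + e).+1) (t (2 * n.+1 + e))).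
- by apply: t_lt; lia.
- move=> x [j /= jn [_ /andP[/ltW + _]]]; apply: le_trans; apply: t_le; lia.
- by move=> y [_ /andP[]].
Qed.

Let summable_layers : H E < +oo -> \sum_(j <oo) H (P j) < +oo.
Proof.
move=> Ey; apply: (@le_lt_trans _ _ (H E + H E)); last by rewrite lte_add_pinfty.
apply: lime_le; first by apply: is_cvg_nneseries => n _ _; exact: hausdorff2_ge0.
near=> n; apply: (@le_trans _ _ (\sum_(0 <= j < 2 * n) H (P j))).
  apply: lee_sum_nneg_natr => //; last by lia.
  by move=> k _ _; exact: hausdorff2_ge0.
apply: (@le_trans _ _ (\sum_(j < n) H (P (2 * j + 0)) + \sum_(j < n) H (P (2 * j + 1)))); last first.
  by apply: leeD; apply: sum_layers.
rewrite -big_split/= big_mkord.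
elim: (n) => [|m IH]; first by rewrite !big_ord0.
have -> : (2 * m.+1 = (2 * m).+2)%N by lia.
rewrite big_ord_recr big_ord_recr/= [leRHS]big_ord_recr/= -addeA addn0 addn1.
by apply: leeD.
Unshelve. all: by end_near. Qed.

(** The parts of [E] where g <= 0 and where g > [t k] are separated; what lies between is covered by
    the layers of index at least [k], whose total measure is the tail of a convergent series. *)
Lemma caratheodory_le0_finite : H E < +oo ->
  H (E `&` [set x | (g x <= 0)%R]) + H (E `&` ~` [set x | (g x <= 0)%R]) <= H E.
Proof.
move=> Ey; set A := [set x | (g x <= 0)%R].
apply/lee_addgt0Pr => e e0.
have tail := nneseries_tail_cvg (summable_layers Ey) (fun n _ => hausdorff2_ge0 (P n)).
have [k tk] : exists k, \sum_(k <= j <oo) H (P j) < e%:E.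
  have dn : nbhs (0 : \bar R) [set x | x < e%:E].
    by apply: open_nbhs_nbhs; split; [exact: open_ereal_lt_ereal|rewrite /= lte_fin].
  by have [n _ /(_ n (leqnn n))] := tail _ dn; exists n.
pose Ek := E `&` [set x | (t k < g x)%R].
have s1 : H (E `&` A) + H Ek <= H E.
  rewrite addeC; apply: le_trans (_ : H (Ek `|` (E `&` A)) <= _).
    by apply: (@sep _ _ (t k) 0%R) => // [x [_ /ltW]|y []].
  by apply: (le_outer_measure (hausdorff2_outer R)) => x [[]|[]].
have s2 : H (E `&` ~` A) <= H Ek + \sum_(k <= j <oo) H (P j).
  have -> : \sum_(k <= j <oo) H (P j) = \sum_(j <oo) H (P (k + j)%N).
    by rewrite -[in LHS](add0n k) -nneseries_addn//; [under eq_eseriesr do rewrite addnC|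
      move=> i; exact: hausdorff2_ge0].
  apply: le_trans (leeD (lexx _) (hausdorff2_sigma_subadditive _)).
  apply: le_trans (outer_measureU2 (hausdorff2_outer R) _ _).
  apply: (le_outer_measure (hausdorff2_outer R)) => x [Ex /= /negP]; rewrite -ltNge => gx.
  have [gk|gk] := ltP (t k) (g x); first by left.
  right; suff [j jP] : exists j, P (k + j)%N x by exists j.
  have ex : exists j, (t (k + j).+1 < g x)%R.
    exists (Num.truncn (g x)^-1); rewrite /t invf_plt ?posrE//.
    apply: lt_le_trans (truncnS_gt _) _; rewrite ler_nat; move: (Num.truncn _) => n; lia.
  (* The least such index places [x] between two consecutive levels; at index 0 the upper level is
     the assumption [gk]. *)
  case: (ex_minnP ex) => j tj jmin; exists j; split => //=; rewrite tj/=.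
  case: j tj jmin => [|j] tj jmin; first by rewrite addn0.
  by rewrite addnS leNgt; apply/negP => /jmin; rewrite ltnn.
apply: le_trans (leeD (lexx _) s2) _; rewrite addeA; apply: leeD => //; exact: ltW.
Qed.

End HalfSpace.

Lemma caratheodory_le0 (g : R3 R -> R) : (forall x y, (`|g x - g y| <= eucl_dist x y)%R) ->
  (hausdorff2_outer R).-caratheodory [set x | (g x <= 0)%R].
Proof.
move=> gl; apply: le_caratheodory_measurable => E.
have [Ey|Ey] := eqVneq (H E) +oo; first by rewrite [leRHS]Ey leey.
by apply: caratheodory_le0_finite => //; rewrite ltey.
Qed.

Lemma measurable_lipschitz_H2 (g : R3 R -> R) : (forall x y, (`|g x - g y| <= eucl_dist x y)%R) ->
  measurable_fun [set: H2space R] (g : H2space R -> measurableTypeR R).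
Proof.
move=> gl; apply: (measurability _ (RGenOInfty.measurableE R)) => _ [_ [a ->] <-].
rewrite setTI (_ : _ @^-1` _ = ~` [set x | (g x - a <= 0)%R]); last first.
  apply/seteqP; split => x /=; rewrite in_itv/= andbT subr_le0 ltNge; first by move/negP.
  by move/negP.
apply: measurableC; apply: caratheodory_le0 => x y.
by rewrite (_ : g x - a - (g y - a) = g x - g y)%R; [exact: gl|ring].
Qed.

(** The coordinates are 1-Lipschitz, hence Caratheodory measurable, so the identity from [H2space]
    to [borelR3] is measurable. *)
Lemma measurable_H2_borel (f : R3 R -> R) : measurable_fun [set: borelR3 R] f ->
  measurable_fun [set: H2space R] (f : H2space R -> measurableTypeR R).
Proof.
move=> mf.
have idm : measurable_fun [set: H2space R] (id : H2space R -> borelR3 R).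
  rewrite (_ : id = fun x : R3 R => ((x.1.1, x.1.2), x.2)); last by apply/funext => -[[]].
  have D (x y : (R * R * R)%type) : [/\ (`|x.1.1 - y.1.1| <= eucl_dist x y)%R, (`|x.1.2 - y.1.2| <= eucl_dist x y)%R &
      (`|x.2 - y.2| <= eucl_dist x y)%R] by exact: (enorm_coord (x - y)%R).
  apply: measurable_fun_pair.
    apply: measurable_fun_pair; apply: measurable_lipschitz_H2 => x y; by case: (D x y).
  by apply: measurable_lipschitz_H2 => x y; case: (D x y).
exact: (measurableT_comp mf idm).
Qed.

Lemma measurable_H2_set (A : set (R3 R)) : measurable (A : set (borelR3 R)) ->
  measurable (A : set (H2space R)).
Proof.
move=> mA; have mI : measurable_fun [set: borelR3 R] (\1_A : borelR3 R -> R) by exact: measurable_indic.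
have AE : (A : set (H2space R)) = setT `&` ((\1_A : H2space R -> measurableTypeR R) @^-1` [set 1%R]).
  apply/seteqP; split => x; first by move=> Ax; split => //=; rewrite indicE mem_set.
  move=> [_ /=]; rewrite indicE; case: (asboolP (A x)) => // nA.
  by rewrite memNset// => /eqP; rewrite eq_sym oner_eq0.
by rewrite AE; exact: (measurable_H2_borel mI).
Qed.

End HausdorffMetric.

(** * Comparison of H^2 with areas of rectangles *)

Section GraphMeasure.
Context {R : realType}.
Local Notation H := (hausdorff2 R).
Local Open Scope ereal_scope.

Lemma ediam_le (A : set (R3 R)) (d : R) : (0 <= d)%R ->
  (forall x y, A x -> A y -> (eucl_dist x y <= d)%R) -> ediam A <= d%:E.
Proof.
move=> d0 Ad; apply: ge_ereal_sup => _ [->|[[x y] [/= Ax Ay] <-]]; rewrite lee_fin//.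
exact: Ad.
Qed.

Lemma hausdorff2_pre_finite (X : set (R3 R)) (n : nat) (F : nat -> set (R3 R)) (d : R) :
  (0 <= d)%R -> X `<=` \bigcup_(i in [set i | (i < n)%N]) F i ->
  (forall i x y, F i x -> F i y -> (eucl_dist x y <= d)%R) ->
  hausdorff2_pre d X <= (n%:R * (d ^+ 2))%:E.
Proof.
move=> d0 XF Fd; pose G i := if (i < n)%N then F i else set0.
have Gd i : ediam (G i) <= d%:E.
  rewrite /G; case: ifPn => _; last by rewrite ediam0 lee_fin.
  by apply: ediam_le => // x y; exact: Fd.
apply: (@le_trans _ _ (\sum_(i <oo) hausdorff2_gauge (G i))).
  apply: ereal_inf_lbound; exists G => //; split => // x /XF[i /= ni Fx].
  by exists i => //; rewrite /G ni.
have -> : \sum_(i <oo) hausdorff2_gauge (G i) = \sum_(0 <= i < n) hausdorff2_gauge (G i).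
  rewrite (nneseries_split 0 n) ?add0n; last by move=> k _; exact: hausdorff2_gauge_ge0.
  rewrite eseries0 ?adde0// => i ni _; rewrite /G ltnNge ni/=; exact: hausdorff2_gauge0.
apply: (@le_trans _ _ (\sum_(0 <= i < n) (d ^+ 2)%:E)).
  apply: lee_sum => i _; rewrite /hausdorff2_gauge.
  apply: (@le_trans _ _ (1%:E * (d%:E * d%:E))); last by rewrite mul1e -EFinM expr2.
  apply: lee_pmul.
  - by rewrite lee_fin divr_ge0// pi_ge0.
  - by rewrite mule_ge0 ?ediam_ge0.
  - by rewrite lee_fin ler_pdivrMr// mul1r; have := @pihalf_lt2 R; lra.
  - by apply: lee_pmul; rewrite ?ediam_ge0.
by rewrite sumEFin big_const_nat subn0 iter_addr_0 mulr_natl.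
Qed.

(** The parameter rectangle is cut into squares of side [e], above which [X] has diameter at most 2
    L e. As e is at most both sides, 2 l_i / e squares are enough in each direction, whence 16 = 2 *
    2 * 2^2. *)
Lemma hausdorff2_le_rectangle (X : set (R3 R)) (sg ta : R3 R -> R) (s0 t0 l1 l2 L : R) :
  (0 < l1)%R -> (0 < l2)%R -> (0 < L)%R ->
  (forall x, X x -> (s0 <= sg x <= s0 + l1)%R /\ (t0 <= ta x <= t0 + l2)%R) ->
  (forall x y, X x -> X y -> (eucl_dist x y <= L * (`|sg x - sg y| + `|ta x - ta y|))%R) ->
  H X <= (16 * L ^+ 2 * l1 * l2)%:E.
Proof.
move=> l10 l20 L0 Xr XL; apply: ge_ereal_sup => _ [d /= d0 <-].
pose e : R := Num.min (Num.min l1 l2) (d / (2 * L))%R.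
have e0 : (0 < e)%R by rewrite !lt_min l10 l20 divr_gt0// mulr_gt0.
have el1 : (e <= l1)%R by rewrite !ge_min lexx.
have el2 : (e <= l2)%R by rewrite !ge_min lexx orbT.
have eL : (2 * L * e <= d)%R.
  rewrite mulrC -ler_pdivlMr ?mulr_gt0//; by rewrite /e !ge_min lexx orbT.
apply: le_trans (hausdorff2_pre_le X eL) _.
pose N (l : R) := (Num.truncn (l / e)).+1.
have Nlt l v v0 : (v0 <= v <= v0 + l)%R -> (Num.truncn ((v - v0) / e) < N l)%N /\
    (0 <= v - v0 - (Num.truncn ((v - v0) / e))%:R * e <= e)%R.
  move=> /andP[v1 v2].
  have q0 : (0 <= (v - v0) / e)%R by rewrite divr_ge0 ?subr_ge0// ltW.
  have /andP[q1 q2] := truncn_itv q0; split.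
    rewrite /N ltnS; apply: le_truncn.
    by rewrite ler_pM2r ?invr_gt0//; lra.
  move: q1 q2; rewrite ler_pdivlMr// ltr_pdivrMr// -natr1 => q1 q2.
  by apply/andP; split; lra.
pose n1 := N l1; pose n2 := N l2.
pose cell (i j : nat) := X `&` [set x | Num.truncn ((sg x - s0) / e) = i /\ Num.truncn ((ta x - t0) / e) = j].
have e2L : (0 <= 2 * L * e)%R by rewrite !mulr_ge0// ltW.
apply: le_trans (@hausdorff2_pre_finite X (n1 * n2) (fun k => cell (k %/ n2)%N (k %% n2)%N) _ e2L _ _) _.
- move=> x Xx; have [/Nlt[i1 _] /Nlt[j1 _]] := Xr _ Xx.
  exists (Num.truncn ((sg x - s0) / e) * n2 + Num.truncn ((ta x - t0) / e))%N => /=.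
    apply: (@leq_trans (Num.truncn ((sg x - s0) / e) * n2 + n2)); first by rewrite ltn_add2l.
    by rewrite -mulSnr leq_mul2r i1 orbT.
  by split => //=; rewrite divnMDl// divn_small// addn0 modnMDl modn_small.
- move=> k x y [Xx [ix jx]] [Xy [iy jy]]; apply: le_trans (XL _ _ Xx Xy) _.
  have [/Nlt[_ sx] /Nlt[_ tx]] := Xr _ Xx; have [/Nlt[_ sy] /Nlt[_ ty]] := Xr _ Xy.
  move: sx tx sy ty; rewrite ix jx iy jy.
  move: ((k %/ n2)%N%:R * e)%R ((k %% n2)%N%:R * e)%R => a b /andP[? ?] /andP[? ?] /andP[? ?] /andP[? ?].
  rewrite (_ : 2 * L * e = L * (e + e))%R; last by ring.
  apply: ler_wpM2l; first exact: ltW.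
  apply: lerD; rewrite ler_norml; apply/andP; split; lra.
- rewrite lee_fin.
  have Nle l : (e <= l)%R -> ((N l)%:R * e <= 2 * l)%R.
    move=> el; have q0 : (0 <= l / e)%R by rewrite divr_ge0 ?(ltW e0)// (le_trans (ltW e0)).
    have /andP[q1 _] := truncn_itv q0; move: q1; rewrite ler_pdivlMr// /N -natr1; lra.
  have := Nle _ el1; have := Nle _ el2; rewrite -/n1 -/n2 natrM.
  move: (n1%:R : R) (n2%:R : R) (ler0n R n1) (ler0n R n2) => a b a0 b0 be ae.
  have -> : (a * b * (2 * L * e) ^+ 2 = 4 * L ^+ 2 * ((a * e) * (b * e)))%R by ring.
  have -> : (16 * L ^+ 2 * l1 * l2 = 4 * L ^+ 2 * ((2 * l1) * (2 * l2)))%R by ring.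
  apply: ler_wpM2l; first by rewrite mulr_ge0// sqr_ge0.
  by apply: ler_pM => //; rewrite mulr_ge0// ltW.
Qed.

Lemma lebesgue_itv_length (a l : R) : (0 <= l)%R ->
  @lebesgue_measure R `[a, (a + l)%R]%classic = l%:E.
Proof.
move=> l0; rewrite lebesgue_measure_itv/= lte_fin ltrDl; case: ifPn => [_|].
  by rewrite -EFinD; congr EFin; ring.
by rewrite -leNgt => l0'; congr EFin; apply/eqP; rewrite eq_le l0 l0'.
Qed.

(** The shadow of a covering set of diameter d lies in a square of side 2 d, and pi d^2 / 4 is at
    least one eighth of its area 4 d^2. The shadows cover a rectangle. *)
Lemma hausdorff2_ge_rectangle (X : set (R3 R)) (a1 a2 l1 l2 : R) : (0 <= l1)%R -> (0 <= l2)%R ->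
  (forall u : R * R, (a1 <= u.1 <= a1 + l1)%R -> (a2 <= u.2 <= a2 + l2)%R -> exists z, X (u, z)) ->
  ((l1 * l2) / 8)%:E <= H X.
Proof.
move=> l10 l20 DX; apply: le_trans (hausdorff2_pre_ub X ltr01).
apply: le_ereal_inf_tmp => _ [F [XF dF] <-].
pose d i : R := fine (ediam (F i)).
have dE i : ediam (F i) = (d i)%:E.
  by rewrite /d fineK// ge0_fin_numE ?ediam_ge0// (le_lt_trans (dF i))// ltry.
have d0 i : (0 <= d i)%R by rewrite -lee_fin -dE ediam_ge0.
have [p pP] : {p : nat -> R3 R & forall i, (exists x, F i x) -> F i (p i)}.
  apply: (@choice _ _ (fun i x => (exists x, F i x) -> F i x)) => i.
  have [[x Fx]|nF] := pselect (exists x, F i x); first by exists x.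
  by exists 0%R => /nF.
pose Sq i : set (measurableTypeR R * measurableTypeR R) :=
  `[((p i).1.1 - d i)%R, ((p i).1.1 + d i)%R]%classic `*`
  `[((p i).1.2 - d i)%R, ((p i).1.2 + d i)%R]%classic.
have mSq i : measurable (Sq i) by exact: measurableX.
have lSq i : lebesgue2 R (Sq i) = ((2 * d i) ^+ 2)%:E.
  rewrite lebesgue2E//; have E (q : R) : (q + d i = q - d i + 2 * d i)%R by ring.
  by rewrite !E !lebesgue_itv_length ?mulr_ge0// -EFinM expr2.
pose D : set (measurableTypeR R * measurableTypeR R) := `[a1, (a1 + l1)%R]%classic `*`
  `[a2, (a2 + l2)%R]%classic.
have mD : measurable D by exact: measurableX.
have lD : lebesgue2 R D = (l1 * l2)%:E.
  by rewrite lebesgue2E// !lebesgue_itv_length.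
have DS : D `<=` \bigcup_i Sq i.
  move=> u [/=]; rewrite !in_itv/= => u1 u2; have [z Xz] := DX u u1 u2.
  have [i _ Fi] := XF _ Xz; exists i => //.
  have Fp : F i (p i) by apply: pP; exists (u, z).
  have : (eucl_dist (u, z) (p i) <= d i)%R by rewrite -lee_fin -dE; exact: ediam_dist.
  have [c1 c2 _] := enorm_coord ((u, z) - p i : R * R * R)%R => le.
  have := le_trans c1 le; have := le_trans c2 le; rewrite /= !ler_norml => /andP[? ?] /andP[? ?].
  by split; rewrite /= in_itv/=; apply/andP; split; lra.
have := measure_sigma_subadditive (lebesgue2 R) mSq mD DS; rewrite lD.
move=> le; apply: (@le_trans _ _ (8^-1%:E * \sum_(i <oo) lebesgue2 R (Sq i))).
  by rewrite mulrC EFinM; apply: lee_wpmul2l.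
rewrite -nneseriesZl//.
apply: lee_nneseries => i _; first by rewrite mule_ge0// measure_ge0.
rewrite lSq /hausdorff2_gauge dE -!EFinM lee_fin.
have := @pihalf_ge1 R; have := sqr_ge0 (d i); move: (d i) => v; rewrite expr2 => v0 p1.
have -> : (pi / 4 * (v * v) = pi / 2 * (v * v) / 2)%R by field.
have : (1 * (v * v) <= pi / 2 * (v * v))%R by apply: ler_wpM2r.
lra.
Qed.

End GraphMeasure.

(** * Slabs cutting a quadratic graph *)

Section GraphSlabs.
Context {R : realType}.
Local Notation H := (hausdorff2 R).

Lemma window_dist (a b y d : R) : y <= a <= y + d -> y <= b <= y + d -> `|a - b| <= d.
Proof. by move=> /andP[? ?] /andP[? ?]; rewrite ler_norml; apply/andP; split; lra. Qed.

Lemma dist_window (a b d : R) : `|a - b| <= d -> b - d <= a <= b - d + 2 * d.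
Proof. by rewrite ler_norml => /andP[? ?]; apply/andP; split; lra. Qed.

Lemma window_shiftD (x t lo w : R) : lo <= x - t <= lo + w -> t + lo <= x <= t + lo + w.
Proof. by move=> /andP[? ?]; apply/andP; split; lra. Qed.

Lemma window_shiftB (x t lo w : R) : lo <= t - x <= lo + w -> t - lo - w <= x <= t - lo - w + w.
Proof. by move=> /andP[? ?]; apply/andP; split; lra. Qed.

Lemma absorb_quarter (u v d e1 e2 : R) : 0 <= u -> 0 <= v -> u <= d + e1 -> v <= d + e2 ->
  e1 <= 4^-1 * (u + v) -> e2 <= 4^-1 * (u + v) -> u <= 4 * d /\ v <= 4 * d.
Proof. by move=> *; split; lra. Qed.

Lemma double_window (p th m : R) : `|p| <= m -> 0 <= th <= 1 -> `|2 * p - th| <= 2 * (m + 1).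
Proof. by rewrite !ler_norml => /andP[? ?] /andP[? ?]; apply/andP; split; lra. Qed.

(** The nonnegative square roots of an interval of length 2 be^2 spread over at most 2 be, also when
    the interval reaches below 0, which is why [lo] contains a maximum with 0. *)
Lemma sqr_window (E be s lo : R) : lo = Num.sqrt (Num.max 0 (E - be ^+ 2)) ->
  0 <= be -> 0 <= s -> `|s ^+ 2 - E| <= be ^+ 2 -> lo <= s <= lo + 2 * be.
Proof.
move=> loE b0 s0; rewrite ler_norml => /andP[s1 s2].
have lo0 : 0 <= lo by rewrite loE sqrtr_ge0.
have lo2 : lo ^+ 2 = Num.max 0 (E - be ^+ 2) by rewrite loE sqr_sqrtr// le_max lexx.
apply/andP; split.
  rewrite -ler_sqr ?nnegrE// lo2 ge_max sqr_ge0/=; lra.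
rewrite -ler_sqr ?nnegrE ?addr_ge0 ?mulr_ge0// sqrrD lo2.
have m1 : E - be ^+ 2 <= Num.max 0 (E - be ^+ 2) by rewrite le_max lexx orbT.
have := mulr_ge0 lo0 b0; have := sqr_ge0 be; rewrite exprMn; nra.
Qed.

(* Where the slab a t + const is tangent to the graph to first order, the
   second order term A (t - t0)^2 confines t to two windows of length O(1/q). *)
Lemma quadratic_slab (X : set (R3 R)) (p1 p2 : R3 R -> R) (k1 k2 m M L a b y2 y3 q : R) :
  0 < m -> m <= `|k1| -> 0 < k1 * k2 -> 0 <= M -> 1 <= L -> 1 <= q -> `|b| <= 1 ->
  (forall x, X x -> x.2 = (k1 * p1 x ^+ 2 + k2 * p2 x ^+ 2) / 2 /\ `|p2 x| <= M) ->
  (forall x y, X x -> X y -> eucl_dist x y <= L * (`|p1 x - p1 y| + `|p2 x - p2 y|)) ->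
  (forall x, X x -> y2 <= p2 x - b * p1 x <= y2 + (q ^+ 2)^-1 /\
                    y3 <= x.2 - a * p1 x <= y3 + (q ^+ 2)^-1) ->
  (H X <= (256 * L ^+ 2 * Num.sqrt (2 * (1 + `|k2| * (M + 1)) / m) / q ^+ 3)%:E)%E.
Proof.
move=> m0 mk k12 M0 L1 q1 b1 XQ XL Xs.
have q0 : 0 < q by lra.
have L0 : 0 < L by lra.
have k10 : k1 != 0 by rewrite -normr_gt0; lra.
pose de := (q ^+ 2)^-1; have de0 : 0 < de by rewrite invr_gt0 exprn_gt0.
have de1 : de <= 1 by rewrite invf_le1 ?exprn_gt0// exprn_ege1.
pose A := (k1 + k2 * b ^+ 2) / 2.
have k1E : k1 = 2 * A - k2 * b ^+ 2 by rewrite /A; field.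
(* Here the sign of k1 k2 matters: k2 b^2 cannot cancel k1, so the curvature 2 A in the direction of
   slope [b] is at least [m] in modulus. *)
have Am : m <= 2 * `|A|.
  have -> : 2 * `|A| = `|k1 + k2 * b ^+ 2|.
    by rewrite /A normrM normfV (ger0_norm (_ : 0 <= 2))//; field.
  apply: le_trans mk _.
  have [k1p|k1n] := ltP 0 k1.
    have k2p : 0 < k2 by move: k12; rewrite pmulr_rgt0.
    have n2 : 0 <= k2 * b ^+ 2 by rewrite mulr_ge0 ?sqr_ge0// ltW.
    by rewrite !ger0_norm; lra.
  have k1n' : k1 < 0 by rewrite lt_neqAle k10.
  have k2n : k2 < 0 by move: k12; rewrite nmulr_rgt0.
  have n2 : k2 * b ^+ 2 <= 0 by rewrite mulr_le0_ge0 ?sqr_ge0// ltW.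
  by rewrite !ler0_norm; lra.
have A0 : A != 0 by rewrite -normr_gt0; lra.
pose B := k2 * b * y2 - a; pose Cc := k2 * y2 ^+ 2 / 2.
(* Completion of the square in A t^2 + B t + Cc - y3. *)
pose t0 := - B / (2 * A); pose E := B ^+ 2 / (4 * A ^+ 2) - (Cc - y3) / A.
pose D1 := 1 + `|k2| * (M + 1).
have D10 : 1 <= D1 by rewrite lerDl mulr_ge0//; lra.
pose be0 := Num.sqrt (2 * D1 / m); pose be := be0 / q.
have be00 : 0 < be0 by rewrite sqrtr_gt0 divr_gt0// mulr_gt0//; lra.
have bep : 0 < be by rewrite divr_gt0.
have be2 : be ^+ 2 = 2 * D1 / m * de.
  by rewrite /be exprMn exprVn sqr_sqrtr// divr_ge0 ?(ltW m0)// mulr_ge0//; lra.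
have win x : X x -> `|(p1 x - t0) ^+ 2 - E| <= be ^+ 2.
  move=> Xx; have [x2 p2M] := XQ x Xx; have [/andP[u1 u2] /andP[v1 v2]] := Xs x Xx.
  (* The position inside the first slab: substituting p2 = b p1 + y2 + th makes x.2 - a p1 a
     quadratic polynomial in p1 up to O(th). *)
  pose th := p2 x - b * p1 x - y2.
  have th0 : 0 <= th by rewrite /th subr_ge0.
  have th1 : th <= de by rewrite /th lerBlDl.
  have eqA : A * ((p1 x - t0) ^+ 2 - E) = (x.2 - a * p1 x - y3) - k2 * (th * (2 * p2 x - th)) / 2.
    by rewrite x2 k1E /E /t0 /B /Cc /th; field.
  have bnd : `|A| * `|(p1 x - t0) ^+ 2 - E| <= D1 * de.
    rewrite -normrM eqA; apply: le_trans (ler_normB _ _) _.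
    rewrite (_ : D1 * de = de + `|k2| * (M + 1) * de); last by rewrite /D1; ring.
    apply: lerD.
      by rewrite ger0_norm ?subr_ge0// lerBlDl.
    rewrite !normrM normfV (ger0_norm (_ : 0 <= 2))// (ger0_norm th0).
    have c1 : `|2 * p2 x - th| <= 2 * (M + 1).
      by apply: double_window => //; rewrite th0 (le_trans th1).
    rewrite -mulrA -[leRHS]mulrA ler_wpM2l//.
    apply: (@le_trans _ _ (de * (2 * (M + 1)) / 2)).
      by rewrite ler_pM2r ?invr_gt0// ler_pM.
    by lra.
  rewrite be2; set w := `|(p1 x - t0) ^+ 2 - E| in bnd *.
  have w0 : 0 <= w by exact: normr_ge0.
  have : m * w <= 2 * D1 * de.
    apply: (@le_trans _ _ (2 * `|A| * w)); first by rewrite ler_wpM2r.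
    by rewrite -mulrA -[leRHS]mulrA ler_pM2l.
  by move=> mw; rewrite mulrAC ler_pdivlMr// mulrC.
pose lo := Num.sqrt (Num.max 0 (E - be ^+ 2)).
pose Xp := X `&` [set x | t0 <= p1 x]; pose Xm := X `&` [set x | p1 x <= t0].
have piece (Z : set (R3 R)) s0 : Z `<=` X -> (forall x, Z x -> s0 <= p1 x <= s0 + 2 * be) ->
    (H Z <= (128 * L ^+ 2 * be0 / q ^+ 3)%:E)%E.
  move=> ZX Zs.
  have -> : 128 * L ^+ 2 * be0 / q ^+ 3 = 16 * (2 * L) ^+ 2 * (2 * be) * de.
    by rewrite /be /de; field; rewrite gt_eqF.
  apply: (@hausdorff2_le_rectangle _ _ p1 (fun x => p2 x - b * p1 x) s0 y2) => //; [by rewrite mulr_gt0|by rewrite mulr_gt0|..].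
  - by move=> x Zx; split; [exact: Zs|case: (Xs x (ZX x Zx))].
  - move=> x y /ZX Xx /ZX Xy; apply: le_trans (XL _ _ Xx Xy) _.
    rewrite -mulrA [leRHS]mulrCA; apply: ler_wpM2l; first exact: ltW.
    set u := p1 x - p1 y; set v := p2 x - p2 y.
    have -> : p2 x - b * p1 x - (p2 y - b * p1 y) = v - b * u by rewrite /u /v; ring.
    have tri : `|v| <= `|v - b * u| + `|b * u|.
      by rewrite -{1}[v](subrK (b * u)) ler_normD.
    have bu : `|b * u| <= `|u| by rewrite normrM -[leRHS]mul1r ler_wpM2r.
    by have := normr_ge0 (v - b * u); lra.
have Hp : (H Xp <= (128 * L ^+ 2 * be0 / q ^+ 3)%:E)%E.
  apply: (piece _ (t0 + lo)) => [x []//|x [Xx /= tx]].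
  have s0 : 0 <= p1 x - t0 by rewrite subr_ge0.
  exact: window_shiftD (sqr_window erefl (ltW bep) s0 (win x Xx)).
have Hm : (H Xm <= (128 * L ^+ 2 * be0 / q ^+ 3)%:E)%E.
  apply: (piece _ (t0 - lo - 2 * be)) => [x []//|x [Xx /= tx]].
  have s0 : 0 <= t0 - p1 x by rewrite subr_ge0.
  have := win x Xx; rewrite -sqrrN opprB => wx.
  exact: window_shiftB (sqr_window erefl (ltW bep) s0 wx).
apply: (@le_trans _ _ (H Xp + H Xm)%E).
  apply: le_trans (outer_measureU2 (hausdorff2_outer R) _ _).
  apply: (le_outer_measure (hausdorff2_outer R)) => x Xx.
  by have [tx|/ltW tx] := leP t0 (p1 x); [left; split|right; split].
apply: le_trans (leeD Hp Hm) _; rewrite -EFinD lee_fin /be0 -/D1.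
by lra.
Qed.

(** The height is [D]-Lipschitz in the horizontal coordinates and enters the slabs with slopes b
    such that |b| D <= 1/4, so it is absorbed and both horizontal coordinates are confined to
    O(q^-2). The resulting q^-4 is weakened to q^-3, the rate of the tangential case. *)
Lemma transversal_slab (X : set (R3 R)) (L D b1 b2 y1 y2 q : R) :
  1 <= L -> 1 <= q -> 0 <= D -> `|b1| * D <= 4^-1 -> `|b2| * D <= 4^-1 ->
  (forall x y, X x -> X y -> `|x.2 - y.2| <= D * (`|x.1.1 - y.1.1| + `|x.1.2 - y.1.2|)) ->
  (forall x y, X x -> X y -> eucl_dist x y <= L * (`|x.1.1 - y.1.1| + `|x.1.2 - y.1.2|)) ->
  (forall x, X x -> y1 <= x.1.1 - b1 * x.2 <= y1 + (q ^+ 2)^-1 /\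
                    y2 <= x.1.2 - b2 * x.2 <= y2 + (q ^+ 2)^-1) ->
  (H X <= (1024 * L ^+ 2 / q ^+ 3)%:E)%E.
Proof.
move=> L1 q1 D0 bD1 bD2 XD XL Xs.
have q0 : 0 < q by lra.
have L0 : 0 < L by lra.
pose de := (q ^+ 2)^-1; have de0 : 0 < de by rewrite invr_gt0 exprn_gt0.
have C0 : 0 <= 1024 * L ^+ 2 / q ^+ 3.
  exact: (divr_ge0 (mulr_ge0 (ler0n _ _) (sqr_ge0 L)) (exprn_ge0 3 (ltW q0))).
have [[p Xp]|nX] := pselect (exists p, X p); last first.
  rewrite (_ : X = set0); last by apply/seteqP; split => // x Xx; apply: nX; exists x.
  by rewrite hausdorff20 lee_fin.
have close x : X x -> `|x.1.1 - p.1.1| <= 4 * de /\ `|x.1.2 - p.1.2| <= 4 * de.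
  move=> Xx; have := XD _ _ Xx Xp.
  have [/andP[a1 a2] /andP[a3 a4]] := Xs _ Xx; have [/andP[a5 a6] /andP[a7 a8]] := Xs _ Xp.
  rewrite -/de in a2 a4 a6 a8.
  set u := x.1.1 - p.1.1; set v := x.1.2 - p.1.2; set w := x.2 - p.2 => wD.
  have hb b : `|b| * D <= 4^-1 -> `|b * w| <= 4^-1 * (`|u| + `|v|).
    move=> bD; rewrite normrM; apply: (@le_trans _ _ (`|b| * (D * (`|u| + `|v|)))).
      by rewrite ler_wpM2l.
    by rewrite mulrA ler_wpM2r// addr_ge0.
  have hu : `|u| <= de + `|b1 * w|.
    rewrite -{1}[u](subrK (b1 * w)); apply: le_trans (ler_normD _ _) _.
    rewrite lerD2r (_ : u - _ = (x.1.1 - b1 * x.2) - (p.1.1 - b1 * p.2)); last by rewrite /u /w; ring.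
    by apply: (@window_dist _ _ y1); rewrite ?a1 ?a2 ?a5 ?a6.
  have hv : `|v| <= de + `|b2 * w|.
    rewrite -{1}[v](subrK (b2 * w)); apply: le_trans (ler_normD _ _) _.
    rewrite lerD2r (_ : v - _ = (x.1.2 - b2 * x.2) - (p.1.2 - b2 * p.2)); last by rewrite /v /w; ring.
    by apply: (@window_dist _ _ y2); rewrite ?a3 ?a4 ?a7 ?a8.
  exact: (absorb_quarter (normr_ge0 u) (normr_ge0 v) hu hv (hb _ bD1) (hb _ bD2)).
apply: (@le_trans _ _ (16 * L ^+ 2 * (8 * de) * (8 * de))%:E).
  apply: (@hausdorff2_le_rectangle _ _ (fun x => x.1.1) (fun x => x.1.2) (p.1.1 - 4 * de) (p.1.2 - 4 * de)) => //;
    [by rewrite mulr_gt0|by rewrite mulr_gt0|..].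
  move=> x /close[/dist_window h1 /dist_window h2].
  by have -> : 8 * de = 2 * (4 * de) by ring.
rewrite lee_fin /de.
have -> : 16 * L ^+ 2 * (8 * (q ^+ 2)^-1) * (8 * (q ^+ 2)^-1) = 1024 * L ^+ 2 / q ^+ 3 * q^-1.
  by field; rewrite gt_eqF.
by rewrite -[leRHS]mulr1; apply: ler_wpM2l => //; rewrite invf_le1.
Qed.

End GraphSlabs.

(** * The upper bound *)

Section Frames.
Context {R : realType}.

Let coord (x : R3 R) (k : 'I_3) : R := [:: x.1.1; x.1.2; x.2]`_k.

Let sum3 (F : 'I_3 -> R) : \sum_i F i = F 0 + F 1 + F (lift 0 1).
Proof. by rewrite !big_ord_recl big_ord0 addr0 addrA; congr (_ + F _ + F _); exact: val_inj. Qed.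

(* Rows orthonormal implies columns orthonormal. *)
Lemma frame_parseval (b : box R) (x : R3 R) : orthonormal_frame b ->
  dot x x = dot x (axis1 b) ^+ 2 + dot x (axis2 b) ^+ 2 + dot x (axis3 b) ^+ 2.
Proof.
case: b => a1 a2 a3 ? ? ?; rewrite /orthonormal_frame /= => -[d11 d22 d33 [d12 d13 d23]].
pose f (i : 'I_3) : R3 R := nth a1 [:: a1; a2; a3] i.
pose M : 'M[R]_3 := \matrix_(i, k) coord (f i) k.
have MM : M *m M^T = 1%:M.
  apply/matrixP => i j; rewrite !mxE; under eq_bigr do rewrite !mxE.
  rewrite sum3 /coord/=.
  have d21 : dot a2 a1 = 0 by rewrite dotC.
  have d31 : dot a3 a1 = 0 by rewrite dotC.
  have d32 : dot a3 a2 = 0 by rewrite dotC.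
  by case: i => -[|[|[|//]]] ?; case: j => -[|[|[|//]]] ?; rewrite /f/=;
    [exact: d11|exact: d12|exact: d13|exact: d21|exact: d22|exact: d23
    |exact: d31|exact: d32|exact: d33].
have /matrixP E := mulmx1C MM.
have e k l : coord a1 k * coord a1 l + coord a2 k * coord a2 l + coord a3 k * coord a3 l = (k == l)%:R.
  by have := E k l; rewrite !mxE; under eq_bigr do rewrite !mxE; rewrite sum3.
have e00 := e 0 0; have e11 := e 1 1; have e22 := e (lift 0 1) (lift 0 1).
have e01 := e 0 1; have e02 := e 0 (lift 0 1); have e12 := e 1 (lift 0 1).
rewrite /coord/= in e00 e11 e22 e01 e02 e12.
rewrite /dot; transitivity
  (x.1.1 ^+ 2 * (a1.1.1 * a1.1.1 + a2.1.1 * a2.1.1 + a3.1.1 * a3.1.1)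
   + x.1.2 ^+ 2 * (a1.1.2 * a1.1.2 + a2.1.2 * a2.1.2 + a3.1.2 * a3.1.2)
   + x.2 ^+ 2 * (a1.2 * a1.2 + a2.2 * a2.2 + a3.2 * a3.2)
   + 2 * x.1.1 * x.1.2 * (a1.1.1 * a1.1.2 + a2.1.1 * a2.1.2 + a3.1.1 * a3.1.2)
   + 2 * x.1.1 * x.2 * (a1.1.1 * a1.2 + a2.1.1 * a2.2 + a3.1.1 * a3.2)
   + 2 * x.1.2 * x.2 * (a1.1.2 * a1.2 + a2.1.2 * a2.2 + a3.1.2 * a3.2)); last by ring.
by rewrite e00 e11 e22 e01 e02 e12; ring.
Qed.

Lemma dotDl (x y z : R * R * R) : dot (x + y) z = dot x z + dot y z.
Proof. by rewrite /dot /=; ring. Qed.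

Lemma dotBl (x y z : R * R * R) : dot (x - y) z = dot x z - dot y z.
Proof. by rewrite /dot /=; ring. Qed.

Lemma dotZl (a : R) (x z : R * R * R) : dot (a *: x) z = a * dot x z.
Proof. by rewrite /dot /= /GRing.scale/=; ring. Qed.

Lemma dot_ge0 (x : R3 R) : 0 <= dot x x.
Proof. by rewrite /dot -!expr2 !addr_ge0 ?sqr_ge0. Qed.

Lemma enorm_sqr (x : R3 R) : enorm x ^+ 2 = dot x x.
Proof. by rewrite sqr_sqrtr// dot_ge0. Qed.

Lemma enorm_ge0 (x : R3 R) : 0 <= enorm x. Proof. exact: sqrtr_ge0. Qed.

(** The dilation times twice the radial defect bound 2 + 2 [comparability K] ^+ 2, so that one
    constant serves both for the radial width and for the distance to the centre. *)
Definition box_scale (K : partition_constants R) : R := dilation K * (4 + 4 * comparability K ^+ 2).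

Lemma box_scale_ge1 K : valid_constants K -> 1 <= box_scale K.
Proof.
move=> [k1 d1 _]; rewrite /box_scale.
by have := sqr_ge0 (comparability K); nra.
Qed.

(* The radial defect of a point of the annulus at tangential distance O(sqrt r)
   is O(1), because r^2 - t^2 = O(r). *)
Lemma dilated_box_bounds (K : partition_constants R) (r : R) (b : box R) (xi : R * R * R) :
  valid_constants K -> 1 <= r -> is_box K r b ->
  dilate (box_center r b) (dilation K) (box_set r b) xi ->
  `|dot (xi - box_center r b) (axis3 b)| <= box_scale K /\
  enorm (xi - box_center r b) <= box_scale K * Num.sqrt r.
Proof.
move=> [k1 d1 _] r1 [of_b [s1 s2 _] _ _] [ze zb <-].
have [_ _ d33 [_ d13 d23]] := of_b.
set kk := comparability K in k1 s1 s2 *; set dl := dilation K in d1 *.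
have r0 : 0 < r by lra.
pose sq := Num.sqrt r; have sq2 : sq ^+ 2 = r by rewrite sqr_sqrtr// ltW.
have sq1 : 1 <= sq by rewrite -(sqrtr1 R) ler_wsqrtr.
have [z1 z2 z3 z4] : [/\ `|dot ze (axis1 b)| <= kk * sq, `|dot ze (axis2 b)| <= kk * sq,
    `|enorm ze - r| <= 1 & 0 <= dot ze (axis3 b)].
  move: s1 s2 zb => /andP[_ s1] /andP[_ s2]; rewrite /box_set /curved_box/= !mul1r => -[z1 z2 z3 z4].
  by split => //; [exact: le_trans s1|exact: le_trans s2].
have pars := frame_parseval ze of_b; rewrite -enorm_sqr in pars.
set t := dot ze (axis3 b) in z4 pars *.
set A := dot ze (axis1 b) in z1 pars *; set B := dot ze (axis2 b) in z2 pars *.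
have sqrle (c : R) : `|c| <= kk * sq -> c ^+ 2 <= kk ^+ 2 * r.
  move=> ce; rewrite -sq2 -exprMn -[c ^+ 2]real_normK ?num_real//.
  by rewrite ler_sqr ?nnegrE// mulr_ge0//; lra.
have A2 := sqrle _ z1; have B2 := sqrle _ z2.
have n0 := enorm_ge0 ze.
move: z3; rewrite ler_norml => /andP[z5 z6].
have tn : t <= enorm ze.
  rewrite -ler_sqr ?nnegrE// pars; have := sqr_ge0 A; have := sqr_ge0 B; lra.
pose k3 := 2 + 2 * kk ^+ 2.
have kk2 : 1 <= kk ^+ 2 by rewrite exprn_ege1.
have t3 : `|t - r| <= k3.
  rewrite ler_norml; apply/andP; split; last by rewrite /k3; lra.
  have [tr|tr] := leP r t; first by rewrite /k3; lra.
  have e1 : r - 1 <= enorm ze by lra.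
  have e2 : (r - 1) ^+ 2 <= enorm ze ^+ 2 by rewrite ler_sqr ?nnegrE; lra.
  have : (r - t) * (r + t) <= (2 + 2 * kk ^+ 2) * r.
    have -> : (r - t) * (r + t) = r ^+ 2 - (enorm ze ^+ 2 - A ^+ 2 - B ^+ 2) by rewrite pars; ring.
    by move: e2; rewrite sqrrB; lra.
  move=> H; have : (r - t) * r <= k3 * r.
    apply: le_trans H; rewrite ler_wpM2l; lra.
  rewrite ler_pM2r//; lra.
have cE : box_center r b + dl *: (ze - box_center r b) - box_center r b = dl *: (ze - box_center r b).
  by rewrite addrAC subrr add0r.
rewrite cE.
have D3 : dot (ze - box_center r b) (axis3 b) = t - r by rewrite dotBl dotZl d33 mulr1.
have a31 : dot (axis3 b) (axis1 b) = 0 by rewrite dotC.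
have a32 : dot (axis3 b) (axis2 b) = 0 by rewrite dotC.
have D1 : dot (ze - box_center r b) (axis1 b) = A by rewrite dotBl dotZl a31 mulr0 subr0.
have D2 : dot (ze - box_center r b) (axis2 b) = B by rewrite dotBl dotZl a32 mulr0 subr0.
have dl0 : 0 < dl by lra.
split.
  rewrite dotZl D3 normrM (gtr0_norm dl0) /box_scale -/dl -/kk ler_pM2l//.
  by apply: le_trans t3 _; rewrite /k3; lra.
have P2 := frame_parseval (ze - box_center r b) of_b.
rewrite -enorm_sqr D1 D2 D3 in P2.
have -> : enorm (dl *: (ze - box_center r b)) = dl * enorm (ze - box_center r b).
  rewrite /enorm dotZl dotC dotZl mulrA -expr2 sqrtrM ?sqr_ge0// sqrtr_sqr gtr0_norm//.
rewrite /box_scale -/dl -/kk -mulrA ler_pM2l//.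
rewrite -ler_sqr ?nnegrE ?enorm_ge0//; last by rewrite mulr_ge0 ?sqrtr_ge0//; lra.
rewrite P2 exprMn sq2.
have t4 : (t - r) ^+ 2 <= k3 ^+ 2 by rewrite -[(t - r) ^+ 2]real_normK ?num_real// ler_sqr ?nnegrE// /k3; lra.
have : k3 ^+ 2 <= k3 ^+ 2 * r by rewrite ler_peMr// sqr_ge0.
move=> k3r; apply: (@le_trans _ _ ((2 * kk ^+ 2 + k3 ^+ 2) * r)); first by lra.
rewrite ler_pM2r// /k3; move: (kk ^+ 2) kk2 => w w1; nra.
Qed.

End Frames.

(** * Coordinates adapted to the direction of a box *)

Section AdaptedCoordinates.
Context {R : realType}.
Variables (l1 l2 M : R).
Hypotheses (l12 : 0 < l1 * l2) (M1 : 1 <= M).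
Local Notation H := (hausdorff2 R).

(** A Borel enlargement of the patch, over the square of half side [M]. *)
Definition graph_part : set (R3 R) :=
  [set x | [/\ x.2 = quadratic l1 l2 x.1, `|x.1.1| <= M & `|x.1.2| <= M]].

Definition slab_piece (a2 a3 : R3 R -> R) (q y2 y3 : R) : set (R3 R) :=
  graph_part `&` [set x | y2 <= a2 x <= y2 + (q ^+ 2)^-1 /\ y3 <= a3 x <= y3 + (q ^+ 2)^-1].

(** Here [al] is the radial direction and [ctr] the centre of the box, the [c_i] are coordinates of
    frequency and the [a_i] the dual coordinates of space. The box is thin in [c1], so the cells are
    long in [a1] and the measure estimate relies on [a2] and [a3]. *)
Definition adapted (Kc : R) (al ctr : R * R * R) (c1 c2 c3 a1 a2 a3 k : R3 R -> R) : Prop :=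
  [/\ sheared c1 c2 c3,
      forall x u, dot x u = a1 x * c1 u + a2 x * c2 u + a3 x * c3 u + k x,
      forall u : R * R * R, [/\ `|c1 u| <= Kc * `|dot (u - ctr) al|,
        `|c2 u| <= enorm (u - ctr) & `|c3 u| <= enorm (u - ctr)],
      [/\ measurable_fun [set: borelR3 R] a1, measurable_fun [set: borelR3 R] a2 &
          measurable_fun [set: borelR3 R] a3] &
      (forall x, graph_part x -> [/\ `|a1 x| <= Kc, `|a2 x| <= Kc & `|a3 x| <= Kc]) /\
      forall q y2 y3, 1 <= q -> (H (slab_piece a2 a3 q y2 y3) <= (Kc / q ^+ 3)%:E)%E].

Lemma measurable_affine3 (m0 m1 m2 m3 : R) :
  measurable_fun [set: borelR3 R] (fun u : R3 R => m0 + m1 * u.1.1 + m2 * u.1.2 + m3 * u.2).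
Proof.
have [[k1 k2] k3] := (@measurable_coord1 R, @measurable_coord2 R, @measurable_coord3 R).
by do ! (apply: measurable_funD => //); apply: measurable_funM.
Qed.

Lemma measurable_affine3E (f : R3 R -> R) (m0 m1 m2 m3 : R) :
  (forall u, f u = m0 + m1 * u.1.1 + m2 * u.1.2 + m3 * u.2) ->
  measurable_fun [set: borelR3 R] f.
Proof. by move=> /funext ->; exact: measurable_affine3. Qed.

Lemma enorm_le_coord (x : R3 R) : enorm x <= `|x.1.1| + `|x.1.2| + `|x.2|.
Proof.
have s0 : 0 <= `|x.1.1| + `|x.1.2| + `|x.2| by rewrite !addr_ge0.
rewrite -ler_sqr ?nnegrE ?enorm_ge0// enorm_sqr /dot -!expr2.
rewrite -[x.1.1 ^+ 2]real_normK ?num_real// -[x.1.2 ^+ 2]real_normK ?num_real//.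
rewrite -[x.2 ^+ 2]real_normK ?num_real//.
move: `|x.1.1| (normr_ge0 x.1.1) `|x.1.2| (normr_ge0 x.1.2) `|x.2| (normr_ge0 x.2) => a a0 b b0 c c0.
by clear -a0 b0 c0; nra.
Qed.

Let D := (`|l1| + `|l2|) * M.

Let M0 : 0 <= M. Proof. exact: le_trans M1. Qed.

Let D0 : 0 <= D. Proof. by rewrite mulr_ge0// addr_ge0. Qed.

Lemma graph_part_lipschitz (x y : R3 R) : graph_part x -> graph_part y ->
  `|x.2 - y.2| <= D * (`|x.1.1 - y.1.1| + `|x.1.2 - y.1.2|).
Proof.
move=> [-> x1 x2] [-> y1 y2]; rewrite /quadratic.
have -> : (l1 * x.1.1 ^+ 2 + l2 * x.1.2 ^+ 2) / 2 - (l1 * y.1.1 ^+ 2 + l2 * y.1.2 ^+ 2) / 2 =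
  l1 * ((x.1.1 + y.1.1) / 2) * (x.1.1 - y.1.1) + l2 * ((x.1.2 + y.1.2) / 2) * (x.1.2 - y.1.2) by field.
have h (s t : R) : `|s| <= M -> `|t| <= M -> `|(s + t) / 2| <= M.
  by rewrite !ler_norml => /andP[? ?] /andP[? ?]; apply/andP; split; lra.
apply: le_trans (ler_normD _ _) _; rewrite [leRHS]mulrDr; apply: lerD.
  rewrite normrM ler_wpM2r// normrM /D; apply: ler_pM => //; last exact: (h _ _ x1 y1).
  by rewrite lerDl.
rewrite normrM ler_wpM2r// normrM /D; apply: ler_pM => //; last exact: (h _ _ x2 y2).
by rewrite lerDr.
Qed.

Lemma graph_part_dist (x y : R3 R) : graph_part x -> graph_part y ->
  eucl_dist x y <= (1 + D) * (`|x.1.1 - y.1.1| + `|x.1.2 - y.1.2|).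
Proof.
move=> Gx Gy; apply: le_trans (enorm_le_coord _) _.
by rewrite mulrDl mul1r lerD2l; exact: graph_part_lipschitz.
Qed.

Lemma graph_part_height (x : R3 R) : graph_part x -> `|x.2| <= D * M.
Proof.
move=> [-> x1 x2]; rewrite /quadratic normrM normfV (ger0_norm (_ : 0 <= 2))//.
rewrite ler_pdivrMr//; apply: le_trans (ler_normD _ _) _; rewrite [`|l1 * _|]normrM [`|l2 * _|]normrM !normrX.
have h (s : R) : `|s| <= M -> `|s| ^+ 2 <= M ^+ 2 by move=> sM; rewrite ler_sqr ?nnegrE//; lra.
have := ler_wpM2l (normr_ge0 l1) (h _ x1); have := ler_wpM2l (normr_ge0 l2) (h _ x2).
rewrite /D; have : 0 <= `|l1| * M ^+ 2 + `|l2| * M ^+ 2 by rewrite addr_ge0 ?mulr_ge0 ?sqr_ge0.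
by lra.
Qed.

(** Threshold for the slopes of a nearly vertical direction: [D] is the Lipschitz constant of the
    graph, and e0 D <= 1/4 is the absorption condition of [transversal_slab]. *)
Let e0 := (4 + 4 * D)^-1.

Let e0_gt0 : 0 < e0. Proof. by rewrite invr_gt0; have := D0; lra. Qed.

Let e0D : e0 * D <= 4^-1.
Proof. by have := D0; rewrite /e0 => d; rewrite mulrC ler_pdivrMr; lra. Qed.

Let e0_le : e0 <= 4^-1.
Proof. by have := D0; rewrite /e0 => d; rewrite lef_pV2 ?posrE; lra. Qed.

(* The first alternative is the case of a box whose radial direction is nearly
   vertical, hence transversal to the surface. *)
Lemma direction_cases (al : R * R * R) : dot al al = 1 ->
  [\/ [/\ 2^-1 <= `|al.2|, `|al.1.1| <= e0 * `|al.2| & `|al.1.2| <= e0 * `|al.2|],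
      e0 / 2 <= `|al.1.1| /\ `|al.1.2| <= `|al.1.1| |
      e0 / 2 <= `|al.1.2| /\ `|al.1.1| <= `|al.1.2|].
Proof.
rewrite /dot -!expr2 -[al.1.1 ^+ 2]real_normK ?num_real// -[al.1.2 ^+ 2]real_normK ?num_real//.
rewrite -[al.2 ^+ 2]real_normK ?num_real//.
move: `|al.1.1| (normr_ge0 al.1.1) `|al.1.2| (normr_ge0 al.1.2) `|al.2| (normr_ge0 al.2) => a a0 b b0 c c0 abc.
have [e1 e2] := (e0_gt0, e0_le); move: e0 e1 e2 => e e1 e2; clear -a0 b0 c0 abc e1 e2.
have sq (s t : R) : 0 <= s -> s <= t -> s ^+ 2 <= t ^+ 2 by move=> s0 st; rewrite ler_sqr ?nnegrE//; lra.
have key (s t : R) : 0 <= t -> t <= s -> s ^+ 2 + t ^+ 2 + c ^+ 2 = 1 -> e * c < s -> e / 2 <= s.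
  move=> t0 ts E es; rewrite leNgt; apply/negP => s2.
  have c2 : c < 2^-1.
    by rewrite -(ltr_pM2l e1); lra.
  have := sq _ _ c0 (ltW c2); have := sq _ _ t0 ts.
  have s8 : s <= 8^-1 by lra.
  have := sq _ _ (le_trans t0 ts) s8.
  by rewrite !expr2; lra.
have [h1|h1] := leP a (e * c); have [h2|h2] := leP b (e * c).
- constructor 1; split => //; rewrite leNgt; apply/negP => c2.
  have := sq _ _ c0 (ltW c2).
  have ec : e * c <= 8^-1.
    by apply: (@le_trans _ _ (4^-1 * 2^-1)); [rewrite ler_pM// ltW|lra].
  have := sq _ _ a0 (le_trans h1 ec); have := sq _ _ b0 (le_trans h2 ec).
  by rewrite !expr2; lra.
- constructor 3; have ab : a <= b by lra.
  by split => //; apply: (key _ a) => //; rewrite -abc; ring.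
- constructor 2; have ba : b <= a by lra.
  by split => //; apply: (key _ b).
- have [ab|/ltW ba] := leP a b.
    by constructor 3; split => //; apply: (key _ a) => //; rewrite -abc; ring.
  by constructor 2; split => //; apply: (key _ b).
Qed.

(** The sum of the bounds of the three cases, so that one constant works for all directions. *)
Definition adapted_const : R :=
  2 / e0 + M * (1 + D) * (1 + 2 / e0) + 1024 * (1 + D) ^+ 2 +
  256 * (1 + D) ^+ 2 * Num.sqrt (2 * (1 + `|l2| * (M + 1)) / `|l1|) +
  256 * (1 + D) ^+ 2 * Num.sqrt (2 * (1 + `|l1| * (M + 1)) / `|l2|).

Let KcP : [/\ 2 / e0 <= adapted_const, M * (1 + D) * (1 + 2 / e0) <= adapted_const,
  1024 * (1 + D) ^+ 2 <= adapted_const,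
  256 * (1 + D) ^+ 2 * Num.sqrt (2 * (1 + `|l2| * (M + 1)) / `|l1|) <= adapted_const &
  256 * (1 + D) ^+ 2 * Num.sqrt (2 * (1 + `|l1| * (M + 1)) / `|l2|) <= adapted_const].
Proof.
have t1 : 0 <= 2 / e0 by rewrite divr_ge0// ltW.
have t2 : 0 <= M * (1 + D) * (1 + 2 / e0).
  by rewrite mulr_ge0 ?mulr_ge0 ?addr_ge0.
have dd : 0 <= (1 + D) ^+ 2 by exact: sqr_ge0.
have t4 : 0 <= 256 * (1 + D) ^+ 2 * Num.sqrt (2 * (1 + `|l2| * (M + 1)) / `|l1|).
  by apply: mulr_ge0; [lra|exact: sqrtr_ge0].
have t5 : 0 <= 256 * (1 + D) ^+ 2 * Num.sqrt (2 * (1 + `|l1| * (M + 1)) / `|l2|).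
  by apply: mulr_ge0; [lra|exact: sqrtr_ge0].
rewrite /adapted_const; move: (2 / e0) t1 (M * _ * _) t2 ((1 + D) ^+ 2) dd (_ * Num.sqrt _) t4 (_ * Num.sqrt _) t5.
by move=> *; split; lra.
Qed.

Lemma adapted_const_ge0 : 0 <= adapted_const.
Proof. by have [h _ _ _ _] := KcP; apply: le_trans h; rewrite divr_ge0// ltW. Qed.

Let unit_coord (al : R * R * R) : dot al al = 1 -> [/\ `|al.1.1| <= 1, `|al.1.2| <= 1 & `|al.2| <= 1].
Proof.
move=> d1; have : enorm al = 1 by rewrite /enorm d1 sqrtr1.
by move=> <-; exact: enorm_coord.
Qed.

Let a_bound (al : R) (be : R) : `|be| <= 1 -> e0 / 2 <= `|al| -> `|be / al| <= 2 / e0.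
Proof.
move=> b1 a2; have a0 : 0 < `|al| by have := e0_gt0; lra.
rewrite normrM normfV ler_pdivrMr//; apply: (le_trans b1).
by rewrite mulrAC ler_pdivlMr//; lra.
Qed.

Let c1_bound (al d : R) : e0 / 2 <= `|al| -> `|d / al| <= adapted_const * `|d|.
Proof.
move=> a2; have a0 : 0 < `|al| by have := e0_gt0; lra.
rewrite normrM normfV mulrC ler_wpM2r//; have [h _ _ _ _] := KcP; apply: le_trans h.
rewrite -[2 / e0]invf_div lef_pV2 ?posrE//.
by rewrite divr_gt0.
Qed.

Let lin_bound (s t b : R) : `|s| <= M * (1 + D) -> `|t| <= M * (1 + D) -> `|b| <= 2 / e0 ->
  `|s - b * t| <= adapted_const.
Proof.
move=> sM tM bb; have [_ h _ _ _] := KcP; apply: le_trans h.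
apply: le_trans (ler_normB _ _) _; rewrite mulrDr mulr1; apply: lerD => //.
by rewrite normrM mulrC; apply: ler_pM.
Qed.

Let coord_bound (x : R3 R) : graph_part x ->
  [/\ `|x.1.1| <= M * (1 + D), `|x.1.2| <= M * (1 + D) & `|x.2| <= M * (1 + D)].
Proof.
move=> Gx; have := graph_part_height Gx; case: Gx => _ x1 x2 x3.
have : 0 <= D * M by rewrite mulr_ge0.
rewrite mulrDr mulr1 [M * D]mulrC => dm.
by split; [apply: le_trans x1 _|apply: le_trans x2 _|apply: le_trans x3 _]; rewrite ?lerDl ?lerDr.
Qed.

(** Dividing by the dominant horizontal component of [al] makes [c1] the radial coordinate up to a
    bounded factor; that this component dominates is the slope condition |b| <= 1 of
    [quadratic_slab]. *)
Let adapted_steep1 (al ctr : R * R * R) : dot al al = 1 ->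
  e0 / 2 <= `|al.1.1| -> `|al.1.2| <= `|al.1.1| ->
  exists c1 c2 c3 a1 a2 a3 k, adapted adapted_const al ctr c1 c2 c3 a1 a2 a3 k.
Proof.
move=> al1 ale ab; have a0 : 0 < `|al.1.1| by have := e0_gt0; lra.
have an0 : al.1.1 != 0 by rewrite -normr_gt0.
have [u1 u2 u3] := unit_coord al1.
pose b := al.1.2 / al.1.1; pose a := al.2 / al.1.1.
exists (fun u => u.1.1 + (b * u.1.2 + a * u.2 - (ctr.1.1 + b * ctr.1.2 + a * ctr.2))).
exists (fun u => u.1.2 + - ctr.1.2), (fun u => u.2 + - ctr.2).
exists (fun x => x.1.1), (fun x => x.1.2 - b * x.1.1), (fun x => x.2 - a * x.1.1), (dot^~ ctr).
split.
- apply: (@sheared_zyx _ (fun y z => b * y + a * z - (ctr.1.1 + b * ctr.1.2 + a * ctr.2))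
    (fun=> - ctr.1.2) (- ctr.2)) => //.
  + by apply: (@measurable_affine3E _ (- (ctr.1.1 + b * ctr.1.2 + a * ctr.2)) 1 b a) => u; ring.
  + by apply: (@measurable_affine3E _ (- ctr.1.2) 0 1 0) => u; ring.
  + by apply: (@measurable_affine3E _ (- ctr.2) 0 0 1) => u; ring.
- by move=> x u; rewrite /dot; ring.
- move=> u; have [n1 n2 n3] := enorm_coord (u - ctr); split => //.
  rewrite (_ : _ + _ = dot (u - ctr) al / al.1.1); first exact: c1_bound.
  by rewrite /dot /= /a /b; field.
- split; [exact: measurable_coord1|..].
  + by apply: (@measurable_affine3E _ 0 (- b) 1 0) => u; ring.
  + by apply: (@measurable_affine3E _ 0 (- a) 0 1) => u; ring.
- split => [x Gx|q y2 y3 q1].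
    have [x1 x2 x3] := coord_bound Gx; split; try by apply: lin_bound => //; exact: a_bound.
    have := @lin_bound x.1.1 0 0 x1; rewrite mulr0 subr0; apply; rewrite normr0.
      by apply: le_trans x1.
    by rewrite divr_ge0// ltW.
  have [_ _ _ h _] := KcP.
  apply: le_trans (@quadratic_slab _ _ (fun x => x.1.1) (fun x => x.1.2) l1 l2 `|l1| M (1 + D) a b y2 y3 q
     _ _ _ _ _ _ _ _ _ _) _ => //.
  + by rewrite normr_gt0; apply: contraTneq l12 => ->; rewrite mul0r ltxx.
  + by rewrite lerDl.
  + by rewrite /b normrM normfV ler_pdivrMr// mul1r.
  + by move=> x [[-> ? ?] _].
  + by move=> x y [Gx _] [Gy _]; exact: graph_part_dist.
  + by move=> x [_ []].
  + rewrite lee_fin ler_wpM2r// invr_ge0 exprn_ge0//; lra.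
Qed.

Let adapted_steep2 (al ctr : R * R * R) : dot al al = 1 ->
  e0 / 2 <= `|al.1.2| -> `|al.1.1| <= `|al.1.2| ->
  exists c1 c2 c3 a1 a2 a3 k, adapted adapted_const al ctr c1 c2 c3 a1 a2 a3 k.
Proof.
move=> al1 ale ab; have a0 : 0 < `|al.1.2| by have := e0_gt0; lra.
have an0 : al.1.2 != 0 by rewrite -normr_gt0.
have [u1 u2 u3] := unit_coord al1.
pose b := al.1.1 / al.1.2; pose a := al.2 / al.1.2.
exists (fun u => u.1.2 + (b * u.1.1 + a * u.2 - (ctr.1.2 + b * ctr.1.1 + a * ctr.2))).
exists (fun u => u.1.1 + - ctr.1.1), (fun u => u.2 + - ctr.2).
exists (fun x => x.1.2), (fun x => x.1.1 - b * x.1.2), (fun x => x.2 - a * x.1.2), (dot^~ ctr).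
split.
- apply: (@sheared_zxy _ (fun y z => b * y + a * z - (ctr.1.2 + b * ctr.1.1 + a * ctr.2))
    (fun=> - ctr.1.1) (- ctr.2)) => //.
  + by apply: (@measurable_affine3E _ (- (ctr.1.2 + b * ctr.1.1 + a * ctr.2)) b 1 a) => u; ring.
  + by apply: (@measurable_affine3E _ (- ctr.1.1) 1 0 0) => u; ring.
  + by apply: (@measurable_affine3E _ (- ctr.2) 0 0 1) => u; ring.
- by move=> x u; rewrite /dot; ring.
- move=> u; have [n1 n2 n3] := enorm_coord (u - ctr); split => //.
  rewrite (_ : _ + _ = dot (u - ctr) al / al.1.2); first exact: c1_bound.
  by rewrite /dot /= /a /b; field.
- split; [exact: measurable_coord2|..].
  + by apply: (@measurable_affine3E _ 0 1 (- b) 0) => u; ring.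
  + by apply: (@measurable_affine3E _ 0 0 (- a) 1) => u; ring.
- split => [x Gx|q y2 y3 q1].
    have [x1 x2 x3] := coord_bound Gx; split; try by apply: lin_bound => //; exact: a_bound.
    have := @lin_bound x.1.2 0 0 x2; rewrite mulr0 subr0; apply; rewrite normr0.
      by apply: le_trans x2.
    by rewrite divr_ge0// ltW.
  have [_ _ _ _ h] := KcP.
  apply: le_trans (@quadratic_slab _ _ (fun x => x.1.2) (fun x => x.1.1) l2 l1 `|l2| M (1 + D) a b y2 y3 q
     _ _ _ _ _ _ _ _ _ _) _ => //.
  + by rewrite normr_gt0; apply: contraTneq l12 => ->; rewrite mulr0 ltxx.
  + by rewrite mulrC.
  + by rewrite lerDl.
  + by rewrite /b normrM normfV ler_pdivrMr// mul1r.
  + by move=> x [[-> ? ?] _]; split => //; rewrite /quadratic addrC.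
  + by move=> x y [Gx _] [Gy _]; rewrite [`|x.1.2 - _| + _]addrC; exact: graph_part_dist.
  + by move=> x [_ []].
  + rewrite lee_fin ler_wpM2r// invr_ge0 exprn_ge0//; lra.
Qed.

(** Now the third coordinate leads [c1], and the slabs become those of [transversal_slab]. *)
Let adapted_vertical (al ctr : R * R * R) : dot al al = 1 ->
  2^-1 <= `|al.2| -> `|al.1.1| <= e0 * `|al.2| -> `|al.1.2| <= e0 * `|al.2| ->
  exists c1 c2 c3 a1 a2 a3 k, adapted adapted_const al ctr c1 c2 c3 a1 a2 a3 k.
Proof.
move=> al1 ale ab1 ab2; have a0 : 0 < `|al.2| by lra.
have an0 : al.2 != 0 by rewrite -normr_gt0.
pose b1 := al.1.1 / al.2; pose b2 := al.1.2 / al.2.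
have ale' : e0 / 2 <= `|al.2| by have := e0_le; lra.
have bb (t : R) : `|t| <= e0 * `|al.2| -> `|t / al.2| <= e0.
  by move=> te; rewrite normrM normfV ler_pdivrMr.
have be (t : R) : `|t| <= e0 * `|al.2| -> `|t / al.2| <= 2 / e0.
  move=> te; apply: le_trans (bb _ te) _; rewrite ler_pdivlMr//.
  have e1 : e0 <= 1 by apply: le_trans e0_le _; lra.
  by apply: (@le_trans _ _ 1); [rewrite mulr_ile1 ?(ltW e0_gt0)|rewrite ler1n].
have bD (t : R) : `|t| <= e0 * `|al.2| -> `|t / al.2| * D <= 4^-1.
  by move=> te; apply: le_trans e0D; rewrite ler_wpM2r// bb.
exists (fun u => u.2 + (b2 * u.1.2 + b1 * u.1.1 - (ctr.2 + b1 * ctr.1.1 + b2 * ctr.1.2))).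
exists (fun u => u.1.2 + - ctr.1.2), (fun u => u.1.1 + - ctr.1.1).
exists (fun x => x.2), (fun x => x.1.2 - b2 * x.2), (fun x => x.1.1 - b1 * x.2), (dot^~ ctr).
split.
- apply: (@sheared_xyz _ (fun y z => b2 * y + b1 * z - (ctr.2 + b1 * ctr.1.1 + b2 * ctr.1.2))
    (fun=> - ctr.1.2) (- ctr.1.1)) => //.
  + by apply: (@measurable_affine3E _ (- (ctr.2 + b1 * ctr.1.1 + b2 * ctr.1.2)) b1 b2 1) => u; ring.
  + by apply: (@measurable_affine3E _ (- ctr.1.2) 0 1 0) => u; ring.
  + by apply: (@measurable_affine3E _ (- ctr.1.1) 1 0 0) => u; ring.
- by move=> x u; rewrite /dot; ring.
- move=> u; have [n1 n2 n3] := enorm_coord (u - ctr); split => //.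
  rewrite (_ : _ + _ = dot (u - ctr) al / al.2); first exact: c1_bound.
  by rewrite /dot /= /b1 /b2; field.
- split; [exact: measurable_coord3|..].
  + by apply: (@measurable_affine3E _ 0 0 1 (- b2)) => u; ring.
  + by apply: (@measurable_affine3E _ 0 1 0 (- b1)) => u; ring.
- split => [x Gx|q y2 y3 q1].
    have [x1 x2 x3] := coord_bound Gx; split; try by apply: lin_bound => //; exact: be.
    have := @lin_bound x.2 0 0 x3; rewrite mulr0 subr0; apply; rewrite normr0.
      by apply: le_trans x3.
    by rewrite divr_ge0// ltW.
  have [_ _ h _ _] := KcP.
  apply: le_trans (@transversal_slab _ _ (1 + D) D b1 b2 y3 y2 q _ _ _ _ _ _ _ _) _ => //.
  + by rewrite lerDl.
  + exact: bD.
  + exact: bD.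
  + by move=> x y [Gx _] [Gy _]; exact: graph_part_lipschitz.
  + by move=> x y [Gx _] [Gy _]; exact: graph_part_dist.
  + by move=> x [_ []].
  + rewrite lee_fin ler_wpM2r// invr_ge0 exprn_ge0//; lra.
Qed.

Lemma exists_adapted (al ctr : R * R * R) : dot al al = 1 ->
  exists c1 c2 c3 a1 a2 a3 k, adapted adapted_const al ctr c1 c2 c3 a1 a2 a3 k.
Proof.
move=> al1; have [[h1 h2 h3]|[h1 h2]|[h1 h2]] := direction_cases al1.
- exact: adapted_vertical.
- exact: adapted_steep1.
- exact: adapted_steep2.
Qed.

End AdaptedCoordinates.

Section ContinuousMeasurable.
Context {R : realType}.

(** [borelR3] carries the product sigma-algebra; an open set belongs to it as a countable union of
    cubes with rational centres and half sides 1 / (n + 1). *)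
Lemma open_measurable_R3 (O : set (R * R * R)) : open O -> measurable (O : set (borelR3 R)).
Proof.
move=> oO.
pose B (t : rat * rat * rat * nat) : set (R3 R) :=
  [set x | [/\ `|x.1.1 - ratr t.1.1.1| < (t.2.+1%:R)^-1, `|x.1.2 - ratr t.1.1.2| < (t.2.+1%:R)^-1 &
    `|x.2 - ratr t.1.2| < (t.2.+1%:R)^-1]].
have mB t : measurable (B t : set (borelR3 R)).
  have slab (c : R3 R -> R) (q : R) : measurable_fun [set: borelR3 R] c ->
      measurable ([set x | `|c x - q| < (t.2.+1%:R)^-1] : set (borelR3 R)).
    move=> mc; rewrite (_ : [set x | _] = setT `&` c @^-1` `]q - (t.2.+1%:R)^-1, q + (t.2.+1%:R)^-1[).
      exact: mc.
    by apply/seteqP; split => x /=; rewrite in_itv/= ltr_distl; [split|case].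
  rewrite (_ : B t = [set x | `|x.1.1 - ratr t.1.1.1| < (t.2.+1%:R)^-1] `&`
     [set x | `|x.1.2 - ratr t.1.1.2| < (t.2.+1%:R)^-1] `&` [set x | `|x.2 - ratr t.1.2| < (t.2.+1%:R)^-1]).
    by do ! apply: measurableI; apply: slab; [exact: measurable_coord1|exact: measurable_coord2|exact: measurable_coord3].
  by apply/seteqP; split => x; [case|move=> [[]]].
have -> : O = \bigcup_t (if `[< B t `<=` O >] then B t else set0).
  apply/seteqP; split => [x Ox|x [t _]]; last by case: asboolP => // BO /BO.
  have : nbhs x O by exact: open_nbhs_nbhs.
  move=> /nbhs_ballP[e/= e0 eO].
  pose n := Num.truncn (2 / e); have ne : 2 / e < n.+1%:R by exact: truncnS_gt.
  have n0 : 0 < (n.+1%:R : R)^-1 by rewrite invr_gt0.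
  have rat_near (d y : R) : 0 < d -> exists q : rat, `|y - ratr q| < d.
    move=> d0; have yy : y - d < y + d by lra.
    have [q] := rat_in_itvoo yy.
    by rewrite in_itv/= => /andP[? ?]; exists q; rewrite ltr_distl; apply/andP; split; lra.
  have [[[q1 h1] [q2 h2]] [q3 h3]] := (rat_near _ x.1.1 n0, rat_near _ x.1.2 n0, rat_near _ x.2 n0).
  exists (q1, q2, q3, n) => //; rewrite asboolT//= => y [/= k1 k2 k3]; apply: eO.
  have close (a b c : R) : `|a - c| < n.+1%:R^-1 -> `|b - c| < n.+1%:R^-1 -> `|a - b| < e.
    have n2 : 2 * n.+1%:R^-1 < e by move: ne; rewrite ltr_pdivrMr// mulrC => ne; rewrite ltr_pdivrMr.
    move: n2; move: (n.+1%:R^-1) => d d2.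
    by rewrite !ltr_distl => /andP[? ?] /andP[? ?]; apply/andP; split; lra.
  by split; [split|]; [exact: (close _ _ (ratr q1))|exact: (close _ _ (ratr q2))|exact: (close _ _ (ratr q3))].
by apply: countable_bigcupT_measurable; [exact: countableP|move=> t; case: ifP].
Qed.

Lemma continuous_measurable_R3 (f : R * R * R -> R) : continuous f ->
  measurable_fun [set: borelR3 R] (f : borelR3 R -> measurableTypeR R).
Proof.
move=> /continuousP cf; apply: (measurability _ (RGenOInfty.measurableE R)) => _ [_ [a ->] <-].
by rewrite setTI; apply: open_measurable_R3; apply: cf; exact: rray_open.
Qed.

End ContinuousMeasurable.

(** * The estimate for one box *)

Section Piece.
Context {R : realType}.
Local Notation C := (R[i]).
Local Notation H := (hausdorff2 R).
Variables (l1 l2 M : R).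
Hypotheses (l12 : 0 < l1 * l2) (M1 : 1 <= M).
Local Notation G := (graph_part l1 l2 M).
Local Notation Kc := (adapted_const l1 l2 M).

Lemma measurable_graph_part : measurable (G : set (borelR3 R)).
Proof.
have [[m1 m2] m3] := (@measurable_coord1 R, @measurable_coord2 R, @measurable_coord3 R).
have mq : measurable_fun [set: borelR3 R] (fun x : R3 R => x.2 - quadratic l1 l2 x.1).
  apply: measurable_funB => //; apply: measurable_funM => //.
  by apply: measurable_funD; apply: measurable_funM => //; exact: measurable_funX.
rewrite (_ : G = (setT `&` (fun x : R3 R => x.2 - quadratic l1 l2 x.1) @^-1` [set 0]) `&`
   (setT `&` (fun x : R3 R => x.1.1) @^-1` `[- M, M]) `&` (setT `&` (fun x : R3 R => x.1.2) @^-1` `[- M, M])).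
  by apply: measurableI; [apply: measurableI; [exact: (mq measurableT _ (measurable_set1 0))|exact: m1]|exact: m2].
apply/seteqP; split => x /=; rewrite !in_itv/= -!ler_norml.
  by move=> [-> ? ?]; rewrite subrr.
by move=> [[[_ /eqP]]]; rewrite subr_eq0 => /eqP ? [_ ?] [_ ?].
Qed.

Lemma cintegrable_ball (g : R3 R -> C) (ctr : R * R * R) (rho : R) :
  cmeasurable g -> (energy g < +oo)%E -> (forall u : R * R * R, g u != 0 -> enorm (u - ctr) <= rho) ->
  cintegrable g.
Proof.
move=> cmg eg sg; pose t1 := `|ctr.1.1| + `|ctr.1.2| + `|ctr.2|.
apply: (@cintegrable_compact _ _ (Num.truncn (t1 + rho))) => // u /sg s2.
have [n1 n2 n3] := enorm_coord (u - ctr).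
have w (s t : R) : `|s - t| <= enorm (u - ctr) -> `|t| <= t1 -> `|s| <= (Num.truncn (t1 + rho)).+1%:R.
  move=> st tt; apply: le_trans (ltW (truncnS_gt _)); rewrite -(subrK t s).
  by apply: le_trans (ler_normD _ _) _; rewrite addrC lerD//; exact: le_trans s2.
have t10 := normr_ge0 ctr.1.1; have t20 := normr_ge0 ctr.1.2; have t30 := normr_ge0 ctr.2.
by split; [apply: (w _ _ n1)|apply: (w _ _ n2)|apply: (w _ _ n3)]; rewrite /t1; lra.
Qed.

Lemma measurable_H2_ctrans (g : R3 R -> C) s : cintegrable g ->
  measurable_fun [set: H2space R] (fun x : H2space R => (cabs (ctrans s g x) ^+ 2)%:E).
Proof.
move=> cg; have [mr' mi'] := cmeasurable_ctrans s cg; apply/measurable_EFinP.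
rewrite (_ : (fun x => _) = fun x => complex.Re (ctrans s g x) ^+ 2 + complex.Im (ctrans s g x) ^+ 2).
  by apply: measurable_funD; apply: measurable_funX; exact: measurable_H2_borel.
by apply/funext => x; exact: cabs_sqr.
Qed.

(** The factor 512 is 64 from the sampling times 8 from the volume h1 h2^2 of the box of
    coordinates. *)
Definition piece_const (ka : R) : R := 512 * 160 ^+ 3 * ((Kc + 1) * Kc) * ka ^+ 3.

(** The volume, of order q^4, times the measure of a cell, of order q^-3, leaves [q]. The bound on
    the cells is uniform, so it comes out of the sum of the suprema. *)
Lemma piece_estimate (nu : {measure set (H2space R) -> \bar R}) (B ka q : R)
    (al ctr : R * R * R) (g : R3 R -> C) :
  0 <= B -> (forall A : set (H2space R), measurable A -> (nu A <= B%:E * H (A `&` G))%E) ->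
  1 <= ka -> 1 <= q -> dot al al = 1 -> cmeasurable g -> (energy g < +oo)%E ->
  (forall u : R * R * R, g u != 0 -> `|dot (u - ctr) al| <= ka /\ enorm (u - ctr) <= ka * q ^+ 2) ->
  (\int[nu]_x (cabs (ctrans 1 g x) ^+ 2)%:E <= (B * piece_const ka * q)%:E * energy g)%E.
Proof.
move=> B0 nuH k1 q1 al1 cmg eg sg.
have q0 : 0 < q by lra.
have k0 : 0 < ka by lra.
have k2 : 1 <= 2 * ka by lra.
have Kc0 : 0 <= Kc by exact: adapted_const_ge0.
have [c1 [c2 [c3 [a1 [a2 [a3 [k [sh phE cb [m1 m2 m3] [ab slab]]]]]]]]] := exists_adapted l12 M1 ctr al1.
pose h1 := 2 * (Kc + 1) * ka; pose h2 := 2 * ka * q ^+ 2.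
have h10 : 0 < h1 by rewrite mulr_gt0// mulr_gt0//; lra.
have h20 : 0 < h2 by rewrite mulr_gt0 ?exprn_gt0// mulr_gt0.
have p0 : 0 < 2 * pi :> R by rewrite mulr_gt0// pi_gt0.
have p1 : 1 <= 2 * pi :> R by have := pi_ge2 R; lra.
have sg' u : g u != 0 -> [/\ `|c1 u| <= h1 / 2, `|c2 u| <= h2 / 2 & `|c3 u| <= h2 / 2].
  move=> /sg[s1 s2]; have [b1 b2 b3] := cb u.
  have -> : h2 / 2 = ka * q ^+ 2 by rewrite /h2; field.
  have -> : h1 / 2 = (Kc + 1) * ka by rewrite /h1; field.
  split; [|exact: le_trans s2|exact: le_trans s2].
  by apply: (le_trans b1); apply: ler_pM => //; lra.
have [ir ii eE] := energy_Re_Im cmg eg; have [mr mi] := cmg.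
have phE' x u : 2 * pi * (1 * dot x u) = (2 * pi * a1 x) * c1 u + (2 * pi * a2 x) * c2 u +
    (2 * pi * a3 x) * c3 u + 2 * pi * k x by rewrite mul1r phE; ring.
(* The dual coordinates are bounded by [Kc] on the graph, so 2 [Mn] + 1 cells in each direction
   cover it. *)
pose t0 := (h1 + h2) * (2 * pi * Kc); pose Mn := (Num.truncn t0).+1.
have Mnt : t0 <= Mn%:R by rewrite ltW// truncnS_gt.
have [S [S0 SF SE]] := sampling sh h10 h20 h20 mr mi ir ii sg' phE' (2 * Mn).+1 (- Mn%:R).
set cell := @sampling_cell _ _ _ _ _ _ _ _ _ in SF.
pose E j := cell j `&` G.
have mE j : measurable (E j : set (H2space R)).
  apply: measurable_H2_set; apply: measurableI; last exact: measurable_graph_part.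
  have mA (h y : R) (a : R3 R -> R) : measurable_fun [set: borelR3 R] a ->
      measurable ([set x | y <= h * (2 * pi * a x) <= y + 1] : set (borelR3 R)).
    move=> ma; rewrite (_ : [set x | _] = setT `&` (fun x => h * (2 * pi * a x)) @^-1` `[y, y + 1]).
      by apply: measurable_funM => //; apply: measurable_funM.
    by apply/seteqP; split => x /=; rewrite in_itv/=; [split|case].
  rewrite (_ : cell j = [set x | - Mn%:R + j.1.1%:R <= h1 * (2 * pi * a1 x) <= - Mn%:R + j.1.1%:R + 1] `&`
    [set x | - Mn%:R + j.1.2%:R <= h2 * (2 * pi * a2 x) <= - Mn%:R + j.1.2%:R + 1] `&`
    [set x | - Mn%:R + j.2%:R <= h2 * (2 * pi * a3 x) <= - Mn%:R + j.2%:R + 1]).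
    by do ! apply: measurableI; exact: mA.
  by apply/seteqP; split => x; [case|move=> [[]]].
have nuE j : (nu (E j) <= (B * (Kc / q ^+ 3))%:E)%E.
  apply: le_trans (nuH _ (mE j)) _; rewrite EFinM lee_wpmul2l ?lee_fin//.
    apply: le_trans (slab q ((- Mn%:R + j.1.2%:R) / (h2 * (2 * pi))) ((- Mn%:R + j.2%:R) / (h2 * (2 * pi))) q1).
    apply: (le_outer_measure (hausdorff2_outer R)) => x [[[_ b2 b3] Gx] _]; split => //.
    have w (y t : R) : y <= h2 * (2 * pi * t) <= y + 1 ->
        y / (h2 * (2 * pi)) <= t <= y / (h2 * (2 * pi)) + (q ^+ 2)^-1.
      have hp : 0 < h2 * (2 * pi) by exact: mulr_gt0.
      rewrite mulrA => /andP[y1 y2]; apply/andP; split; first by rewrite ler_pdivrMr// mulrC.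
      apply: (@le_trans _ _ ((y + 1) / (h2 * (2 * pi)))); first by rewrite ler_pdivlMr// mulrC.
      rewrite mulrDl lerD2l mul1r lef_pV2 ?posrE ?exprn_gt0//.
      apply: (@le_trans _ _ (q ^+ 2 * 1)); first by rewrite mulr1.
      rewrite /h2 -mulrA [q ^+ 2 * _ in leRHS]mulrC mulrA mulrC ler_wpM2r ?sqr_ge0//.
      by rewrite -[leLHS]mulr1; exact: (ler_pM ler01 ler01 k2 p1).
    by split; apply: w.
pose F x : \bar R := (cabs (ctrans 1 g x) ^+ 2)%:E.
have cg : cintegrable g by apply: (cintegrable_ball cmg eg (ctr := ctr) (rho := ka * q ^+ 2)) => u /sg[].
have mF : measurable_fun [set: H2space R] F by exact: measurable_H2_ctrans.
have mG := measurable_H2_set measurable_graph_part.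
(* The cells are only known to cover [G], so the integral is first restricted to [G], which carries
   [nu]. *)
have nG : nu (~` G) = 0%E.
  apply/eqP; rewrite eq_le measure_ge0 andbT.
  by apply: le_trans (nuH _ (measurableC mG)) _; rewrite setICl hausdorff20 mule0.
apply: (@le_trans _ _ (integral nu setT (F \_ G))).
  rewrite le_eqVlt; apply/orP; left; apply/eqP; transitivity (integral nu setT F) => //.
  rewrite (@ge0_negligible_integral _ _ _ nu setT (~` G) F (measurableC mG) measurableT mF _ nG).
    by rewrite setTD setCK integral_mkcond.
  by move=> x _; rewrite lee_fin sqr_ge0.
apply: (@le_trans _ _ (\sum_j (S j)%:E * nu (E j))%E).
  apply: (@integral_step_le _ (H2space R) R nu _ (F \_ G) E S mE S0).
  - by move=> x; rewrite patchE; case: ifP => // _; rewrite lee_fin sqr_ge0.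
  - move=> x; rewrite sumEFin patchE; case: ifPn => [/set_mem Gx|_]; last first.
      by rewrite lee_fin; apply: sumr_ge0 => j _; rewrite mulr_ge0.
    have [b1 b2 b3] := ab x Gx.
    have w (h a : R) : 0 < h -> h <= h1 + h2 -> `|a| <= Kc ->
        exists i : 'I_(2 * Mn).+1, - Mn%:R + i%:R <= h * (2 * pi * a) <= - Mn%:R + i%:R + 1.
      move=> h0 hh aK; apply: truncn_slab; apply: le_trans Mnt.
      rewrite normrM (gtr0_norm h0) normrM (gtr0_norm p0) /t0.
      apply: ler_pM => //; [exact: ltW|by rewrite mulr_ge0// ltW|].
      by rewrite ler_pM2l.
    have [i1 e1] := w _ _ h10 ltac:(by rewrite lerDl ltW) b1.
    have [i2 e2] := w _ _ h20 ltac:(by rewrite lerDr ltW) b2.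
    have [i3 e3] := w _ _ h20 ltac:(by rewrite lerDr ltW) b3.
    have cx : cell (i1, i2, i3) x by [].
    rewrite lee_fin; apply: le_trans (SF _ _ cx) _.
    rewrite (bigD1 (i1, i2, i3))//= indicE mem_set// mulr1 lerDl.
    by apply: sumr_ge0 => j _; rewrite mulr_ge0.
apply: (@le_trans _ _ (\sum_j (S j)%:E * (B * (Kc / q ^+ 3))%:E)%E).
  by apply: lee_sum => j _; rewrite lee_wpmul2l// lee_fin.
under eq_bigr do rewrite -EFinM.
rewrite sumEFin eE -EFinM lee_fin -mulr_suml.
have b0 : 0 <= B * (Kc / q ^+ 3).
  by rewrite mulr_ge0// divr_ge0// exprn_ge0// ltW.
apply: le_trans (ler_wpM2r b0 SE) _.
rewrite mulrAC /piece_const /h1 /h2; move: (160 ^+ 3) => c.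
rewrite le_eqVlt; apply/orP; left; apply/eqP; congr (_ * _).
by field; rewrite gt_eqF.
Qed.

End Piece.

Section SurfaceMeasureBound.
Context {R : realType}.
Local Notation H := (hausdorff2 R).
Local Open Scope ereal_scope.

Lemma Lnorm_oo_ae_bound d (T : measurableType d) (mu : {measure set T -> \bar R}) (f : T -> R) :
  Lnorm mu +oo (fun x => (f x)%:E) < +oo ->
  exists2 B : R, (0 <= B)%R & {ae mu, forall x, (`|f x| <= B)%R}.
Proof.
rewrite Lnorm.unlock; case: ifPn => [m0|].
  move=> fin; have := ess_sup_ge mu (abse \o (fun x => (f x)%:E)).
  move: fin; case: (ess_sup _ _) => [b _|//|_] H.
    exists (Num.max 0 b)%R; first by rewrite le_max lexx.
    by apply: filterS H => x /=; rewrite lee_fin le_max => ->; rewrite orbT.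
  by exists 0%R => //; apply: filterS H => x /=; rewrite leNgt ltNyr.
(* If the whole space is null, every property holds almost everywhere. *)
rewrite -leNgt => m0 _; exists 0%R => //.
by exists setT; split => //; apply/eqP; rewrite eq_le m0 measure_ge0.
Qed.

Lemma surface_measure_le (S G : set (R3 R)) (chi : R3 R -> R)
    (mchi : measurable_fun [set: H2space R] (chi \_ S)) (chi0 : forall x, (0 <= (chi \_ S) x)%R) :
  S `<=` G -> measurable (G : set (borelR3 R)) ->
  Lnorm (H2 R) +oo (fun x => ((chi \_ S) x)%:E) < +oo ->
  exists2 B : R, (0 <= B)%R & forall A : set (H2space R), measurable A ->
    surface_measure mchi chi0 A <= B%:E * H (A `&` G).
Proof.
move=> SG mG /Lnorm_oo_ae_bound[B B0 chiB]; exists B => // A mA.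
have mG' := measurable_H2_set mG; have mAG := measurableI _ _ mA mG'.
rewrite /surface_measure /density_measure/=.
apply: (@le_trans _ _ (integral (H2 R) (A `&` G) (fun x => ((chi \_ S) x)%:E))).
  rewrite le_eqVlt; apply/orP; left; apply/eqP.
  rewrite [LHS]integral_mkcond [RHS]integral_mkcond; congr (integral _ _ _).
  apply/funext => x; rewrite [LHS]patchE [RHS]patchE in_setI; have [Gx|nG] := boolP (x \in G).
    by rewrite andbT.
  rewrite andbF; case: ifP => // _; rewrite patchE memNset// => /SG Gx.
  by move: nG; rewrite mem_set.
apply: (@le_trans _ _ (integral (H2 R) (A `&` G) (cst B%:E))).
  have F0 (x : H2space R) : (A `&` G) x -> 0 <= ((chi \_ S) x)%:E by move=> _; rewrite lee_fin.
  have mF : measurable_fun (A `&` G) (fun x : H2space R => ((chi \_ S) x)%:E).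
    by apply/measurable_EFinP; apply: measurable_funTS.
  have c0 (x : H2space R) : (A `&` G) x -> 0 <= cst (B%:E : \bar R) x by move=> _; rewrite lee_fin.
  have mc : measurable_fun (A `&` G) (cst (B%:E : \bar R) : H2space R -> \bar R) by exact: measurable_cst.
  have ae : {ae H2 R, forall x, (A `&` G) x -> ((chi \_ S) x)%:E <= cst (B%:E : \bar R) x}.
    by apply: filterS chiB => x le _; rewrite lee_fin; apply: le_trans le; exact: ler_norm.
  exact: (ae_ge0_le_integral mAG F0 mF c0 mc ae).
by rewrite integral_cst.
Qed.

Lemma bounded_graph_part (U : set (R * R)) (l1 l2 : R) : bounded_set U ->
  exists2 M : R, (1 <= M)%R & graph_over (quadratic l1 l2) U `<=` graph_part l1 l2 M.
Proof.
move=> [M0 [_ UM]]; pose M : R := (Num.max 1 (M0 + 1))%R.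
have M1 : (1 <= M)%R by rewrite le_max lexx.
exists M => // x [u Uu <-].
have uM : (`|u| <= M)%R by apply: UM => //; rewrite lt_max ltrDl ltr01 orbT.
split => //=; apply: le_trans uM; rewrite /Num.norm/= le_max lexx ?orbT//.
Qed.

End SurfaceMeasureBound.

Section UpperBound.
Context {R : realType}.
Local Notation C := (R[i]).
Local Notation H := (hausdorff2 R).
Local Notation leb3 := (lebesgue3 R).
Variables (l1 l2 M : R).
Hypotheses (l12 : 0 < l1 * l2) (M1 : 1 <= M).
Variable K : partition_constants R.
Hypothesis Kv : valid_constants K.

(** Each term is at most 1 and vanishes off the support of its cutoff. *)
Lemma overlap_sum n (psi : 'I_n -> R * R * R -> R) (N : nat) (xi : R * R * R) :
  (forall i xi, 0 <= psi i xi <= 1) ->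
  (overlap_count (fun i => tsupport (psi i)) xi <= N)%N ->
  \sum_i psi i xi ^+ 2 <= N%:R.
Proof.
move=> p01 ov; pose A := [set i : 'I_n | `[< tsupport (psi i) xi >]].
rewrite (bigID (mem A))/= [X in _ + X]big1 ?addr0; last first.
  move=> i nA; apply/eqP; rewrite sqrf_eq0; apply: contraNT nA => p0.
  by apply: mem_set; apply/asboolP; exact: subset_closure.
have AN : \sum_(i in A) (1 : R) <= N%:R by rewrite sumr_const ler_nat; exact: ov.
apply: le_trans AN.
by apply: ler_sum => i _; have /andP[p0 p1] := p01 i xi; rewrite exprn_ile1.
Qed.

Definition cut (psi : R * R * R -> R) (g : R3 R -> C) (u : R3 R) : C := ((psi u)%:C)%C * g u.

Lemma cutE psi g u : cut psi g u = ((psi u * complex.Re (g u)) +i* (psi u * complex.Im (g u)))%C.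
Proof. by rewrite /cut; case: (g u) => a b /=; congr (_ +i* _)%C; ring. Qed.

Lemma cabs_cut psi g u : cabs (cut psi g u) ^+ 2 = psi u ^+ 2 * cabs (g u) ^+ 2.
Proof. by rewrite cutE !cabs_sqr/=; ring. Qed.

Lemma localizeE psi g : localize psi g = ctrans 1 (cut psi g).
Proof.
by apply/funext => x; rewrite /localize /ctrans; congr cintegral; apply/funext => u; rewrite mul1r.
Qed.

Lemma cmeasurable_cut psi g : continuous psi -> cmeasurable g -> cmeasurable (cut psi g).
Proof.
move=> /continuous_measurable_R3 mp [mr mi].
by split; [rewrite (_ : (fun x => _) = fun x => psi x * complex.Re (g x))|
  rewrite (_ : (fun x => _) = fun x => psi x * complex.Im (g x))];
  try (by apply/funext => u; rewrite cutE); apply: measurable_funM.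
Qed.

Lemma energy_cut_le psi g : (forall xi, 0 <= psi xi <= 1) -> (energy (cut psi g) <= energy g)%E.
Proof.
move=> p01; apply: ge0_integral_mono => u; rewrite lee_fin ?sqr_ge0// cabs_cut.
by rewrite ler_piMl ?sqr_ge0//; have /andP[? ?] := p01 u; rewrite exprn_ile1.
Qed.

Lemma sum_energy_cut_le n (psi : 'I_n -> R * R * R -> R) (N : nat) (g : R3 R -> C) :
  (forall i, continuous (psi i)) -> (forall i xi, 0 <= psi i xi <= 1) ->
  (forall xi, (overlap_count (fun i => tsupport (psi i)) xi <= N)%N) -> cmeasurable g ->
  (\sum_i energy (cut (psi i) g) <= N%:R%:E * energy g)%E.
Proof.
move=> pc p01 ov mg.
have mE i := measurable_cabs_sqr (cmeasurable_cut (pc i) mg).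
rewrite /energy -(ge0_integral_sum leb3 measurableT (fun i => mE i)); last first.
  by move=> i x _; rewrite lee_fin sqr_ge0.
rewrite -ge0_integralZl//; last first.
- by move=> x _; rewrite lee_fin sqr_ge0.
- exact: measurable_cabs_sqr.
apply: ge0_integral_mono => u; first by rewrite sumEFin lee_fin; apply: sumr_ge0 => i _; exact: sqr_ge0.
rewrite sumEFin -EFinM lee_fin; under eq_bigr do rewrite cabs_cut.
by rewrite -mulr_suml ler_wpM2r ?sqr_ge0// overlap_sum.
Qed.

Lemma powR_eighth (r : R) : 0 <= r -> (r `^ 8^-1) ^+ 2 = Num.sqrt (Num.sqrt r).
Proof.
move=> r0.
have sqp (b : R) : (r `^ b) ^+ 2 = r `^ (b * 2).
  by rewrite powRrM -(powR_mulrn 2 (powR_ge0 r b)).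
have q4 : (r `^ 4^-1) ^+ 2 = Num.sqrt r.
  by rewrite sqp -powR12_sqrt//; congr (_ `^ _); field.
by rewrite -q4 sqrtr_sqr ger0_norm ?powR_ge0// sqp; congr (_ `^ _); field.
Qed.

Lemma square_function_upper (nu : {measure set (H2space R) -> \bar R}) (B : R) : 0 <= B ->
  (forall A : set (H2space R), measurable A -> (nu A <= B%:E * H (A `&` graph_part l1 l2 M))%E) ->
  exists2 D : R, 0 < D & forall (r : R) (P : freq_partition R), 1 <= r -> is_freq_partition K r P ->
    forall f fhat : R3 R -> C, inL2 f -> is_fourier f fhat ->
    (Lnorm nu 2%:E (fun x => (square_function P fhat x)%:E) <= (D * r `^ 8^-1)%:E * L2norm f)%E.
Proof.
move=> B0 nuH; pose ka := box_scale K.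
have ka1 : 1 <= ka by exact: box_scale_ge1.
have pc0 : 0 <= piece_const l1 l2 M ka.
  have := adapted_const_ge0 l1 l2 M1; rewrite /piece_const; move: (adapted_const _ _ _) => k k0.
  have k30 : 0 <= ka ^+ 3 by apply: exprn_ge0; lra.
  have c0 : 0 <= 160 ^+ 3 :> R := exprn_ge0 3 (ler0n R 160).
  move: (160 ^+ 3) (ka ^+ 3) c0 k30 => c d c0 d0.
  have e : 0 <= c * ((k + 1) * k) * d by rewrite mulr_ge0 ?mulr_ge0 ?addr_ge0.
  by lra.
pose T := B * piece_const l1 l2 M ka * (overlap K)%:R * (2 * @plancherel_const R).
have T0 : 0 <= T.
  apply: mulr_ge0; first by rewrite mulr_ge0// mulr_ge0.
  by rewrite mulr_ge0// ltW// plancherel_const_gt0.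
(* [T] is a constant for the squared norms; T + 1 dominates its square root and is positive even if
   [T] is 0. *)
have TT : T <= (T + 1) ^+ 2 by rewrite sqrrD mulr1 expr1n; have := sqr_ge0 T; lra.
exists (T + 1); first by rewrite ltr_wpDl.
move=> r P r1 [boxP _ _ [_ _ ov cutP _]] f fhat f2 ff.
have [fhat2 _] := ff; have [mfh efh] := (inL2P fhat).1 fhat2.
have r0 : 0 <= r by lra.
(* The tangential size of the box is q^2, and [q] is the square of r^(1/8). *)
pose q := Num.sqrt (Num.sqrt r).
have sq1 : 1 <= Num.sqrt r by rewrite -(sqrtr1 R) ler_wsqrtr.
have q1 : 1 <= q by rewrite -(sqrtr1 R) ler_wsqrtr.
have q2 : q ^+ 2 = Num.sqrt r by rewrite sqr_sqrtr// sqrtr_ge0.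
have psic i : continuous (cutoff P i).
  by have [sm _ _ _ _] := cutP i; have [] := sm [::] ltac:(by []).
have p01 i xi : 0 <= cutoff P i xi <= 1 by have [_ _ h _ _] := cutP i; exact: h.
have mg i := cmeasurable_cut (psic i) mfh.
have eg i : (energy (cut (cutoff P i) fhat) < +oo)%E := le_lt_trans (energy_cut_le fhat (p01 i)) efh.
have sg i (u : R * R * R) : cut (cutoff P i) fhat u != 0 ->
    `|dot (u - box_center r (part_box P i)) (axis3 (part_box P i))| <= ka /\
    enorm (u - box_center r (part_box P i)) <= ka * Num.sqrt r.
  move=> gu; apply: dilated_box_bounds => //.
  have [_ [_ sub] _ _ _] := cutP i; apply: sub; apply: subset_closure => /=.
  by apply: contraNneq gu => p0; rewrite /cut p0 mul0r.
have cg i : cintegrable (cut (cutoff P i) fhat).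
  by apply: cintegrable_ball (mg i) (eg i) _ => u /sg[_]; exact.
have est i : (\int[nu]_x (cabs (ctrans 1 (cut (cutoff P i) fhat) x) ^+ 2)%:E <=
    (B * piece_const l1 l2 M ka * q)%:E * energy (cut (cutoff P i) fhat))%E.
  have [[_ _ d33 _] _ _ _] := boxP i.
  apply: (@piece_estimate _ _ _ _ l12 M1 nu B ka q _ (box_center r (part_box P i)) _ B0 nuH ka1 q1 d33) => //.
  by move=> u gu; rewrite q2; exact: (sg i u gu).
rewrite Lnorm2E L2normE; apply: poweR_half_le.
- by apply: mulr_ge0; [exact: addr_ge0|exact: powR_ge0].
- by apply: integral_ge0 => x _; rewrite lee_fin sqr_ge0.
- exact: energy_ge0.
rewrite exprMn powR_eighth// -/q.
apply: (@le_trans _ _ (\sum_i integral nu setT (fun x => (cabs (ctrans 1 (cut (cutoff P i) fhat) x) ^+ 2)%:E))%E).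
  have F0 i (x : H2space R) : [set: H2space R] x -> (0 <= (cabs (ctrans 1 (cut (cutoff P i) fhat) x) ^+ 2)%:E)%E.
    by move=> _; rewrite lee_fin sqr_ge0.
  have := ge0_integral_sum nu measurableT (fun i => measurable_H2_ctrans 1 (cg i)) F0 (index_enum _).
  move=> <-; rewrite le_eqVlt; apply/orP; left; apply/eqP.
  apply: eq_integral => x _; rewrite sumEFin /square_function sqr_sqrtr.
    by congr EFin; apply: eq_bigr => i _; rewrite localizeE.
  by apply: sumr_ge0 => i _; exact: sqr_ge0.
apply: le_trans (lee_sum _ (fun i _ => est i)) _.
rewrite -ge0_sume_distrr; last by move=> i _; exact: energy_ge0.
have bq : 0 <= B * piece_const l1 l2 M ka * q by exact: (mulr_ge0 (mulr_ge0 B0 pc0) (sqrtr_ge0 _)).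
apply: (@le_trans _ _ ((B * piece_const l1 l2 M ka * q)%:E *
  ((overlap K)%:R%:E * ((2 * @plancherel_const R)%:E * energy f)))%E).
  apply: lee_wpmul2l; first by rewrite lee_fin.
  apply: le_trans (sum_energy_cut_le psic p01 ov mfh) _.
  apply: lee_wpmul2l; first by rewrite lee_fin.
  exact: energy_fourier_le.
rewrite !muleA -!EFinM; apply: lee_wpmul2r; first exact: energy_ge0.
rewrite lee_fin (_ : _ * _ * _ * _ = T * q); last first.
  by rewrite /T; move: (piece_const _ _ _ _) (plancherel_const) => x y; ring.
by apply: ler_wpM2r; [exact: sqrtr_ge0|exact: TT].
Qed.

End UpperBound.

(** * The lower bound *)

Section WavePackets.
Context {R : realType}.
Local Notation C := (R[i]).
Local Notation leb3 := (lebesgue3 R).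

Lemma fourier_pair_const (p P : R -> R) (a : R) : 0 <= a -> fourier_pair p P ->
  fourier_pair (fun t => a * p t) (fun w => a * P w).
Proof.
move=> a0 [mp p0 pN pE]; split => [|t|t|w].
- exact: measurable_funM.
- exact: mulr_ge0.
- by rewrite pN.
- under eq_integral do rewrite -mulrA EFinM.
  rewrite ge0_integralZl//; first by rewrite pE -EFinM mulrDr.
  + by apply/measurable_EFinP; apply: measurable_funM => //; apply: measurable_funD => //;
      under eq_fun do rewrite -[_ * _]addr0; exact: measurable_cos_affine.
  + by move=> t _; rewrite lee_fin mulr_ge0//; have := cos_geN1 (w * t); lra.
Qed.

Lemma expiD (a b : R) : expi (a + b) = expi a * expi b :> C.
Proof.
rewrite /expi mulrDr cosD sinD; apply/eqP; rewrite eq_complex /= eqxx/=.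
by apply/eqP; ring.
Qed.

Lemma Re_scale (a : R) (z : C) : complex.Re (a%:C%C * z) = a * complex.Re z.
Proof. by rewrite Re_mul /= mul0r subr0. Qed.

Lemma Im_scale (a : R) (z : C) : complex.Im (a%:C%C * z) = a * complex.Im z.
Proof. by rewrite Im_mul /= mul0r addr0. Qed.

Lemma cabs_scale_expi (a k : R) : cabs (a%:C%C * expi k) ^+ 2 = a ^+ 2.
Proof.
rewrite cabs_sqr Re_scale Im_scale !exprMn -mulrDr -[RHS]mulr1; congr (_ * _).
exact: cos2Dsin2.
Qed.

Lemma sin_cos_shift (t : R) : sin t = cos (t - pi / 2).
Proof. by rewrite cosBpihalf. Qed.

Variables (c1 c2 c3 : R3 R -> R) (p1 p2 p3 P1 P2 P3 : R -> R).
Hypothesis sh : sheared c1 c2 c3.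
Hypotheses (pP1 : fourier_pair p1 P1) (pP2 : fourier_pair p2 P2) (pP3 : fourier_pair p3 P3).

Definition packet (phi : R3 R -> R) (v : R3 R) : C :=
  (p1 (c1 v) * p2 (c2 v) * p3 (c3 v))%:C%C * expi (phi v).

Lemma packet_expi (phi : R3 R -> R) (v : R3 R) (b : R) : packet phi v * expi b =
  (p1 (c1 v) * p2 (c2 v) * p3 (c3 v))%:C%C * expi (phi v + b).
Proof. by rewrite /packet -[LHS]mulrA -expiD. Qed.

(** Once all phases are expressed in the [c_i], the transform is again a real product of kernels
    times a phase, that is, a packet in the dual coordinates. *)
Lemma packet_transform (phi : R3 R -> R) (s : R) (x : R3 R) (w1 w2 w3 k : R) :
  (forall v, phi v + s * dot x v = w1 * c1 v + w2 * c2 v + w3 * c3 v + k) ->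
  ctrans s (packet phi) x = (P1 (2 * pi * w1) * P2 (2 * pi * w2) * P3 (2 * pi * w3))%:C%C * expi k.
Proof.
move=> phE.
have E ph := (sheared_integrable_cos (2 * pi * w1) (2 * pi * w2) (2 * pi * w3) ph sh pP1 pP2 pP3).2.
apply/eqP; rewrite eq_complex Re_scale Im_scale; apply/andP; split; apply/eqP.
  rewrite -[LHS]/(Rintegral leb3 setT (fun v => complex.Re (packet phi v * expi (s * dot x v)))).
  rewrite -[complex.Re (expi k)]/(cos (2 * pi * k)) -E; apply: eq_Rintegral => v _; rewrite packet_expi phE Re_scale.
  by congr (_ * cos _); ring.
rewrite -[LHS]/(Rintegral leb3 setT (fun v => complex.Im (packet phi v * expi (s * dot x v)))).
rewrite -[complex.Im (expi k)]/(sin (2 * pi * k)) sin_cos_shift -E; apply: eq_Rintegral => v _; rewrite packet_expi phE Im_scale /=.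
by rewrite sin_cos_shift; congr (_ * cos _); ring.
Qed.

Lemma cintegrable_packet (phi : R3 R -> R) (w1 w2 w3 k : R) :
  (forall v, phi v = w1 * c1 v + w2 * c2 v + w3 * c3 v + k) -> cintegrable (packet phi).
Proof.
move=> phE.
have E ph := (sheared_integrable_cos (2 * pi * w1) (2 * pi * w2) (2 * pi * w3) ph sh pP1 pP2 pP3).1.
split.
  have := E (2 * pi * k); congr (integrable _ _ _); apply/funext => v.
  rewrite -[RHS]/((complex.Re (packet phi v))%:E) Re_scale -[complex.Re (expi _)]/(cos (2 * pi * phi v)) phE /=.
  by congr (_ * cos _)%:E; ring.
have := E (2 * pi * k - pi / 2); congr (integrable _ _ _); apply/funext => v.
rewrite -[RHS]/((complex.Im (packet phi v))%:E) Im_scale -[complex.Im (expi _)]/(sin (2 * pi * phi v)) phE.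
rewrite sin_cos_shift /=; by congr (_ * cos _)%:E; ring.
Qed.

Lemma cabs_packet (phi : R3 R -> R) v :
  cabs (packet phi v) ^+ 2 = (p1 (c1 v) * p2 (c2 v) * p3 (c3 v)) ^+ 2.
Proof. exact: cabs_scale_expi. Qed.

Lemma energy_packet_le (phi : R3 R -> R) :
  (forall t, p1 t <= 1) -> (forall t, p2 t <= 1) -> (forall t, p3 t <= 1) ->
  (energy (packet phi) <= (P1 0 * P2 0 * P3 0)%:E)%E.
Proof.
move=> p1_1 p2_1 p3_1; have [[[_ p10 _ _] [_ p20 _ _]] [_ p30 _ _]] := (pP1, pP2, pP3).
have [iE E] := sheared_integrable_cos 0 0 0 0 sh pP1 pP2 pP3.
rewrite cos0 mulr1 in E; rewrite -E /Rintegral fineK ?(integrable_fin_num measurableT iE)//.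
apply: ge0_integral_mono => v; first by rewrite lee_fin sqr_ge0.
rewrite lee_fin cabs_packet !mul0r !addr0 cos0 mulr1 expr2 ler_piMr ?mulr_ge0//.
by rewrite mulr_ile1 ?mulr_ge0// mulr_ile1.
Qed.

End WavePackets.

(** * Wave packets concentrated on tubes *)

Section TubePackets.
Context {R : realType}.
Local Notation C := (R[i]).

(** Equal to 1, the mass of the Fejer kernel being 2 pi; positivity is what is proved of it. *)
Definition tube_const : R := @sinc2_mass R / (2 * pi).

Lemma tube_const_gt0 : 0 < tube_const.
Proof. by rewrite divr_gt0 ?sinc2_mass_gt0// mulr_gt0// pi_gt0. Qed.

(** [f] is a product of Fejer kernels in the tube coordinates and [fhat] a product of triangles in
    the dual shear; [sinc2_pair] gives the transform in one direction and [tri_pair] in the other.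
    The amplitude of [f] is at most 1, so its energy is at most the integral of the amplitude. *)
Lemma exists_tube_packet (ctr x0 : R * R * R) (b a h1 h2 h3 : R) : 0 < h1 -> 0 < h2 -> 0 < h3 ->
  exists f fhat : R3 R -> C,
  [/\ inL2 f /\ is_fourier f fhat,
      (energy f <= (tube_const ^+ 3 / (h1 * h2 * h3))%:E)%E,
      forall xi : R * R * R, fhat xi != 0 ->
        [/\ `|(xi - ctr).1.1 + b * (xi - ctr).1.2 + a * (xi - ctr).2| <= h1,
            `|(xi - ctr).1.2| <= h2 & `|(xi - ctr).2| <= h3] &
      forall x : R * R * R, cabs (ctrans 1 fhat x) ^+ 2 = (tube_const ^+ 3 *
        (sinc2 (2 * pi * h1 * (x - x0).1.1) *
         sinc2 (2 * pi * h2 * ((x - x0).1.2 - b * (x - x0).1.1)) *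
         sinc2 (2 * pi * h3 * ((x - x0).2 - a * (x - x0).1.1)))) ^+ 2].
Proof.
move=> h10 h20 h30; pose p2 : R := 2 * pi.
have p20 : 0 < p2 by rewrite mulr_gt0// pi_gt0.
have pn : pi != 0 :> R by rewrite gt_eqF// pi_gt0.
have mass0 := @sinc2_mass_gt0 R.
(* The width of the Fejer kernel whose transform is a triangle of half width [h], with the 2 pi of
   the normalization. *)
pose H (h : R) := (p2 * h)^-1.
have H0 (h : R) : 0 < h -> 0 < H h by move=> h0; rewrite invr_gt0 mulr_gt0.
have pS (h : R) (h0 : 0 < h) := fourier_pair_scale (@sinc2_pair R) (H0 _ h0).
pose Q (h t : R) := H h * sinc2_mass * tri (t / h).
have HM (h : R) : 0 < h -> 0 <= H h * sinc2_mass by move=> h0; rewrite mulr_ge0 ?ltW// H0.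
have pQ (h : R) (h0 : 0 < h) := fourier_pair_const (HM _ h0) (fourier_pair_scale (@tri_pair R) h0).
pose Y1 (x : R3 R) := x.1.1 + - x0.1.1.
pose Y2 (x : R3 R) := x.1.2 + (- b * x.1.1 + (b * x0.1.1 - x0.1.2)).
pose Y3 (x : R3 R) := x.2 + (- a * x.1.1 + (a * x0.1.1 - x0.2)).
have shY : sheared Y3 Y2 Y1.
  apply: (@sheared_xyz _ (fun _ z => - a * z + (a * x0.1.1 - x0.2))
    (fun z => - b * z + (b * x0.1.1 - x0.1.2)) (- x0.1.1)) => //.
  - by apply: (@measurable_affine3E _ _ (a * x0.1.1 - x0.2) (- a) 0 1) => u; rewrite /Y3; ring.
  - by apply: (@measurable_affine3E _ _ (b * x0.1.1 - x0.1.2) (- b) 1 0) => u; rewrite /Y2; ring.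
  - by apply: (@measurable_affine3E _ _ (- x0.1.1) 1 0 0) => u; rewrite /Y1; ring.
pose e1 (u : R3 R) := u.1.1 + (b * u.1.2 + a * u.2 - (ctr.1.1 + b * ctr.1.2 + a * ctr.2)).
pose e2 (u : R3 R) := u.1.2 + - ctr.1.2.
pose e3 (u : R3 R) := u.2 + - ctr.2.
have she : sheared e1 e2 e3.
  apply: (@sheared_zyx _ (fun y z => b * y + a * z - (ctr.1.1 + b * ctr.1.2 + a * ctr.2))
    (fun=> - ctr.1.2) (- ctr.2)) => //.
  - by apply: (@measurable_affine3E _ _ (- (ctr.1.1 + b * ctr.1.2 + a * ctr.2)) 1 b a) => u; rewrite /e1; ring.
  - by apply: (@measurable_affine3E _ _ (- ctr.1.2) 0 1 0) => u; rewrite /e2; ring.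
  - by apply: (@measurable_affine3E _ _ (- ctr.2) 0 0 1) => u; rewrite /e3; ring.
pose phi (x : R3 R) := dot x ctr - dot x0 ctr.
pose f := packet Y3 Y2 Y1 (fun t => sinc2 (t / H h3)) (fun t => sinc2 (t / H h2))
  (fun t => sinc2 (t / H h1)) phi.
pose fhat := packet e1 e2 e3 (Q h1) (Q h2) (Q h3) (fun xi => - dot x0 xi).
have fhatE : ctrans (-1) f = fhat.
  apply/funext => xi.
  rewrite (packet_transform shY (pS _ h30) (pS _ h20) (pS _ h10)
    (w1 := - e3 xi) (w2 := - e2 xi) (w3 := - e1 xi) (k := - dot x0 xi)); last first.
    by move=> v; rewrite /phi /dot /Y1 /Y2 /Y3 /e1 /e2 /e3; ring.
  rewrite /fhat /packet; congr (_%:C%C * _).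
  have QE (h t : R) : 0 < h -> H h * (sinc2_mass * tri (H h * (2 * pi * - t))) = Q h t.
    move=> h0; rewrite /Q -(triN (t / h)) mulrA; congr (_ * tri _).
    by rewrite /H /p2; move: (pi : R) pn => p pN; field; rewrite ?pN ?gt_eqF.
  by rewrite !QE//; ring.
have cf : cintegrable f.
  apply: (cintegrable_packet shY (pS _ h30) (pS _ h20) (pS _ h10)
    (w1 := ctr.2) (w2 := ctr.1.2) (w3 := ctr.1.1 + b * ctr.1.2 + a * ctr.2) (k := 0)).
  by move=> v; rewrite /phi /dot /Y1 /Y2 /Y3; ring.
have ef : (energy f <= (tube_const ^+ 3 / (h1 * h2 * h3))%:E)%E.
  apply: le_trans (energy_packet_le shY (pS _ h30) (pS _ h20) (pS _ h10) phi _ _ _) _;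
    try by move=> t; exact: sinc2_le1.
  rewrite lee_fin !mulr0 (_ : tri 0 = 1); last by rewrite /tri normr0 subr0; apply/max_idPr.
  rewrite le_eqVlt; apply/orP; left; apply/eqP; rewrite /tube_const /H /p2; move: (pi : R) pn => p pN; field.
  by rewrite ?pN ?gt_eqF.
exists f, fhat; split => //.
- have ef' := le_lt_trans ef (ltry _); split; last by rewrite -fhatE; exact: is_fourier_ctrans.
  by apply/inL2P; split => //; exact: cintegrable_cmeasurable.
- move=> xi fxi.
  have Q0 (h t : R) : 0 < h -> Q h t != 0 -> `|t| <= h.
    move=> h0; apply: contraNT; rewrite -ltNge => ht; rewrite /Q tri_eq0 ?mulr0//.
    by rewrite normrM normfV (gtr0_norm h0) ler_pdivlMr// mul1r ltW.
  have : Q h1 (e1 xi) * Q h2 (e2 xi) * Q h3 (e3 xi) != 0.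
    by apply: contraNneq fxi => q0; rewrite /fhat /packet q0 mul0r.
  rewrite mulf_eq0 negb_or => /andP[+ q3]; rewrite mulf_eq0 negb_or => /andP[q1 q2].
  split; [|exact: (Q0 _ _ h20 q2)|exact: (Q0 _ _ h30 q3)].
  by have := Q0 _ _ h10 q1; rewrite /e1 /=; congr (`|_| <= _); ring.
- move=> x.
  rewrite (packet_transform she (pQ _ h10) (pQ _ h20) (pQ _ h30)
    (w1 := Y1 x) (w2 := Y2 x) (w3 := Y3 x) (k := dot x ctr - dot x0 ctr)); last first.
    by move=> v; rewrite /dot /Y1 /Y2 /Y3 /e1 /e2 /e3; ring.
  rewrite cabs_scale_expi; congr (_ ^+ 2).
  have HE (h t u : R) : 0 < h -> t = u -> H h * sinc2_mass * (h * sinc2 (h * (2 * pi * t))) =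
      tube_const * sinc2 (2 * pi * h * u).
    move=> h0 ->; rewrite [h * (2 * pi * u)](_ : _ = 2 * pi * h * u); last by ring.
    by rewrite /H /tube_const /p2; move: (pi : R) pn => p pN; field; rewrite ?pN ?gt_eqF.
  rewrite (HE h1 _ (x - x0).1.1 h10)// (HE h2 _ ((x - x0).1.2 - b * (x - x0).1.1) h20)//;
    last by rewrite /Y2 /=; ring.
  rewrite (HE h3 _ ((x - x0).2 - a * (x - x0).1.1) h30)//; last by rewrite /Y3 /=; ring.
  by ring.
Qed.

End TubePackets.

(** * Caps, plateaus and supports of a box *)

Section PlateauGeometry.
Context {R : realType}.
Local Notation C := (R[i]).
Variables (K : partition_constants R) (r : R) (b : box R).
Hypotheses (Kv : valid_constants K) (r1 : 1 <= r) (bP : is_box K r b).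

(** By Lagrange's identity for the cross product. *)
Lemma dot_cauchy (x y : R3 R) : `|dot x y| <= enorm x * enorm y.
Proof.
rewrite -ler_sqr ?nnegrE ?mulr_ge0 ?enorm_ge0// real_normK ?num_real// exprMn !enorm_sqr.
rewrite -subr_ge0 (_ : _ - _ = (x.1.1 * y.1.2 - x.1.2 * y.1.1) ^+ 2 +
  (x.1.1 * y.2 - x.2 * y.1.1) ^+ 2 + (x.1.2 * y.2 - x.2 * y.1.2) ^+ 2).
  by rewrite !addr_ge0 ?sqr_ge0.
by rewrite /dot; ring.
Qed.

Let k1 : 1 <= comparability K. Proof. by case: Kv. Qed.
Let sq1 : 1 <= Num.sqrt r. Proof. by rewrite -(sqrtr1 R) ler_wsqrtr. Qed.
Let r0 : 0 < r. Proof. exact: lt_le_trans r1. Qed.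

(** The chord is at most the angle: |w - a|^2 = 2 - 2 cos th <= th^2, and the angle is at most the
    aperture. *)
Lemma cap_direction (w : R * R * R) : dot w w = 1 -> cap r b (r *: w) ->
  enorm (w - axis3 b) <= comparability K / Num.sqrt r.
Proof.
move=> w1 [_ capw]; have [[_ _ d33 _] [_ _ /andP[_ ap]] _ _] := bP.
have wa : dot (r *: w) (axis3 b) / r = dot w (axis3 b) by rewrite dotZl mulrAC divff ?mul1r// gt_eqF.
rewrite wa in capw.
have c1 : `|dot w (axis3 b)| <= 1.
  by apply: le_trans (dot_cauchy _ _) _; rewrite /enorm w1 d33 sqrtr1 mulr1.
have cI : -1 <= dot w (axis3 b) <= 1 by rewrite -ler_norml.
set th := acos _ in capw.
have th0 : 0 <= th by exact: acos_ge0.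
have thE : cos th = dot w (axis3 b) by rewrite acosK// in_itv/=.
have th1 : th <= comparability K / Num.sqrt r by exact: le_trans capw ap.
apply: le_trans th1; rewrite -ler_sqr ?nnegrE ?enorm_ge0// enorm_sqr.
have -> : dot (w - axis3 b) (w - axis3 b) = 2 - 2 * cos th.
  have e (u v : R * R * R) : dot (u - v) (u - v) = dot u u + dot v v - 2 * dot u v by rewrite /dot /=; ring.
  by rewrite e w1 d33 thE; ring.
by have := cos_ge th; lra.
Qed.

(** A displacement of radial part at most [c] and length at most e sqrt r changes the norm by at
    most c + e^2; the second term is due to the curvature of the sphere. *)
Lemma curved_box_near (xi : R * R * R) (c e : R) :
  c <= plateau K / 2 -> 0 <= e -> e <= plateau K / comparability K -> e ^+ 2 <= plateau K / 2 ->
  `|dot (xi - box_center r b) (axis3 b)| <= c -> enorm (xi - box_center r b) <= e * Num.sqrt r ->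
  curved_box r b (plateau K) xi.
Proof.
move=> cp e0 ek e2 zc ze; set z := xi - box_center r b in zc ze.
have [_ _ /andP[pl0 pl1]] := Kv; have [oF [/andP[s1 _] /andP[s2 _] _] _ _] := bP.
have [d11 d22 d33 [d12 d13 d23]] := oF.
have xiE : xi = z + r *: axis3 b by rewrite /z subrK.
have x1 : dot xi (axis1 b) = dot z (axis1 b) by rewrite xiE dotDl dotZl [dot (axis3 b) _]dotC d13 mulr0 addr0.
have x2 : dot xi (axis2 b) = dot z (axis2 b) by rewrite xiE dotDl dotZl [dot (axis3 b) _]dotC d23 mulr0 addr0.
have x3 : dot xi (axis3 b) = dot z (axis3 b) + r by rewrite xiE dotDl dotZl d33 mulr1.
have kp : 0 < comparability K by apply: lt_le_trans k1.
have tang (v : R * R * R) s : dot v v = 1 -> (comparability K)^-1 * Num.sqrt r <= s ->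
    `|dot z v| <= plateau K * s.
  move=> v1 sv; apply: le_trans (dot_cauchy _ _) _; rewrite [enorm v]/enorm v1 sqrtr1 mulr1.
  apply: (le_trans ze); apply: (@le_trans _ _ (plateau K * ((comparability K)^-1 * Num.sqrt r))).
    by rewrite mulrA ler_wpM2r// sqrtr_ge0.
  by rewrite ler_pM2l.
have pars := frame_parseval xi oF; have parz := frame_parseval z oF.
rewrite -enorm_sqr x1 x2 in pars; rewrite -enorm_sqr in parz.
have ze2 : enorm z ^+ 2 <= e ^+ 2 * r.
  by rewrite -[X in _ * X](sqr_sqrtr (ltW r0)) -exprMn ler_sqr ?nnegrE ?enorm_ge0// mulr_ge0// sqrtr_ge0.
move: zc; rewrite ler_norml => /andP[zc1 zc2].
have n0 := enorm_ge0 xi.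
set t := dot xi (axis3 b) in x3 pars *; set A := dot z (axis1 b) in pars parz *.
set B := dot z (axis2 b) in pars parz *; set D := dot z (axis3 b) in x3 parz zc1 zc2 *.
have A0 := sqr_ge0 A; have B0 := sqr_ge0 B; have D0 := sqr_ge0 D; have E0 := sqr_ge0 e.
have r1' := r1; have t0 : 0 <= t by lra.
have tn : t <= enorm xi.
  rewrite -ler_sqr ?nnegrE// pars.
  by rewrite lerDr addr_ge0.
have up : enorm xi <= r + c + e ^+ 2.
  have c0 : 0 <= c by lra.
  have p : 0 <= r + c by rewrite addr_ge0// ltW.
  have p2 : 0 <= r + c + e ^+ 2 by exact: addr_ge0.
  rewrite -ler_sqr ?nnegrE// pars.
  have tt : t ^+ 2 <= (r + c) ^+ 2 by rewrite ler_sqr ?nnegrE//; lra.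
  have ee : e ^+ 2 * r <= e ^+ 2 * (r + c) by rewrite ler_wpM2l//; lra.
  rewrite [leRHS]sqrrD; have := sqr_ge0 (e ^+ 2); have := mulr_ge0 E0 p; lra.
split; [rewrite x1; exact: tang|rewrite x2; exact: tang| |by rewrite -/t; lra].
by rewrite ler_norml; apply/andP; split; lra.
Qed.

(** A point of the support is within [ep] of a point where [g] does not vanish, hence of the
    plateau, and the margin 1 - [plateau K] absorbs the displacement. The bound on the axial
    component keeps the limit in the right half-space. *)
Lemma fourier_support_box (g : R3 R -> C) :
  (forall xi : R * R * R, g xi != 0 -> curved_box r b (plateau K) xi /\ 1 <= dot xi (axis3 b)) ->
  fourier_support g `<=` box_set r b.
Proof.
move=> gs x suppx; have [_ _ /andP[pl0 pl1]] := Kv.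
have [[d11 d22 d33 _] [/andP[s1 _] /andP[s2 _] _] _ _] := bP.
have kp : 0 < comparability K by apply: lt_le_trans k1.
(* The 3 passes from the sup norm of the topology to the Euclidean norm. *)
pose ep := (1 - plateau K) / (3 * comparability K).
have ep0 : 0 < ep by rewrite divr_gt0 ?subr_gt0// mulr_gt0.
have epE : 3 * ep = (1 - plateau K) / comparability K by rewrite /ep; field; rewrite gt_eqF.
have ep1 : 3 * ep <= 1 - plateau K by rewrite epE ler_pdivrMr// ler_peMr//; lra.
have [y xy gy] : exists2 y : R * R * R, ball (x : R * R * R) ep y & g y != 0.
  apply: contrapT => no; apply: (suppx (ball (x : R * R * R) ep)); first exact: nbhsx_ballx.
  rewrite (_ : _ `&` _ = set0); first exact: negligible_set0.
  by apply/seteqP; split => // y [xy gy]; apply: no; exists y.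
have [[y1 y2 y3 y4] y5] := gs y gy.
have D : enorm (x - y : R * R * R) <= 3 * ep.
  move: xy => [[/= b1 b2] b3]; apply: le_trans (enorm_le_coord _) _ => /=.
  have -> : 3 * ep = ep + ep + ep by ring.
  by do 2 (apply: lerD; last exact: ltW); exact: ltW.
have close (v : R * R * R) : dot v v = 1 -> `|dot x v - dot y v| <= 3 * ep.
  move=> v1; rewrite -dotBl; apply: le_trans (dot_cauchy _ _) _.
  by rewrite [enorm v]/enorm v1 sqrtr1 mulr1.
have tang (v : R * R * R) s : dot v v = 1 -> (comparability K)^-1 * Num.sqrt r <= s ->
    `|dot y v| <= plateau K * s -> `|dot x v| <= 1 * s.
  move=> v1 sv yv; rewrite -(subrK (dot y v) (dot x v)); apply: le_trans (ler_normD _ _) _.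
  have ks : (comparability K)^-1 <= s by apply: le_trans sv; rewrite ler_peMr// invr_ge0 ltW.
  have : (1 - plateau K) * (comparability K)^-1 <= (1 - plateau K) * s.
    by rewrite ler_wpM2l// subr_ge0 ltW.
  by have := close v v1; rewrite epE; lra.
split; [exact: (tang _ _ d11 s1 y1)|exact: (tang _ _ d22 s2 y2)| |].
- have n (u v : R * R * R) : enorm u <= enorm v + enorm (u - v).
    rewrite -ler_sqr ?nnegrE ?addr_ge0 ?enorm_ge0// sqrrD !enorm_sqr.
    have -> : dot u u = dot v v + 2 * dot v (u - v) + dot (u - v) (u - v).
      by rewrite /dot /=; ring.
    have := dot_cauchy v (u - v); rewrite ler_norml => /andP[_].
    lra.
  have n1 := n x y; have n2 := n y x.
  have e : enorm (y - x : R * R * R) = enorm (x - y : R * R * R).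
    by congr Num.sqrt; rewrite /dot /=; ring.
  rewrite e in n2; move: y3; rewrite !ler_norml => /andP[? ?]; apply/andP; split; lra.
- have := close _ d33; rewrite ler_norml => /andP[? ?]; lra.
Qed.

End PlateauGeometry.

Section LowerBound.
Context {R : realType}.
Local Notation C := (R[i]).
Local Notation H := (hausdorff2 R).

Lemma surface_measure_ge (S : set (R3 R)) (chi : R3 R -> R)
    (mchi : measurable_fun [set: H2space R] (chi \_ S)) (chi0 : forall x, 0 <= (chi \_ S) x)
    (x0 : R3 R) (delta kappa : R) (E : set (R3 R)) : 0 <= kappa ->
  {ae H2 R, forall x, S x -> eucl_dist x x0 < delta -> kappa <= chi x} ->
  measurable (E : set (borelR3 R)) -> (forall x, E x -> S x /\ eucl_dist x x0 < delta) ->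
  (kappa%:E * H E <= surface_measure mchi chi0 E)%E.
Proof.
move=> k0 aek mE ES; have mE' := measurable_H2_set mE.
have F0 (x : H2space R) : E x -> (0 <= cst (kappa%:E : \bar R) x)%E by move=> _; rewrite lee_fin.
have mF : measurable_fun (E : set (H2space R)) (cst (kappa%:E : \bar R) : H2space R -> \bar R) by exact: measurable_cst.
have c0 (x : H2space R) : E x -> (0 <= ((chi \_ S) x)%:E)%E by move=> _; rewrite lee_fin.
have mc : measurable_fun (E : set (H2space R)) (fun x : H2space R => ((chi \_ S) x)%:E).
  by apply/measurable_EFinP; exact: (measurable_funTS mchi).
have ae : {ae H2 R, forall x, E x -> (cst (kappa%:E : \bar R) x <= ((chi \_ S) x)%:E)%E}.
  case: aek => N [mN N0 sub]; exists N; split => // x nx; apply: sub => le; apply: nx => Ex.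
  by have [Sx dx] := ES x Ex; rewrite lee_fin patchE mem_set//; exact: le.
have := ae_ge0_le_integral mE' F0 mF c0 mc ae; rewrite integral_cst//.
Qed.

Lemma integral_ge_const d (T : measurableType d) (nu : {measure set T -> \bar R}) (F : T -> \bar R)
    (E : set T) (c : R) : measurable E -> 0 <= c -> (forall x, (0 <= F x)%E) ->
  (forall x, E x -> (c%:E <= F x)%E) -> (c%:E * nu E <= \int[nu]_x F x)%E.
Proof.
move=> mE c0 F0 cF.
apply: (@le_trans _ _ (\int[nu]_x (c%:E * (\1_E x)%:E))%E).
  have mI : measurable_fun setT (fun x => (\1_E x)%:E : \bar R).
    by apply/measurable_EFinP; exact: measurable_indic.
  by rewrite ge0_integralZl//; rewrite integral_indic// setIT.
apply: ge0_integral_mono => x; first by rewrite mule_ge0// lee_fin.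
by rewrite indicE; have [/set_mem Ex|_] := boolP (x \in E); rewrite ?mule1 ?mule0//; exact: cF.
Qed.

Lemma sinc2_half (w : R) : `|w| <= 1 -> 2^-1 <= sinc2 w.
Proof.
move=> w1; apply: le_trans (sinc2_ge w).
have : w ^+ 2 <= 1 by rewrite -real_normK ?num_real// exprn_ile1.
lra.
Qed.

(* The slopes a, b of the radial direction of a box whose cap contains the
   tangent direction (1, 0, a0) are within O(r^-1/2) of those of (1, 0, a0). *)
Lemma tangent_slopes (a0 n0 k sq : R) (al : R * R * R) : 1 <= n0 -> 1 <= k -> dot al al = 1 ->
  2 * n0 * (1 + `|a0|) * k + 2 <= sq ->
  enorm ((n0^-1 *: (1, 0, a0) : R * R * R) - al) <= k / sq ->
  [/\ al.1.1 != 0, `|al.1.1| <= 1, `|al.1.2 / al.1.1| <= 2 * n0 * (1 + `|a0|) * k / sq &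
     `|al.2 / al.1.1 - a0| <= 2 * n0 * (1 + `|a0|) * k / sq].
Proof.
move=> n1 k1 al1 sqK dist.
have n00 : 0 < n0 by lra.
have k0 : 0 < k by lra.
have [e1 e2 e3] := enorm_coord ((n0^-1 *: (1, 0, a0) : R * R * R) - al).
have := le_trans e1 dist; have := le_trans e2 dist; have := le_trans e3 dist.
rewrite /= /GRing.scale /= mulr1 mulr0 sub0r normrN => d3 d2 d1.
have aa : 0 <= `|a0| by [].
have K0 : 2 * n0 * k <= 2 * n0 * (1 + `|a0|) * k.
  apply: (ler_wpM2r (ltW k0)); rewrite ler_peMr//; last by rewrite lerDl.
  by rewrite mulr_ge0// ltW.
have nk : 0 < 2 * n0 * k by rewrite !mulr_gt0.
have sq0 : 0 < sq by lra.
have dn : k / sq <= n0^-1 / 2.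
  by rewrite ler_pdivrMr// mulrC mulrA ler_pdivlMr// ler_pdivlMr//; lra.
have a1 : n0^-1 / 2 <= al.1.1.
  by move: d1; rewrite ler_norml => /andP[_]; lra.
have h0 : 0 < n0^-1 / 2 by rewrite divr_gt0// invr_gt0.
have a1p : 0 < al.1.1 by lra.
have inv1 : (al.1.1)^-1 <= 2 * n0.
  rewrite -[2 * n0]invrK lef_pV2 ?posrE//; last by rewrite invr_gt0 mulr_gt0.
  by rewrite invfM mulrC.
split; first by rewrite gt_eqF.
- have [c1 _ _] := enorm_coord al; apply: (le_trans c1).
  by rewrite /enorm al1 sqrtr1.
- rewrite normrM (gtr0_norm (_ : 0 < al.1.1^-1)) ?invr_gt0//.
  apply: (@le_trans _ _ (k / sq * (2 * n0))); first by rewrite ler_pM// invr_ge0 ltW.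
  rewrite (_ : k / sq * (2 * n0) = 2 * n0 * k / sq); last by ring.
  by rewrite ler_wpM2r// invr_ge0 ltW.
- have -> : al.2 / al.1.1 - a0 = (a0 * (n0^-1 - al.1.1) - (n0^-1 * a0 - al.2)) / al.1.1.
    by field; rewrite !gt_eqF.
  rewrite normrM (gtr0_norm (_ : 0 < al.1.1^-1)) ?invr_gt0//.
  apply: (@le_trans _ _ ((1 + `|a0|) * (k / sq) * (2 * n0))); last by rewrite le_eqVlt; apply/orP; left; apply/eqP; ring.
  apply: ler_pM => //; first by rewrite invr_ge0 ltW.
  apply: le_trans (ler_normB _ _) _; rewrite normrM mulrDl mul1r addrC.
  by apply: lerD => //; rewrite ler_wpM2l.
Qed.

(* On the part of the surface over a rectangle of sides q^-1, q^-2 the tube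
   coordinates, in units of the tube dimensions 1, q^-2, q^-2, stay bounded: the
   first order term in s is cancelled by the slope, and s^2 = O(q^-2). *)
Lemma tube_coordinates (l1 l2 u1 u2 c ep K' a b q s t : R) :
  1 <= q -> 0 < c -> 0 < ep <= 1 -> 0 <= K' ->
  2 * pi * c * ep * (1 + K' + `|l1| + `|l2 * u2| + `|l2|) <= 1 ->
  `|b| <= K' / q ^+ 2 -> `|a - l1 * u1| <= K' / q ^+ 2 ->
  `|s| <= ep / q -> `|t| <= ep / q ^+ 2 ->
  [/\ `|2 * pi * c * s| <= 1, `|2 * pi * (c * q ^+ 2) * (t - b * s)| <= 1 &
     `|2 * pi * (c * q ^+ 2) *
       (quadratic l1 l2 (u1 + s, u2 + t) - quadratic l1 l2 (u1, u2) - a * s)| <= 1].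
Proof.
move=> q1 c0 /andP[ep0 ep1] K0 W bK aK sE tE.
have q0 : 0 < q by lra.
have q20 : 0 < q ^+ 2 by rewrite exprn_gt0.
pose p : R := 2 * pi * c; have p0 : 0 < p by rewrite mulr_gt0// mulr_gt0// pi_gt0.
have s1 : `|s| <= ep by apply: (le_trans sE); rewrite ler_pdivrMr// ler_peMr// ltW.
have t1 : `|t| <= ep.
  by apply: (le_trans tE); rewrite ler_pdivrMr// ler_peMr ?exprn_ege1// ltW.
have qt : q ^+ 2 * `|t| <= ep by rewrite mulrC -ler_pdivlMr.
have qb (x : R) : `|x| <= K' / q ^+ 2 -> q ^+ 2 * `|x * s| <= K' * ep.
  move=> xK; rewrite normrM mulrA.
  have x0 : 0 <= q ^+ 2 * `|x| := mulr_ge0 (ltW q20) (normr_ge0 x).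
  have xK' : q ^+ 2 * `|x| <= K' by rewrite mulrC -ler_pdivlMr.
  exact: ler_pM.
have qs : q ^+ 2 * `|s ^+ 2| <= ep.
  rewrite normrX -exprMn; apply: (@le_trans _ _ (ep ^+ 2)).
    have x0 : 0 <= q * `|s| := mulr_ge0 (ltW q0) (normr_ge0 s).
    have xK' : q * `|s| <= ep by rewrite mulrC -ler_pdivlMr.
    by rewrite ler_sqr ?nnegrE// ltW.
  by rewrite expr2 ler_piMr// ltW.
have qtt : q ^+ 2 * `|t ^+ 2| <= ep.
  rewrite normrX expr2 mulrA; apply: (@le_trans _ _ (ep * 1)); last by rewrite mulr1.
  have x0 : 0 <= q ^+ 2 * `|t| := mulr_ge0 (ltW q20) (normr_ge0 t).
  exact: (ler_pM x0 (normr_ge0 t) qt (le_trans t1 ep1)).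
have n1 := normr_ge0 l1; have n2 := normr_ge0 l2; have n3 := normr_ge0 (l2 * u2).
have fin (x : R) : `|x| <= ep * (1 + K' + `|l1| + `|l2 * u2| + `|l2|) -> `|p * x| <= 1.
  move=> xe; rewrite normrM (gtr0_norm p0); apply: le_trans W.
  by rewrite -/p -mulrA ler_pM2l.
have big : 1 <= 1 + K' + `|l1| + `|l2 * u2| + `|l2| by lra.
split.
- by apply: fin; apply: (le_trans s1); rewrite ler_peMr// ltW.
- rewrite (_ : 2 * pi * (c * q ^+ 2) * (t - b * s) = p * (q ^+ 2 * (t - b * s))); last by rewrite /p; ring.
  apply: fin; rewrite normrM (gtr0_norm q20).
  apply: (@le_trans _ _ (q ^+ 2 * `|t| + q ^+ 2 * `|b * s|)); first by rewrite -mulrDr ler_pM2l// ler_normB.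
  apply: le_trans (lerD qt (qb b bK)) _.
  rewrite (_ : ep + K' * ep = ep * (1 + K')); last by ring.
  by rewrite ler_pM2l//; lra.
- rewrite (_ : 2 * pi * (c * q ^+ 2) * _ = p * (q ^+ 2 * ((l1 * u1 - a) * s + l1 / 2 * s ^+ 2 +
     l2 * u2 * t + l2 / 2 * t ^+ 2))); last by rewrite /p /quadratic /=; field.
  apply: fin; rewrite normrM (gtr0_norm q20).
  apply: (@le_trans _ _ (q ^+ 2 * `|(l1 * u1 - a) * s| + q ^+ 2 * `|l1 / 2 * s ^+ 2| +
     q ^+ 2 * `|l2 * u2 * t| + q ^+ 2 * `|l2 / 2 * t ^+ 2|)).
    rewrite -!mulrDr ler_pM2l//; apply: le_trans (ler_normD _ _) _; rewrite lerD2r.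
    by apply: le_trans (ler_normD _ _) _; rewrite lerD2r ler_normD.
  have h1 : q ^+ 2 * `|(l1 * u1 - a) * s| <= K' * ep by apply: qb; rewrite distrC.
  have half (l x : R) : q ^+ 2 * `|x| <= ep -> q ^+ 2 * `|l * x| <= `|l| * ep.
    by move=> xe; rewrite normrM mulrCA ler_wpM2l.
  have h2 := half (l1 / 2) _ qs; have h3 := half (l2 * u2) _ qt; have h4 := half (l2 / 2) _ qtt.
  have hh (l : R) : `|l / 2| * ep <= `|l| * ep.
    apply: (ler_wpM2r (ltW ep0)); rewrite normrM normfV [`|2|]ger0_norm// ler_pdivrMr//.
    by rewrite ler_peMr// ler1n.
  have k1 := hh l1; have k2 := hh l2.
  have -> : ep * (1 + K' + `|l1| + `|l2 * u2| + `|l2|) =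
    ep + K' * ep + `|l1| * ep + `|l2 * u2| * ep + `|l2| * ep by ring.
  lra.
Qed.

End LowerBound.

Section ExtremalGeometry.
Context {R : realType}.

(** All constraints bound [ep] from above; [Y] adds up lower bounds for 1 / ep that ensure them. *)
Lemma exists_small_scale (X rho delta D : R) : 0 < X -> 0 < rho -> 0 < delta -> 0 <= D ->
  exists ep : R, [/\ 0 < ep, ep <= 1, ep * X <= 1, ep < rho & (1 + D) * (ep + ep) < delta].
Proof.
move=> X0 rho0 d0 D0.
have t3 : 0 < 4 * (1 + D) / delta by rewrite divr_gt0// mulr_gt0//; lra.
have t2 : 0 < rho^-1 by rewrite invr_gt0.
pose Y := X + 1 + rho^-1 + 4 * (1 + D) / delta.
have [Y1 YX Yr Yd] : [/\ 1 <= Y, X <= Y, rho^-1 < Y & 4 * (1 + D) / delta <= Y].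
  by rewrite /Y; split; lra.
clearbody Y; have Y0 : 0 < Y by lra.
have D1 : 0 < 4 * (1 + D) by rewrite mulr_gt0//; lra.
exists Y^-1; split.
- by rewrite invr_gt0.
- by rewrite invf_le1.
- by rewrite mulrC ler_pdivrMr// mul1r.
- by rewrite -[rho]invrK ltf_pV2 ?posrE.
- have : Y^-1 * (4 * (1 + D)) <= delta.
    by rewrite mulrC ler_pdivrMr// [delta * _]mulrC -ler_pdivrMr.
  lra.
Qed.

Variables (K : partition_constants R) (r : R) (b : box R).
Hypotheses (Kv : valid_constants K) (r4 : 4 <= r) (bP : is_box K r b).

(** The sheared coordinate times the first component of the axis is the radial component of [z], so
    it controls the radial width; 5 + A bounds the length of [z] in units of c sqrt r. *)
Lemma sheared_box_plateau (A c sb sa : R) (xi : R * R * R) (z := xi - box_center r b) :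
  0 <= A -> 0 < c -> c * (5 + A) <= plateau K / (2 * comparability K) ->
  (axis3 b).1.1 != 0 -> `|(axis3 b).1.1| <= 1 ->
  sb = (axis3 b).1.2 / (axis3 b).1.1 -> sa = (axis3 b).2 / (axis3 b).1.1 ->
  `|sb| <= 1 -> `|sa| <= 1 + A ->
  `|z.1.1 + sb * z.1.2 + sa * z.2| <= c -> `|z.1.2| <= c * Num.sqrt r -> `|z.2| <= c * Num.sqrt r ->
  curved_box r b (plateau K) xi /\ 1 <= dot xi (axis3 b).
Proof.
move=> A0 c0 cA al0 al1 sbE saE sb1 sa1 z1 z2 z3.
have [k1 _ /andP[pl0 pl1]] := Kv; have [[_ _ d33 _] _ _ _] := bP.
have k0 : 0 < comparability K by exact: lt_le_trans k1.
have r_ge1 : 1 <= r by apply: le_trans r4; rewrite ler1n.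
have sq1 : 1 <= Num.sqrt r by rewrite -(sqrtr1 R) ler_wsqrtr.
have zal : `|dot z (axis3 b)| <= c.
  have -> : dot z (axis3 b) = (axis3 b).1.1 * (z.1.1 + sb * z.1.2 + sa * z.2).
    by rewrite /dot sbE saE; field.
  by rewrite normrM; apply: le_trans z1; rewrite ler_piMl.
have e2 : c * (5 + A) <= plateau K / 2.
  apply: (le_trans cA); rewrite ler_pM2l// lef_pV2 ?posrE//; last by rewrite mulr_gt0.
  by rewrite ler_peMr.
have e0 : 0 <= c * (5 + A) by apply: mulr_ge0; [exact: ltW|exact: addr_ge0].
have ce : c <= c * (5 + A).
  have N1 : 1 <= 5 + A by apply: ler_wpDr => //; rewrite ler1n.
  by rewrite ler_peMr// ltW.
have c1 : c <= 1.
  by apply: (le_trans ce); apply: (le_trans e2); rewrite ler_pdivrMr// mul1r (le_trans (ltW pl1))// ler1n.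
split; last first.
  have -> : dot xi (axis3 b) = dot z (axis3 b) + r.
    by rewrite /z dotBl /box_center dotZl d33 mulr1 subrK.
  move: zal r4; rewrite ler_norml => /andP[+ _]; lra.
apply: (curved_box_near Kv r_ge1 bP (c := c) (e := c * (5 + A))) => //.
- exact: le_trans e2.
- apply: (le_trans cA); rewrite ler_pM2l// lef_pV2 ?posrE//; last by rewrite mulr_gt0.
  by apply: ler_peMl; [exact: ltW|rewrite ler1n].
- apply: (le_trans _ e2); rewrite expr2 ler_piMr//; apply: (le_trans e2).
  by rewrite ler_pdivrMr// mul1r (le_trans (ltW pl1))// ler1n.
apply: le_trans (enorm_le_coord _) _; rewrite -/z.
have z1' : `|z.1.1| <= c + (c * Num.sqrt r + (1 + A) * (c * Num.sqrt r)).
  have -> : z.1.1 = (z.1.1 + sb * z.1.2 + sa * z.2) - (sb * z.1.2 + sa * z.2) by ring.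
  apply: le_trans (ler_normB _ _) _; apply: lerD => //; apply: le_trans (ler_normD _ _) _.
  rewrite !normrM; apply: lerD; last exact: ler_pM.
  by rewrite -[leRHS]mul1r; exact: ler_pM.
have cs : c <= c * Num.sqrt r by rewrite ler_peMr// ltW.
have -> : c * (5 + A) * Num.sqrt r = 5 * (c * Num.sqrt r) + A * (c * Num.sqrt r) by ring.
move: z2 z3 z1' cs; rewrite mulrDl mul1r; move: (c * Num.sqrt r) => y; lra.
Qed.

End ExtremalGeometry.

(** * The extremal family *)

Section ExtremalPacket.
Context {R : realType}.
Local Notation C := (R[i]).
Local Notation H := (hausdorff2 R).
Variables (U : set (R * R)) (l1 l2 : R) (chi : R3 R -> R) (K : partition_constants R).
Local Notation S := (graph_over (quadratic l1 l2) U).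
Hypotheses (mchi : measurable_fun [set: H2space R] (chi \_ S)) (chi0 : forall x, 0 <= (chi \_ S) x).
Local Notation muQ := (surface_measure mchi chi0).
Hypotheses (oU : open U) (Kv : valid_constants K).
Variable M : R.
Hypotheses (M1 : 1 <= M) (SG : S `<=` graph_part l1 l2 M).

Lemma measurable_surface_rectangle (y1 y2 t1 t2 : R) : measurable (graph_part l1 l2 M `&`
  [set x : R3 R | `|x.1.1 - y1| <= t1 /\ `|x.1.2 - y2| <= t2] : set (borelR3 R)).
Proof.
apply: measurableI; first exact: measurable_graph_part.
have slab (co : R3 R -> R) (y z : R) : measurable_fun [set: borelR3 R] co ->
    measurable ([set x | `|co x - y| <= z] : set (borelR3 R)).
  move=> mc; rewrite (_ : [set x | _] = setT `&` co @^-1` `[y - z, y + z]); first exact: mc.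
  by apply/seteqP; split => x /=; rewrite in_itv/= ler_distl; [split|case].
rewrite (_ : [set x | _] = [set x | `|x.1.1 - y1| <= t1] `&` [set x | `|x.1.2 - y2| <= t2]).
  by apply: measurableI; apply: slab; [exact: measurable_coord1|exact: measurable_coord2].
by apply/seteqP; split.
Qed.

(** The rectangle has sides 2 ep / q and 2 ep / q^2, hence area 4 ep^2 / q^3; the comparison of [H]
    with area loses a factor 8. *)
Lemma surface_rectangle_ge (u0 : R * R) (delta kappa rho ep q : R)
    (E := graph_part l1 l2 M `&`
      [set x : R3 R | `|x.1.1 - u0.1| <= ep / q /\ `|x.1.2 - u0.2| <= ep / q ^+ 2]) :
  U u0 -> 0 < kappa -> 0 < ep -> 1 <= q -> ball u0 rho `<=` U -> ep < rho ->
  (1 + (`|l1| + `|l2|) * M) * (ep + ep) < delta ->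
  {ae H2 R, forall x, S x -> eucl_dist x (u0, quadratic l1 l2 u0) < delta -> kappa <= chi x} ->
  ((kappa * (ep ^+ 2 / 2 / q ^+ 3))%:E <= muQ E)%E.
Proof.
move=> Uu0 kap0 ep0 q1 rhoU eprho epd aek.
have q0 : 0 < q by exact: lt_le_trans q1.
have q20 : 0 < q ^+ 2 by rewrite exprn_gt0.
have epq : ep / q <= ep by rewrite ler_pdivrMr// ler_peMr// ltW.
have epq2 : ep / q ^+ 2 <= ep by rewrite ler_pdivrMr// ler_peMr ?exprn_ege1// ltW.
have D1 : 0 < 1 + (`|l1| + `|l2|) * M.
  by rewrite ltr_pwDl// mulr_ge0 ?addr_ge0// (le_trans ler01).
have rect_U (u : R * R) : `|u.1 - u0.1| <= ep / q -> `|u.2 - u0.2| <= ep / q ^+ 2 -> U u.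
  move=> u1 u2; apply: rhoU; split; rewrite /ball/= distrC.
    by apply: le_lt_trans eprho; exact: le_trans epq.
  by apply: le_lt_trans eprho; exact: le_trans epq2.
have Gx0 : graph_part l1 l2 M (u0, quadratic l1 l2 u0) by apply: SG; exists u0.
have ES x : E x -> S x /\ eucl_dist x (u0, quadratic l1 l2 u0) < delta.
  move=> [Gx [x1 x2]]; split.
    exists x.1; first exact: rect_U.
    by case: Gx => <- _ _; case: (x).
  apply: le_lt_trans (graph_part_dist Gx Gx0) _; apply: le_lt_trans epd.
  rewrite /= ler_pM2l//.
  by apply: lerD; [exact: le_trans epq|exact: le_trans epq2].
have mE : measurable (E : set (borelR3 R)) by exact: measurable_surface_rectangle.
have HE : ((ep ^+ 2 / 2 / q ^+ 3)%:E <= H E)%E.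
  have l10 : 0 <= 2 * (ep / q) by rewrite mulr_ge0// divr_ge0// ltW.
  have l20 : 0 <= 2 * (ep / q ^+ 2) by rewrite mulr_ge0// divr_ge0// ltW.
  apply: le_trans (hausdorff2_ge_rectangle (X := E) (a1 := u0.1 - ep / q) (a2 := u0.2 - ep / q ^+ 2) l10 l20 _).
    rewrite lee_fin le_eqVlt; apply/orP; left; apply/eqP; field.
    by rewrite gt_eqF.
  move=> u /andP[u1 u2] /andP[v1 v2]; exists (quadratic l1 l2 u).
  have [u3 v3] : `|u.1 - u0.1| <= ep / q /\ `|u.2 - u0.2| <= ep / q ^+ 2.
    rewrite !ler_distl u1 v1 /=; move: u2 v2; move: (ep / q) (ep / q ^+ 2) => s t u2' v2'; split; lra.
  by split => //; apply: SG; exists u => //; exact: rect_U.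
apply: le_trans (surface_measure_ge mchi chi0 (ltW kap0) aek mE ES).
by rewrite EFinM lee_wpmul2l// lee_fin ltW.
Qed.

Lemma square_function_lower (x0 : R3 R) (delta kappa : R) :
  S x0 -> 0 < delta -> 0 < kappa ->
  {ae H2 R, forall x, S x -> eucl_dist x x0 < delta -> kappa <= chi x} ->
  exists2 c : R, 0 < c & exists2 r1 : R, 1 <= r1 &
  forall (r : R) (P : freq_partition R), r1 <= r -> is_freq_partition K r P ->
  exists f fhat : R3 R -> C, exists i, [/\ inL2 f, is_fourier f fhat,
    fourier_support fhat `<=` box_set r (part_box P i),
    (0 < Lnorm muQ 2%:E (fun x => (square_function P fhat x)%:E))%E &
    ((c * r `^ 8^-1)%:E * L2norm f <= Lnorm muQ 2%:E (fun x => (square_function P fhat x)%:E))%E].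
Proof.
move=> Sx0 d0 kap0 aek.
have cancel (v n d t : R) : n != 0 -> d != 0 -> t != 0 ->
    v * d ^+ 3 / n ^+ 3 * t * (n ^+ 3 / (d * (d * t ^+ 2) * (d * t ^+ 2))) = v / t ^+ 3.
  by move=> n0 d0' t0; field; rewrite n0 d0' t0.
have [u0 Uu0 x0E] : exists2 u, U u & (u, quadratic l1 l2 u) = x0 by case: Sx0 => u; exists u.
have [k1 _ /andP[pl0 pl1]] := Kv.
have k0 : 0 < comparability K by exact: lt_le_trans k1.
have : nbhs u0 U by exact: open_nbhs_nbhs.
move=> /nbhs_ballP[rho /= rho0 rhoU].
(* The vector (1, 0, a0) / n0 is a unit tangent vector at [x0]; the box will be one whose cap
   contains this direction. *)
pose a0 : R := l1 * u0.1; pose n0 : R := Num.sqrt (1 + a0 ^+ 2).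
have n02 : n0 ^+ 2 = 1 + a0 ^+ 2 by rewrite sqr_sqrtr// addr_ge0// sqr_ge0.
have n01 : 1 <= n0 by rewrite -(sqrtr1 R) ler_wsqrtr// lerDl sqr_ge0.
have n00 : 0 < n0 by exact: lt_le_trans n01.
pose K' : R := 2 * n0 * (1 + `|a0|) * comparability K.
have K'0 : 0 <= K'.
  by do 2 (apply: mulr_ge0; last by [exact: ltW|exact: addr_ge0]); exact: mulr_ge0 (ltW n00).
(* Size of the frequency support relative to the box, small enough for [sheared_box_plateau]. *)
pose c : R := plateau K / (2 * comparability K) / (5 + `|a0|).
have N0 : 0 < 5 + `|a0| by rewrite ltr_pwDl.
have c0 : 0 < c by rewrite !divr_gt0// mulr_gt0.
have cN : c * (5 + `|a0|) <= plateau K / (2 * comparability K) by rewrite divfK// gt_eqF.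
clearbody c.
pose D : R := (`|l1| + `|l2|) * M.
have D0 : 0 <= D by apply: mulr_ge0; [exact: addr_ge0|exact: le_trans M1].
pose W : R := 1 + K' + `|l1| + `|l2 * u0.2| + `|l2|.
have W0 : 0 < W by rewrite /W -!addrA ltr_pwDl// !addr_ge0.
have p0 : 0 < 2 * pi * c by rewrite !mulr_gt0// pi_gt0.
have [ep [ep0 ep1 epW eprho epd]] := exists_small_scale (mulr_gt0 p0 W0) rho0 d0 D0.
have {}epW : 2 * pi * c * ep * W <= 1 by move: epW; rewrite mulrA [ep * _]mulrC.
have m0 := @tube_const_gt0 R.
pose m := @tube_const R.
(* The packet is at least m^3 / 8 on the rectangle, its three kernels being at least 1/2 there; the
   other factor is q^3 times a lower bound for the measure of the rectangle. *)
pose V : R := (m ^+ 3 / 8) ^+ 2 * (kappa * (ep ^+ 2 / 2)).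
have V0 : 0 < V.
  by rewrite mulr_gt0 ?exprn_gt0 ?divr_gt0 ?exprn_gt0// mulr_gt0// divr_gt0// exprn_gt0.
have X0 : 0 < V * c ^+ 3 / m ^+ 3.
  exact: (divr_gt0 (mulr_gt0 V0 (exprn_gt0 3 c0)) (exprn_gt0 3 m0)).
pose cc : R := Num.sqrt (V * c ^+ 3 / m ^+ 3).
have cc2 : cc ^+ 2 = V * c ^+ 3 / m ^+ 3.
  by rewrite sqr_sqrtr// ltW.
have cc0 : 0 < cc by rewrite sqrtr_gt0.
have K'1 : 1 <= K' + 2 by rewrite (le_trans (_ : 1 <= 2))// ?ler1n// lerDr.
(* From sqrt r >= K' + 2 the slopes of the box are within 1 of those of the tangent vector, and r >=
   4. *)
exists cc => //; exists ((K' + 2) ^+ 2); first by rewrite exprn_ege1.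
move=> r P r1 [boxP coverP _ [_ _ _ cutP _]].
pose sq : R := Num.sqrt r; pose q : R := Num.sqrt sq.
have sqK : K' + 2 <= sq.
  have : Num.sqrt ((K' + 2) ^+ 2) <= sq by exact: ler_wsqrtr.
  by rewrite sqrtr_sqr ger0_norm// (le_trans ler01).
have r4 : 4 <= r.
  apply: le_trans r1; rewrite (_ : 4 = 2 ^+ 2); last by rewrite expr2; ring.
  by rewrite ler_sqr ?nnegrE ?(le_trans ler01)// lerDr.
have r_ge1 : 1 <= r by apply: le_trans r4; rewrite ler1n.
have r0 : 0 <= r by exact: le_trans r_ge1.
have q2 : q ^+ 2 = sq by rewrite sqr_sqrtr// sqrtr_ge0.
have q1 : 1 <= q by rewrite -(sqrtr1 R) ler_wsqrtr// -(sqrtr1 R) ler_wsqrtr.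
have sq0 : 0 < sq by apply: (lt_le_trans _ sqK); exact: lt_le_trans K'1.
have q0 : 0 < q by exact: lt_le_trans q1.
pose w : R * R * R := n0^-1 *: (1, 0, a0).
have ww : dot w w = 1.
  rewrite /w dotZl dotC dotZl [dot _ _](_ : _ = n0 ^+ 2); last by rewrite n02 /dot /=; ring.
  by field; rewrite gt_eqF.
have rw : enorm (r *: w : R * R * R) = r.
  by rewrite /enorm dotZl dotC dotZl ww mulr1 -expr2 sqrtr_sqr ger0_norm.
have [i _ capw] := coverP _ rw.
have bi := boxP i; have [[_ _ d33 _] _ _ _] := bi.
have dist := cap_direction r_ge1 bi ww capw.
have [al0 al1 slb sla] := tangent_slopes n01 k1 d33 sqK dist.
set b := part_box P i in capw bi d33 dist al0 al1 slb sla *.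
pose sb := (axis3 b).1.2 / (axis3 b).1.1; pose sa := (axis3 b).2 / (axis3 b).1.1.
have K's : K' / sq <= 1 by rewrite ler_pdivrMr// mul1r (le_trans _ sqK)// lerDl.
have sb1 : `|sb| <= 1 by exact: le_trans slb K's.
have sa1 : `|sa| <= 1 + `|a0|.
  rewrite -(subrK a0 sa); apply: le_trans (ler_normD _ _) _; rewrite lerD2r.
  exact: le_trans sla K's.
have h20 : 0 < c * sq by exact: mulr_gt0.
have [f [fhat [[f2 ff] ef suppf valf]]] := exists_tube_packet (box_center r b) x0 sb sa c0 h20 h20.
have suppP (xi : R * R * R) : fhat xi != 0 ->
    curved_box r b (plateau K) xi /\ 1 <= dot xi (axis3 b).
  by move=> /suppf[z1 z2 z3]; exact: (sheared_box_plateau Kv r4 bi (normr_ge0 a0) c0 cN al0 al1 erefl erefl sb1 sa1 z1).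
have [_ _ _ _ plat] := cutP i.
(* The cutoff is 1 on the plateau, so localization leaves the packet unchanged; the other boxes can
   only increase the square function. *)
have cutfhat : cut (cutoff P i) fhat = fhat.
  apply/funext => xi; have [fxi|fxi] := eqVneq (fhat xi) 0; first by rewrite /cut fxi mulr0.
  by rewrite /cut plat ?mul1r//; have [] := suppP xi fxi.
pose E : set (R3 R) := graph_part l1 l2 M `&` [set x | `|x.1.1 - u0.1| <= ep / q /\ `|x.1.2 - u0.2| <= ep / q ^+ 2].
have lowE x : E x -> ((m ^+ 3 / 8) ^+ 2 <= square_function P fhat x ^+ 2).
  move=> [[x2 _ _] [x11 x12]].
  apply: (@le_trans _ _ (cabs (ctrans 1 fhat x) ^+ 2)); last first.
    rewrite /square_function [leRHS]sqr_sqrtr; last by apply: sumr_ge0 => j _; exact: sqr_ge0.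
    have -> : ctrans 1 fhat x = localize (cutoff P i) fhat x by rewrite localizeE cutfhat.
    rewrite (bigD1 i)// lerDl.
    by apply: sumr_ge0 => j _; exact: sqr_ge0.
  have slb' : `|sb| <= K' / q ^+ 2 by rewrite q2.
  have sla' : `|sa - l1 * u0.1| <= K' / q ^+ 2 by rewrite q2.
  have ep01 : 0 < ep <= 1 by rewrite ep0.
  have := @tube_coordinates _ l1 l2 u0.1 u0.2 c ep K' sa sb q _ _ q1 c0 ep01 K'0 epW slb' sla' x11 x12.
  rewrite [_ + (x.1.1 - _)]addrC [_ + (x.1.2 - _)]addrC !subrK -!surjective_pairing -x2 q2 => -[w1 w2 w3].
  rewrite (valf (x : R * R * R)) -x0E ler_sqr ?nnegrE; last 2 first.
  - by rewrite divr_ge0// exprn_ge0// ltW.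
  - by rewrite mulr_ge0 ?exprn_ge0 ?(ltW m0)// !mulr_ge0 ?sinc2_ge0.
  rewrite ler_pM2l ?exprn_gt0//.
  have s1 := sinc2_half w1; have s2 := sinc2_half w2; have s3 := sinc2_half w3.
  have -> : (8^-1 : R) = 2^-1 * 2^-1 * 2^-1 by field.
  exact: (ler_pM (mulr_ge0 _ _) _ (ler_pM _ _ s1 s2) s3).
have sq_ge0 x : (0 <= (square_function P fhat x ^+ 2)%:E)%E by rewrite lee_fin sqr_ge0.
have low : ((V / q ^+ 3)%:E <= \int[muQ]_x (square_function P fhat x ^+ 2)%:E)%E.
  have m80 : 0 <= (m ^+ 3 / 8) ^+ 2 by exact: sqr_ge0.
  have mE := measurable_H2_set (measurable_surface_rectangle u0.1 u0.2 (ep / q) (ep / q ^+ 2)).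
  have lowE' x : E x -> (((m ^+ 3 / 8) ^+ 2)%:E <= (square_function P fhat x ^+ 2)%:E)%E.
    by move=> Ex; rewrite lee_fin; exact: lowE.
  apply: le_trans (integral_ge_const muQ mE m80 sq_ge0 lowE').
  rewrite /V -mulrA EFinM lee_wpmul2l ?lee_fin// -mulrA.
  by apply: (surface_rectangle_ge Uu0 kap0 ep0 q1 rhoU eprho epd); rewrite x0E.
have Vq : 0 < V / q ^+ 3 by rewrite divr_gt0// exprn_gt0.
exists f, fhat, i; split => //.
- exact: (fourier_support_box Kv r_ge1 bi).
- rewrite Lnorm2E poweR_gt0//; apply: lt_le_trans low; rewrite lte_fin//.
- rewrite Lnorm2E L2normE; apply: poweR_half_ge.
  + by apply: mulr_ge0; [exact: ltW|exact: powR_ge0].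
  + exact: integral_ge0.
  + exact: energy_ge0.
  apply: le_trans low; rewrite exprMn powR_eighth// -/sq -/q cc2.
  (* The energy is at most of order q^-4 and the integral at least of order q^-3, so their ratio is
     at least of order q = (r^(1/8))^2. *)
  apply: (@le_trans _ _ ((V * c ^+ 3 / m ^+ 3 * q)%:E * (m ^+ 3 / (c * (c * sq) * (c * sq)))%:E)%E).
    apply: lee_wpmul2l => //; rewrite lee_fin; apply: mulr_ge0; last exact: ltW.
    by rewrite -cc2 sqr_ge0.
  rewrite -EFinM lee_fin -q2 le_eqVlt; apply/orP; left; apply/eqP.
  by apply: cancel; rewrite gt_eqF.
Qed.

End ExtremalPacket.

Theorem theorem1p2 (R : realType) (U : set (R * R)) (l1 l2 : R)
    (chi : R3 R -> R) (K : partition_constants R)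
    (S := graph_over (quadratic l1 l2) U)
    (mchi : measurable_fun [set: H2space R] (chi \_ S))
    (chi0 : forall x, 0 <= (chi \_ S) x)
    (muQ := surface_measure mchi chi0) :
  open U -> connected U -> U !=set0 -> bounded_set U ->
  0 < l1 * l2 ->
  (Lnorm (H2 R) +oo (fun x => ((chi \_ S) x)%:E) < +oo)%E ->
  compactly_supported_in_patch (quadratic l1 l2) U chi ->
  valid_constants K ->
  exists2 R0 : R, 1 <= R0 &
  forall P : R -> freq_partition R,
  (forall r, 1 <= r -> is_freq_partition K r (P r)) ->
  let upper_bound (alpha C r : R) :=
    forall f fhat : R3 R -> R[i],
      inL2 f -> is_fourier f fhat -> fourier_support fhat `<=` annulus r ->
      (Lnorm muQ 2%:E (fun x => (square_function (P r) fhat x)%:E)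
        <= (C * r `^ alpha)%:E * L2norm f)%E in
  [/\ exists2 C : R, 0 < C & forall r, R0 <= r -> upper_bound 8^-1 C r,
      exists2 C : R, 0 < C & forall r, 1 <= r < R0 -> upper_bound 8^-1 C r &
      (exists x0 v0 : R3 R, exists delta kappa : R,
        [/\ S x0, unit_tangent (quadratic l1 l2) x0 v0, 0 < delta, 0 < kappa &
         {ae H2 R, forall x, S x -> eucl_dist x x0 < delta -> kappa <= chi x}]) ->
      (exists2 c : R, 0 < c &
       exists f fhat : R -> R3 R -> R[i], \forall r \near +oo,
        [/\ inL2 (f r), is_fourier (f r) (fhat r), L2norm (f r) != 0%E,
            exists i, fourier_support (fhat r) `<=` box_set r (part_box (P r) i) &
            ((c * r `^ 8^-1)%:E * L2norm (f r)
              <= Lnorm muQ 2%:E (fun x => (square_function (P r) (fhat r) x)%:E))%E])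
      /\ (forall alpha C : R,
           (\forall r \near +oo, upper_bound alpha C r) -> 8^-1 <= alpha)].
Proof.
move=> oU _ _ bU l12 chiN _ Kv.
have [M M1 SG] := bounded_graph_part l1 l2 bU.
have [B B0 muB] := surface_measure_le mchi chi0 SG (measurable_graph_part l1 l2 M) chiN.
have [D D0 up] := square_function_upper l12 M1 Kv B0 muB.
(* The estimate is uniform in r >= 1, so the threshold can be 1. *)
exists 1 => // P partP upper_bound.
have ub r : 1 <= r -> upper_bound 8^-1 D r.
  by move=> r1 f fhat f2 ff _; exact: (up r (P r) r1 (partP r r1) f fhat f2 ff).
split; [by exists D|by exists D => // r /andP[r1 _]; exact: ub|].
move=> [x0 [v0 [delta [kappa [Sx0 _ d0 k0 aek]]]]].
have [c c0 [r1 r11 low]] := square_function_lower mchi chi0 oU Kv M1 SG Sx0 d0 k0 aek.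
pose good r (p : (R3 R -> R[i]) * (R3 R -> R[i])) := r1 <= r -> exists i,
  [/\ inL2 p.1, is_fourier p.1 p.2, fourier_support p.2 `<=` box_set r (part_box (P r) i),
    (0 < Lnorm muQ 2%:E (fun x => (square_function (P r) p.2 x)%:E))%E &
    ((c * r `^ 8^-1)%:E * L2norm p.1 <= Lnorm muQ 2%:E (fun x => (square_function (P r) p.2 x)%:E))%E].
have [F FP] : {F & forall r, good r (F r)}.
  apply: choice => r; have [r1r|rr1] := leP r1 r; last first.
    by exists ((fun=> 0), (fun=> 0)) => r1r; move: rr1; rewrite ltNge r1r.
  by have [f [fhat fP]] := low r (P r) r1r (partP r (le_trans r11 r1r)); exists (f, fhat).
(* Nonvanishing comes from the upper bound: a packet of norm 0 would have a square function of norm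
   0. *)
have F0 r : r1 <= r -> L2norm (F r).1 != 0%E.
  move=> r1r; have [i [f2 ff _ pos _]] := FP r r1r.
  apply/eqP => f0; have := up r (P r) (le_trans r11 r1r) (partP r (le_trans r11 r1r)) _ _ f2 ff.
  by rewrite f0 mule0 leNgt pos.
split.
  exists c => //; exists (fun r => (F r).1), (fun r => (F r).2), r1; split; first exact: num_real.
  move=> r /ltW r1r; have [i [f2 ff sup _ le]] := FP r r1r.
  by split => //; [exact: F0|exists i].
move=> alpha C [N [_ NP]]; rewrite leNgt; apply/negP => al8.
pose d := 8^-1 - alpha; have dp : 0 < d by rewrite subr_gt0.
(* If alpha < 1/8, the two bounds at one r give c r^d <= C; the choice of [T] makes r^d at least |C|
   / c + 1 as soon as r >= T. *)
pose T := (`|C| / c + 1) `^ d^-1.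
pose r := Num.max r1 (Num.max (N + 1) T).
have r1r : r1 <= r by rewrite le_max lexx.
have Nr : N < r by rewrite !lt_max ltrDl ltr01 orbT.
have Tr : T <= r by rewrite !le_max lexx !orbT.
have r0 : 0 < r by apply: (lt_le_trans ltr01); exact: le_trans r11 r1r.
have [i [f2 ff sup _ le]] := FP r r1r.
(* The box lies in the annulus, so the packet is admissible in the assumed upper bound. *)
have [[_ _ sub _] _] : is_box K r (part_box (P r) i) /\ True.
  by have [bx _ _ _] := partP r (le_trans r11 r1r); split.
have := le_trans le (NP r Nr _ _ f2 ff (subset_trans sup sub)).
have Lfin : L2norm (F r).1 \is a fin_num.
  by case: f2 => _ _ f2; rewrite ge0_fin_numE// L2normE poweR_ge0.
have Lpos : (0 < L2norm (F r).1)%E by rewrite lt0e F0//= L2normE poweR_ge0.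
rewrite lee_pmul2r// lee_fin (_ : 8^-1 = alpha + d); last by rewrite /d addrC subrK.
rewrite powRD; last by rewrite (gt_eqF r0) implybT.
rewrite mulrCA mulrC ler_pM2r ?powR_gt0// => cC.
have C0 : 0 <= `|C| / c by rewrite divr_ge0// ltW.
have : T `^ d <= r `^ d.
  by apply: ge0_ler_powR; rewrite ?nnegrE ?powR_ge0// ltW.
rewrite -powRrM mulVf ?gt_eqF// powRr1 ?addr_ge0// => Tle.
have : c * (`|C| / c + 1) <= C by apply: le_trans cC; rewrite ler_pM2l.
rewrite mulrDr mulr1 mulrCA divff ?gt_eqF// mulr1.
by have := ler_norm C; lra.
Qed.
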